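(* Let $\mathfrak g$ be a complex simple simply-laced Lie algebra with root system $\Phi$ and set of simple roots $\Pi$, and let $\mathcal C$ and the functors $\mathcal E_\alpha,\mathcal F_\alpha,\mathcal K_\alpha^{\pm1}:\mathcal C\to\mathcal C$ ($\alpha\in\Pi$) be as in the context. For all $\alpha,\beta\in\Pi$ there are isomorphisms of functors $$\mathcal K_\alpha\mathcal K_\alpha^{-1}\cong \mathrm{Id}\cong\mathcal K_\alpha^{-1}\mathcal K_\alpha,\qquad \mathcal K_\alpha\mathcal K_\beta\cong\mathcal K_\beta\mathcal K_\alpha,$$ $$\mathcal K_\alpha\mathcal E_\beta\cong\mathcal E_\beta\mathcal K_\alpha\{(\alpha,\beta)\},\qquad \mathcal K_\alpha\mathcal F_\beta\cong\mathcal F_\beta\mathcal K_\alpha\{-(\alpha,\beta)\},$$ $$\mathcal E_\alpha\mathcal F_\beta\cong\mathcal F_\beta\mathcal E_\alpha\quad\text{if }\alpha\neq\beta,$$ $$\mathcal E_\alpha\mathcal E_\beta\cong\mathcal E_\beta\mathcal E_\alpha,\quad \mathcal F_\alpha\mathcal F_\beta\cong\mathcal F_\beta\mathcal F_\alpha\quad\text{if }(\alpha,\beta)=0,$$ $$\mathcal E_\alpha^2\mathcal E_\beta\oplus\mathcal E_\beta\mathcal E_\alpha^2\cong(\mathrm{Id}\{1\}\oplus\mathrm{Id}\{-1\})\,\mathcal E_\alpha\mathcal E_\beta\mathcal E_\alpha\quad\text{if }(\alpha,\beta)=-1,$$ $$\mathcal F_\alpha^2\mathcal F_\beta\oplus\mathcal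 F_\beta\mathcal F_\alpha^2\cong(\mathrm{Id}\{1\}\oplus\mathrm{Id}\{-1\})\,\mathcal F_\alpha\mathcal F_\beta\mathcal F_\alpha\quad\text{if }(\alpha,\beta)=-1.$$
   Context: $(\cdot,\cdot)$ is the Weyl-group-invariant bilinear form on $\mathbb R\Phi$ with $(\alpha,\alpha)=2$ for all roots; $\Gamma$ is the Dynkin diagram of $\mathfrak g$, with vertices indexed by $\Pi$. Zigzag algebra $A(\Gamma)$ over $\mathbb C$: replace each edge of $\Gamma$ by two oppositely oriented edges to get the double $D\Gamma$; a path is written as the list $(a_1|\dots|a_k)$ of vertices it visits; product is concatenation of paths. If $\Gamma$ has more than two vertices, $A(\Gamma)$ is the path algebra of $D\Gamma$ modulo the ideal generated by $(a|b|c)$ for $a$–$b$, $b$–$c$ edges with $a\ne c$, and $(a|b|a)-(a|c|a)$ whenever $a$ is connected to $b$ and $c$. If $\Gamma$ is a single edge with two vertices, quotient by all paths of length $>2$. If $\Gamma$ is one vertex, $A(\Gamma)=\mathbb C[X]/(X^2)$. It is graded by path length ($\deg X=2$ for one vertex). $P_\alpha=A(\Gamma)(\alpha)$ and ${}_\alpha P=(\alpha)A(\Gamma)$ are the left and right projective modules of the idempotent $(\alpha)$ (length-zero path). For a graded module $M$, $M\{k\}_n=M_{n-k}$, and $\{k\}$ denotes the shift functor. The category $\mathcal C=\bigoplus_{\mu\in\Phi\cup\{0\}}\mathcal C_\mu$: $\mathcal C_0$ is the category of finite-dimensional graded left $A(\Gamma)$-modules with grading-preserving maps; for $\mu\in\Phi$,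 $\mathcal C_\mu$ is the category of finite-dimensional graded complex vector spaces, with $\mathbb C_\mu\in\mathcal C_\mu$ one-dimensional in degree $0$. Functors $\mathcal C\to\mathcal C$ (tensor products over $\mathbb C$ unless indicated): for $M\in\mathcal C_0$, $\mathcal E_\alpha(M)=({}_\alpha P\otimes_{A(\Gamma)}M)\otimes\mathbb C_\alpha$, $\mathcal F_\alpha(M)=({}_\alpha P\otimes_{A(\Gamma)}M)\otimes\mathbb C_{-\alpha}$. For $M\in\mathcal C_\mu$, $\mu\neq0$: both are $0$ if $(\mu,\alpha)=0$; $\mathcal E_\alpha M=0$, $\mathcal F_\alpha M=M\otimes\mathbb C_{\mu-\alpha}$ if $(\mu,\alpha)=1$; $\mathcal E_\alpha M=M\otimes\mathbb C_{\mu+\alpha}$, $\mathcal F_\alpha M=0$ if $(\mu,\alpha)=-1$; $\mathcal E_\alpha M=0$, $\mathcal F_\alpha M=P_\alpha\otimes M\{-1\}$ if $\mu=\alpha$; $\mathcal E_\alpha M=P_\alpha\otimes M\{-1\}$, $\mathcal F_\alpha M=0$ if $\mu=-\alpha$. $\mathcal K_\alpha^{\pm1}(M)=M\{\pm(\mu,\alpha)\}$ for $M\in\mathcal C_\mu$. *)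

(* Defs.v *)
From HB Require Import structures.
From mathcomp Require Import all_boot all_order all_algebra.
From mathcomp Require Import boolp reals complex.
From mathcomp Require Import finmap monalg.

Set Implicit Arguments.
Unset Strict Implicit.
Unset Printing Implicit Defensive.

Import Order.TTheory GRing.Theory Num.Theory.

Local Open Scope ring_scope.

(* Equality of morphisms, quotients by arbitrary relations and choices use the
   classical axioms of boolp. *)

(* [M] is the direct sum of the subspaces [deg n], n : int; [sc] is the
   scalar multiplication by the ground field. *)
Record is_grading (K : fieldType) (M : zmodType) (sc : K -> M -> M)
    (deg : int -> M -> Prop) : Prop := IsGrading {
  deg0 : forall n, deg n 0;
  degB : forall n x y, deg n x -> deg n y -> deg n (x - y);
  degZ : forall n c x, deg n x -> deg n (sc c x);
  deg_span : forall x, exists (s : seq int) (f : int -> M),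
    [/\ uniq s, forall n, deg n (f n) & x = \sum_(n <- s) f n];
  deg_free : forall (s : seq int) (f : int -> M), uniq s ->
    (forall n, deg n (f n)) -> \sum_(n <- s) f n = 0 ->
    forall n, n \in s -> f n = 0 }.

Definition is_findim (K : fieldType) (M : zmodType) (sc : K -> M -> M) : Prop :=
  exists s : seq M, forall x, exists c : nat -> K,
    x = \sum_(i < size s) sc (c i) s`_i.

Lemma grading_of_components (K : fieldType) (M : zmodType) (sc : K -> M -> M)
    (deg : int -> M -> Prop) (p : int -> M -> M) :
  (forall n, deg n 0) ->
  (forall n x y, deg n x -> deg n y -> deg n (x - y)) ->
  (forall n c x, deg n x -> deg n (sc c x)) ->
  (forall n, {morph p n : x y / x + y}) ->
  (forall n x, deg n (p n x)) ->
  (forall n x, deg n x -> p n x = x) ->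
  (forall m n x, deg m x -> m != n -> p n x = 0) ->
  (forall x, exists2 s : seq int, uniq s & x = \sum_(n <- s) p n x) ->
  is_grading sc deg.
Proof.
move=> d0 dD dZ pD pdeg pid pneq pspan; split=> //.
  by move=> x; have [s us ex] := pspan x; exists s, (p^~ x); split.
move=> s f us fdeg sum0 n ns.
have p0 k : p k 0 = 0 by apply: (addrI (p k 0)); rewrite -pD !addr0.
have := congr1 (p n) sum0; rewrite p0 (big_morph (p n) (pD n) (p0 n)) => <-.
rewrite (bigD1_seq n) //= (pid n) ?big1 ?addr0 //.
by move=> i ni; apply: pneq (fdeg i) _.
Qed.

Section Components.
Variables (K : fieldType) (M : zmodType) (sc : K -> M -> M).
Variables (deg : int -> M -> Prop) (dM : is_grading sc deg).

Lemma component_key x : {sf : seq int * (int -> M) |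
  [/\ uniq sf.1, forall n, deg n (sf.2 n) & x = \sum_(n <- sf.1) sf.2 n]}.
Proof.
apply: cid; have [s [f h]] := deg_span dM x.
by exists (s, f).
Qed.

Definition component (n : int) (x : M) : M :=
  let sf := sval (component_key x) in if n \in sf.1 then sf.2 n else 0.

Lemma component_deg n x : deg n (component n x).
Proof.
rewrite /component; case: (component_key x) => -[s f] /= [_ h _].
by case: ifP => // _; apply: (deg0 dM).
Qed.

Lemma degN n x : deg n x -> deg n (- x).
Proof. by move=> dx; rewrite -sub0r; apply: (degB dM) => //; apply: (deg0 dM). Qed.

Lemma degD n x y : deg n x -> deg n y -> deg n (x + y).
Proof. by move=> dx dy; rewrite -[y]opprK; apply: (degB dM) => //; apply: degN. Qed.

Lemma deg_sum n (I : Type) (r : seq I) (P : pred I) (F : I -> M) :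
  (forall i, P i -> deg n (F i)) -> deg n (\sum_(i <- r | P i) F i).
Proof.
by move=> h; apply: big_ind => //; [apply: (deg0 dM) | apply: degD].
Qed.

Lemma component_eq (s : seq int) (f : int -> M) n : uniq s ->
  (forall n, deg n (f n)) ->
  component n (\sum_(m <- s) f m) = if n \in s then f n else 0.
Proof.
move=> us fd; rewrite /component; case: (component_key _) => -[t g] /=.
move=> [ut gd e].
pose F (u : seq int) (h : int -> M) m := if m \in u then h m else 0.
have Fd u h m : (forall n, deg n (h n)) -> deg m (F u h m).
  by move=> hd; rewrite /F; case: ifP => _ //; apply: (deg0 dM).
pose w := undup (s ++ t).
have Fsum u h : uniq u -> {subset u <= w} ->
    \sum_(m <- w) F u h m = \sum_(m <- u) h m.
  move=> uu uw; rewrite /F -big_mkcond /= -big_filter; apply: perm_big.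
  apply: uniq_perm; rewrite ?filter_uniq ?undup_uniq // => m.
  by rewrite mem_filter; case: (boolP (m \in u)) => //= /uw.
have sw : {subset s <= w} by move=> m ms; rewrite mem_undup mem_cat ms.
have tw : {subset t <= w} by move=> m ms; rewrite mem_undup mem_cat ms orbT.
have dd m : deg m (F t g m - F s f m).
  by apply: (degB dM); apply: Fd.
have : \sum_(m <- w) (F t g m - F s f m) = 0.
  by rewrite sumrB !Fsum // e subrr.
move=> /(deg_free dM (undup_uniq _) dd)/(_ n) h.
have [nw|nw] := boolP (n \in w).
  by apply/eqP; rewrite -subr_eq0; apply/eqP/h.
case: ifP => [/tw|_]; first by rewrite (negPf nw).
by case: ifP => [/sw|_] //; rewrite (negPf nw).
Qed.

Lemma component_id n x : deg n x -> component n x = x.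
Proof.
move=> dx; pose f m := if m == n then x else 0.
have fd m : deg m (f m).
  by rewrite /f; case: eqP => [->|_] //; apply: (deg0 dM).
have -> : x = \sum_(m <- [:: n]) f m by rewrite big_seq1 /f eqxx.
by rewrite component_eq // inE eqxx big_seq1.
Qed.

Lemma component_neq m n x : deg m x -> m != n -> component n x = 0.
Proof.
move=> dx mn; pose f k := if k == m then x else 0.
have fd k : deg k (f k).
  by rewrite /f; case: eqP => [->|_] //; apply: (deg0 dM).
have -> : x = \sum_(k <- [:: m]) f k by rewrite big_seq1 /f eqxx.
by rewrite component_eq // inE eq_sym (negPf mn).
Qed.

Lemma component_span x :
  exists2 s : seq int, uniq s & x = \sum_(n <- s) component n x.
Proof.
have [s [f [us fd e]]] := deg_span dM x; exists s => //.
rewrite {1}e; apply: eq_big_seq => n ns.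
by rewrite e component_eq // ns.
Qed.

Lemma component_supp x (w : seq int) : uniq w ->
  (forall n, n \notin w -> component n x = 0) ->
  x = \sum_(n <- w) component n x.
Proof.
move=> uw out; have [s us ex] := component_span x.
have ins n : n \notin s -> component n x = 0.
  move=> /negPf ns; rewrite ex component_eq // ?ns // => m.
  exact: component_deg.
rewrite {1}ex (bigID (mem w)) /= [X in _ + X]big1 ?addr0; last by move=> i /out.
rewrite -big_filter [RHS](bigID (mem s)) /= [X in _ + X]big1 ?addr0.
  rewrite -[RHS]big_filter; apply: perm_big; apply: uniq_perm.
  - exact: filter_uniq.
  - exact: filter_uniq.
  - by move=> m; rewrite !mem_filter andbC.
by move=> i /ins.
Qed.

Lemma componentD n : {morph component n : x y / x + y}.
Proof.
move=> x y; have [s us ex] := component_span x.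
have [t ut ey] := component_span y.
pose F (u : seq int) z m := if m \in u then component m z else 0.
pose w := undup (s ++ t).
have Fsum u z : uniq u -> {subset u <= w} ->
    \sum_(m <- w) F u z m = \sum_(m <- u) component m z.
  move=> uu uw; rewrite /F -big_mkcond /= -big_filter; apply: perm_big.
  apply: uniq_perm; rewrite ?filter_uniq ?undup_uniq // => m.
  by rewrite mem_filter; case: (boolP (m \in u)) => //= /uw.
have Fd u z m : deg m (F u z m).
  by rewrite /F; case: ifP => _; [apply: component_deg|apply: (deg0 dM)].
have sw : {subset s <= w} by move=> m ms; rewrite mem_undup mem_cat ms.
have tw : {subset t <= w} by move=> m ms; rewrite mem_undup mem_cat ms orbT.
have Fc u z : uniq u -> z = \sum_(n <- u) component n z ->
    component n z = F u z n.
  move=> uu ez; rewrite /F {1}ez component_eq // => m; exact: component_deg.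
rewrite (Fc s x) // (Fc t y) //.
have -> : x + y = \sum_(m <- w) (F s x m + F t y m).
  by rewrite big_split /= !Fsum // -ex -ey.
rewrite component_eq ?undup_uniq //; last first.
  by move=> m; apply: degD.
case: ifPn => // nw; rewrite /F !ifN ?addr0 //.
  by apply: contra nw => /tw.
by apply: contra nw => /sw.
Qed.

Lemma componentB n : {morph component n : x y / x - y}.
Proof.
by move=> x y; apply/eqP; rewrite eq_sym subr_eq -componentD subrK.
Qed.

Lemma component0 n : component n 0 = 0.
Proof. by apply: component_id; apply: (deg0 dM). Qed.

Lemma component_sum n (I : Type) (r : seq I) (P : pred I) (F : I -> M) :
  component n (\sum_(i <- r | P i) F i) = \sum_(i <- r | P i) component n (F i).
Proof. exact: (big_morph _ (componentD n) (component0 n)). Qed.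

End Components.

(* A possibly zero ring suffices as carrier; [galg_scal] is the structure map
   of the K-algebra. *)
Record galg (K : fieldType) := GAlg {
  galg_ring :> pzRingType;
  galg_scal : {rmorphism K -> galg_ring};
  galg_deg : int -> galg_ring -> Prop;
  galg_central : forall c x, galg_scal c * x = x * galg_scal c;
  galg_grading : is_grading (fun c x => galg_scal c * x) galg_deg;
  galg_deg1 : galg_deg 0 1;
  galg_degM : forall m n x y,
    galg_deg m x -> galg_deg n y -> galg_deg (m + n) (x * y) }.

Arguments galg_scal {K} A : rename.
Arguments galg_deg {K} A : rename.

Section Ideal.
Variables (K : fieldType) (A : galg K) (S : A -> Prop).

Inductive ideal : A -> Prop :=
| ideal_gen a s b : S s -> ideal (a * s * b)
| ideal_zero : ideal 0
| ideal_add x y : ideal x -> ideal y -> ideal (x + y).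

Lemma ideal_sub x : S x -> ideal x.
Proof. by move=> Sx; rewrite -[x]mul1r -[1 * x]mulr1; apply: ideal_gen. Qed.

Lemma ideal_opp x : ideal x -> ideal (- x).
Proof.
elim=> [a s b Ss||y z _ iy _ iz]; rewrite ?oppr0 ?opprD.
- by rewrite -!mulNr; apply: ideal_gen.
- exact: ideal_zero.
- exact: ideal_add.
Qed.

Lemma ideal_mull a x : ideal x -> ideal (a * x).
Proof.
elim=> [c s b Ss||y z _ iy _ iz]; rewrite ?mulr0 ?mulrDr.
- by rewrite !mulrA; apply: ideal_gen.
- exact: ideal_zero.
- exact: ideal_add.
Qed.

Lemma ideal_mulr a x : ideal x -> ideal (x * a).
Proof.
elim=> [c s b Ss||y z _ iy _ iz]; rewrite ?mul0r ?mulrDl.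
- by rewrite -mulrA; apply: ideal_gen.
- exact: ideal_zero.
- exact: ideal_add.
Qed.

Definition in_ideal : {pred A} := fun x => `[< ideal x >].

Lemma in_ideal_zmod_closed : zmod_closed in_ideal.
Proof.
split=> [|x y]; rewrite !unfold_in; first by apply/asboolP; apply: ideal_zero.
move=> /asboolP ix /asboolP iy; apply/asboolP; apply: ideal_add => //.
exact: ideal_opp.
Qed.

HB.instance Definition _ := GRing.isZmodClosed.Build A in_ideal
  in_ideal_zmod_closed.

Definition quo : Type := Quotient.quot in_ideal.
HB.instance Definition _ := GRing.Zmodule.on quo.

Definition quo_pi (x : A) : quo := (\pi_(Quotient.quot in_ideal) x)%qT.
Definition quo_repr (x : quo) : A := repr x.

Lemma quo_reprK : cancel quo_repr quo_pi.
Proof. exact: reprK. Qed.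

Lemma quo_piP x y : ideal (x - y) <-> quo_pi x = quo_pi y.
Proof.
split=> [i|/eqP]; last by rewrite -Quotient.idealrBE => /asboolP.
by apply/eqP; rewrite -Quotient.idealrBE; apply/asboolP.
Qed.

Lemma quo_piD x y : quo_pi (x + y) = quo_pi x + quo_pi y.
Proof. by rewrite /quo_pi !piE. Qed.

Lemma quo_piN x : quo_pi (- x) = - quo_pi x.
Proof. by rewrite /quo_pi !piE. Qed.

Lemma quo_pi0 : quo_pi 0 = 0.
Proof. by rewrite /quo_pi !piE. Qed.

Lemma quo_repr_pi x : ideal (quo_repr (quo_pi x) - x).
Proof. by apply/quo_piP; rewrite quo_reprK. Qed.

Definition quo_mul (x y : quo) : quo := quo_pi (quo_repr x * quo_repr y).

Lemma quo_pi_mul x y : quo_pi (x * y) = quo_mul (quo_pi x) (quo_pi y).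
Proof.
apply/esym/quo_piP; set x' := quo_repr _; set y' := quo_repr _.
have -> : x' * y' - x * y = (x' - x) * y' + x * (y' - y).
  by rewrite mulrBl mulrBr addrA subrK.
by apply: ideal_add; [apply: ideal_mulr|apply: ideal_mull]; apply: quo_repr_pi.
Qed.

Lemma quo_mulA : associative quo_mul.
Proof.
move=> x y z; rewrite -[x]quo_reprK -[y]quo_reprK -[z]quo_reprK.
by rewrite -!quo_pi_mul mulrA.
Qed.

Lemma quo_mul1 : left_id (quo_pi 1) quo_mul.
Proof. by move=> x; rewrite -[x]quo_reprK -quo_pi_mul mul1r. Qed.

Lemma quo_mulr1 : right_id (quo_pi 1) quo_mul.
Proof. by move=> x; rewrite -[x]quo_reprK -quo_pi_mul mulr1. Qed.

Lemma quo_mulDl : left_distributive quo_mul +%R.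
Proof.
move=> x y z; rewrite -[x]quo_reprK -[y]quo_reprK -[z]quo_reprK.
by rewrite -quo_piD -!quo_pi_mul mulrDl quo_piD.
Qed.

Lemma quo_mulDr : right_distributive quo_mul +%R.
Proof.
move=> x y z; rewrite -[x]quo_reprK -[y]quo_reprK -[z]quo_reprK.
by rewrite -quo_piD -!quo_pi_mul mulrDr quo_piD.
Qed.

HB.instance Definition _ := GRing.Zmodule_isPzRing.Build quo
  quo_mulA quo_mul1 quo_mulr1 quo_mulDl quo_mulDr.

Lemma quo_piM x y : quo_pi (x * y) = quo_pi x * quo_pi y.
Proof. exact: quo_pi_mul. Qed.

Definition quo_scal (c : K) : quo := quo_pi (galg_scal A c).

Lemma quo_scal_zmod : zmod_morphism quo_scal.
Proof. by move=> c d; rewrite /quo_scal rmorphB quo_piD quo_piN. Qed.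

Lemma quo_scal_monoid : monoid_morphism quo_scal.
Proof.
split=> [|c d]; first by rewrite /quo_scal rmorph1.
by rewrite /quo_scal rmorphM quo_piM.
Qed.

HB.instance Definition _ := GRing.isZmodMorphism.Build K quo quo_scal
  quo_scal_zmod.
HB.instance Definition _ := GRing.isMonoidMorphism.Build K quo quo_scal
  quo_scal_monoid.

Definition quo_deg (n : int) (x : quo) : Prop :=
  exists2 a, galg_deg A n a & x = quo_pi a.

Hypothesis homS : forall s, S s -> exists n, galg_deg A n s.

Let cmp := component (galg_grading A).

Lemma ideal_component n x : ideal x -> ideal (cmp n x).
Proof.
pose gA := galg_grading A.
elim=> [a s b /[dup] Ss /homS[d ds]||y z _ iy _ iz]; last 2 first.
- by rewrite /cmp component0; apply: ideal_zero.
- by rewrite /cmp componentD; apply: ideal_add.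
have [u _ ->] := component_span gA a; have [v _ ->] := component_span gA b.
rewrite !mulr_suml /cmp component_sum.
apply: big_ind => [||i _]; [exact: ideal_zero|exact: ideal_add|].
rewrite mulr_sumr component_sum.
apply: big_ind => [||j _]; [exact: ideal_zero|exact: ideal_add|].
set t := _ * _ * _.
have dt : galg_deg A (i + d + j) t.
  by do 2?apply: galg_degM => //; apply: component_deg.
case: (i + d + j =P n) => [e|/eqP ne].
  by rewrite component_id -?e //; apply: ideal_gen.
by rewrite (component_neq gA dt) //; apply: ideal_zero.
Qed.

Let qcmp n x := quo_pi (cmp n (quo_repr x)).

Lemma quo_pi_component n a : qcmp n (quo_pi a) = quo_pi (cmp n a).
Proof.
apply/quo_piP; rewrite /cmp -componentB; apply: ideal_component.
exact: quo_repr_pi.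
Qed.

Lemma quo_grading : is_grading (fun c x => quo_scal c * x) quo_deg.
Proof.
pose gA := galg_grading A.
apply: (@grading_of_components _ _ _ _ qcmp).
- by move=> n; exists 0; [apply: (deg0 gA) | rewrite quo_pi0].
- move=> n _ _ [a da ->] [b db ->]; exists (a - b); first exact: (degB gA).
  by rewrite quo_piD quo_piN.
- move=> n c _ [a da ->]; exists (galg_scal A c * a); first exact: (degZ gA).
  by rewrite quo_piM.
- move=> n x y; rewrite -[x]quo_reprK -[y]quo_reprK -quo_piD.
  by rewrite !quo_pi_component -quo_piD /cmp componentD.
- by move=> n x; exists (cmp n (quo_repr x)); first exact: component_deg.
- by move=> n _ [a da ->]; rewrite quo_pi_component /cmp component_id.
- move=> m n _ [a da ->] mn.
  by rewrite quo_pi_component /cmp (component_neq gA da) // quo_pi0.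
move=> x; have [s us e] := component_span gA (quo_repr x); exists s => //.
rewrite -[LHS]quo_reprK {1}e.
by rewrite (big_morph quo_pi quo_piD quo_pi0).
Qed.

Lemma quo_central c (x : quo) : quo_scal c * x = x * quo_scal c.
Proof. by rewrite -[x]quo_reprK -!quo_piM galg_central. Qed.

Lemma quo_deg1 : quo_deg 0 1.
Proof. by exists 1 => //; apply: galg_deg1. Qed.

Lemma quo_degM m n x y :
  quo_deg m x -> quo_deg n y -> quo_deg (m + n) (x * y).
Proof.
move=> [a da ->] [b db ->]; exists (a * b); first exact: galg_degM.
by rewrite quo_piM.
Qed.

Definition quo_galg : galg K :=
  GAlg quo_central quo_grading quo_deg1 quo_degM.

End Ideal.

Section Span.
Variables (K : fieldType) (M : zmodType) (sc : K -> M -> M).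
Hypotheses (sc0 : forall x, sc 0 x = 0) (sc1 : forall x, sc 1 x = x).
Hypothesis scDl : forall c d x, sc (c + d) x = sc c x + sc d x.

Inductive in_span (s : seq M) : M -> Prop :=
| span_zero : in_span s 0
| span_add c x y : x \in s -> in_span s y -> in_span s (sc c x + y).

Lemma span_findim (s : seq M) : (forall x, in_span s x) -> is_findim sc.
Proof.
move=> h; exists s => x; elim: (h x) => [|c y z ys _ [f ez]].
  by exists (fun=> 0); rewrite big1.
exists (fun i => (if i == index y s then c else 0) + f i).
rewrite (eq_bigr _ (fun i _ => scDl _ _ _)) big_split /= -ez; congr (_ + _).
have ylt : (index y s < size s)%N by rewrite index_mem.
rewrite (bigD1 (Ordinal ylt)) //= eqxx nth_index // big1 ?addr0 // => i ni.
by case: eqP => // e; case/eqP: ni; apply/val_inj.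
Qed.

Lemma spanD s x y : in_span s x -> in_span s y -> in_span s (x + y).
Proof.
elim=> [|c z t zs _ IH] iy; rewrite ?add0r // -addrA.
by apply: span_add => //; apply: IH.
Qed.

Lemma span_sum (s : seq M) (I : Type) (r : seq I) (F : I -> M) :
  (forall i, in_span s (F i)) -> in_span s (\sum_(i <- r) F i).
Proof.
by move=> h; apply: big_ind => //; [apply: span_zero | apply: spanD].
Qed.

Lemma span_gen (s : seq M) c x : x \in s -> in_span s (sc c x).
Proof.
by move=> xs; rewrite -[sc c x]addr0; apply: span_add => //; apply: span_zero.
Qed.

Lemma findim_span : is_findim sc -> exists s, forall x, in_span s x.
Proof.
case=> s h; exists s => x; have [c ->] := h x.
by apply: span_sum => i; apply: span_gen; apply: mem_nth.
Qed.

Lemma span_sub (s t : seq M) x : {subset s <= t} -> in_span s x -> in_span t x.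
Proof.
move=> st; elim=> [|c y z ys _ IH]; first exact: span_zero.
by apply: span_add => //; apply: st.
Qed.

End Span.

Lemma span_map (K : fieldType) (M N : zmodType) (sc : K -> M -> M)
    (sc' : K -> N -> N) (f : M -> N) s x :
  {morph f : x y / x + y} -> (forall c x, f (sc c x) = sc' c (f x)) ->
  in_span sc s x -> in_span sc' (map f s) (f x).
Proof.
move=> fD fZ; elim=> [|c y z ys _ IH].
  have -> : f 0 = 0 by apply: (addrI (f 0)); rewrite -fD !addr0.
  exact: span_zero.
by rewrite fD fZ; apply: span_add => //; apply: map_f.
Qed.

Notation algebra_findim A := (is_findim (fun c (x : A) => galg_scal A c * x)).

Lemma algebra_span_findim (K : fieldType) (A : galg K) (s : seq A) :
  (forall x, in_span (fun c (x : A) => galg_scal A c * x) s x) ->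
  algebra_findim A.
Proof.
apply: span_findim => [x|c d x]; first by rewrite rmorph0 mul0r.
by rewrite rmorphD mulrDl.
Qed.

Section BaseAlgebras.
Variable K : fieldType.

Definition ground_deg (n : int) (x : K) : Prop := x != 0 -> n = 0.

Lemma ground_grading : is_grading (fun c x : K => (c : K) * x) ground_deg.
Proof.
apply: (@grading_of_components _ _ _ _ (fun n x => if n == 0 then x else 0)).
- by move=> n; rewrite /ground_deg eqxx.
- move=> n x y dx dy; have [x0|/dx -> //] := eqVneq x 0.
  have [y0|/dy -> //] := eqVneq y 0.
  by rewrite x0 y0 /ground_deg subrr eqxx.
- move=> n c x dx; rewrite /ground_deg mulf_eq0 negb_or => /andP[_]; exact: dx.
- by move=> n x y; case: ifP; rewrite ?addr0.
- by move=> n x; rewrite /ground_deg; case: (n =P 0) => // _; rewrite eqxx.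
- move=> n x dx; case: (n =P 0) => // n0; apply/esym/eqP.
  by apply: contraT => /dx.
- move=> m n x dx mn; case: (n =P 0) => // n0; apply/eqP; apply: contraT => /dx m0.
  by rewrite m0 n0 eqxx in mn.
by move=> x; exists [:: 0] => //; rewrite big_seq1 eqxx.
Qed.

Lemma ground_central (c x : K) : c * x = x * c. Proof. exact: mulrC. Qed.

Lemma ground_deg1 : ground_deg 0 1. Proof. by []. Qed.

Lemma ground_degM m n x y :
  ground_deg m x -> ground_deg n y -> ground_deg (m + n) (x * y).
Proof.
move=> dx dy; rewrite /ground_deg mulf_eq0 negb_or => /andP[/dx -> /dy ->].
by rewrite addr0.
Qed.

Definition ground : galg K :=
  @GAlg K K idfun ground_deg ground_central ground_grading ground_deg1
    ground_degM.

Definition poly_deg (n : int) (p : {poly K}) : Prop :=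
  forall i, p`_i != 0 -> n = (2 * i)%:Z.

Definition poly_cmp (n : int) (p : {poly K}) : {poly K} :=
  \poly_(i < size p) (if n == (2 * i)%:Z then p`_i else 0).

Lemma coef_poly_cmp n p i :
  (poly_cmp n p)`_i = if n == (2 * i)%:Z then p`_i else 0.
Proof.
by rewrite coef_poly; case: ltnP => // le; rewrite nth_default ?if_same.
Qed.

Lemma poly_grading : is_grading (fun c p => c%:P * p) poly_deg.
Proof.
apply: (@grading_of_components _ _ _ _ poly_cmp).
- by move=> n i; rewrite coef0 eqxx.
- move=> n p q dp dq i; rewrite coefB.
  have [->|/dp -> //] := eqVneq p`_i 0.
  have [->|/dq -> //] := eqVneq q`_i 0.
  by rewrite subrr eqxx.
- move=> n c p dp i; rewrite coefCM mulf_eq0 negb_or => /andP[_]; exact: dp.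
- move=> n p q; apply/polyP=> i; rewrite coefD !coef_poly_cmp coefD.
  by case: ifP; rewrite ?addr0.
- by move=> n p i; rewrite coef_poly_cmp; case: (n =P _) => // _; rewrite eqxx.
- move=> n p dp; apply/polyP=> i; rewrite coef_poly_cmp; case: eqP => // ni.
  by apply/esym/eqP; apply: contraT => /dp.
- move=> m n p dp mn; apply/polyP=> i; rewrite coef_poly_cmp coef0.
  case: eqP => // ni; apply/eqP; apply: contraT => /dp mi.
  by rewrite ni mi eqxx in mn.
move=> p; exists [seq (2 * i)%:Z | i <- iota 0 (size p)].
  rewrite map_inj_uniq ?iota_uniq // => i j [] /eqP.
  by rewrite eqn_mul2l /= => /eqP.
apply/polyP=> i; rewrite coef_sum big_map.
under eq_bigr => j _ do rewrite coef_poly_cmp eqz_nat eqn_mul2l /=.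
have [le|lt] := leqP (size p) i.
  by rewrite nth_default // big1 // => j _; rewrite if_same.
rewrite (bigD1_seq i) ?iota_uniq ?mem_iota //= eqxx big1 ?addr0 // => j ji.
by rewrite (negPf ji).
Qed.

Lemma poly_central c (p : {poly K}) : c%:P * p = p * c%:P.
Proof. exact: mulrC. Qed.

Lemma poly_deg1 : poly_deg 0 1.
Proof. by move=> [|i]; rewrite coef1 //= eqxx. Qed.

Lemma poly_degM m n p q :
  poly_deg m p -> poly_deg n q -> poly_deg (m + n) (p * q).
Proof.
move=> dp dq i; rewrite coefM => h.
have [j] : exists j : 'I_i.+1, p`_j * q`_(i - j) != 0.
  apply/existsP; apply: contraNT h; rewrite negb_exists => /forallP h.
  by rewrite big1 // => j _; apply/eqP; have := h j; rewrite negbK.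
rewrite mulf_eq0 negb_or => /andP[/dp -> /dq ->].
by rewrite -PoszD -mulnDr subnKC // -ltnS.
Qed.

Definition poly_galg : galg K :=
  @GAlg K {poly K} (@polyC K) poly_deg poly_central poly_grading poly_deg1
    poly_degM.

Variant square_rel : poly_galg -> Prop := SquareRel : square_rel ('X ^+ 2).

Lemma square_rel_homogeneous p : square_rel p -> exists n, poly_deg n p.
Proof.
case=> {p}; exists 4%:Z => i; rewrite coefXn.
by case: (i =P 2%N) => [->|_]; rewrite ?eqxx.
Qed.

Definition dual_numbers : galg K :=
  @quo_galg K poly_galg square_rel square_rel_homogeneous.

Lemma dual_numbers_findim : algebra_findim dual_numbers.
Proof.
pose pi : poly_galg -> dual_numbers := @quo_pi K poly_galg square_rel.
apply: (@algebra_span_findim _ _ [:: pi 1; pi 'X]) => x.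
set p : {poly K} := quo_repr x.
pose P : {poly K} := (p`_0)%:P * 1 + (p`_1)%:P * 'X.
have -> : x = pi P.
  rewrite -[x]quo_reprK -/p.
  apply/quo_piP; rewrite -[_ - _]/(p - P).
  have eP : take_poly 2 p = P.
    apply/polyP=> i; rewrite /P coef_take_poly mulr1 coefD coefC coefCM coefX.
    by case: i => [|[|i]]; rewrite /= ?mulr0 ?mulr1 ?addr0 ?add0r.
  have -> : p - P = (1 : {poly K}) * 'X ^+ 2 * drop_poly 2 p.
    rewrite -{1}(poly_take_drop 2 p) eP addrAC subrr add0r mul1r.
    exact: mulrC.
  exact: (@ideal_gen _ poly_galg _ 1 ('X ^+ 2)).
rewrite /pi quo_piD !quo_piM -[_ * _ + _]/(_ + _).
apply: span_add; first by rewrite inE eqxx.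
by apply: span_gen; rewrite !inE eqxx orbT.
Qed.

End BaseAlgebras.

Section LinearExtension.
Variables (K : fieldType) (P : choiceType) (V : lmodType K) (h : P -> V).

Definition lin (f : {malg K[P]}) : V := \sum_(p <- msupp f) f@_p *: h p.

Lemma linEw (f : {malg K[P]}) (d : {fset P}) :
  (msupp f `<=` d)%fset -> lin f = \sum_(p <- d) f@_p *: h p.
Proof.
move=> sub; rewrite /lin (big_fset_incl _ sub) // => p _ /mcoeff_outdom ->.
by rewrite scale0r.
Qed.

Lemma linD : {morph lin : f g / f + g}.
Proof.
move=> f g; pose d := (msupp f `|` msupp g)%fset.
rewrite (@linEw (f + g) d) ?msuppD_le // (@linEw f d) ?fsubsetUl //.
rewrite (@linEw g d) ?fsubsetUr // -big_split /=.
by apply: eq_bigr => p _; rewrite mcoeffD scalerDl.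
Qed.

Lemma lin0 : lin 0 = 0.
Proof. by rewrite /lin msupp0 big_seq_fset0. Qed.

Lemma linZ c f : lin (c *: f) = c *: lin f.
Proof.
rewrite (@linEw (c *: f) (msupp f)) ?msuppZ_le // scaler_sumr.
by apply: eq_bigr => p _; rewrite mcoeffZ scalerA.
Qed.

Lemma linU c p : lin << c *g p >> = c *: h p.
Proof. by rewrite (linEw msuppU_le) big_seq_fset1 mcoeffUU. Qed.

Lemma lin_sum (I : Type) (r : seq I) (F : I -> {malg K[P]}) :
  lin (\sum_(i <- r) F i) = \sum_(i <- r) lin (F i).
Proof. exact: (big_morph _ linD lin0). Qed.

End LinearExtension.

Lemma malgUZ (K : fieldType) (P : choiceType) (c : K) (p : P) :
  << c *g p >> = c *: << p >>.
Proof. by apply/malgP=> q; rewrite mcoeffZ !mcoeffU mulrnAr mulr1. Qed.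

Lemma malg_ind (K : fieldType) (P : choiceType) (Q : {malg K[P]} -> Prop) :
  Q 0 -> (forall f g, Q f -> Q g -> Q (f + g)) ->
  (forall c p, Q (c *: << p >>)) -> forall f, Q f.
Proof.
move=> Q0 QD QU f; rewrite (monalgE f).
by apply: big_ind => // p _; rewrite malgUZ.
Qed.

Section PathAlgebra.
Variables (K : fieldType) (I : finType) (e : rel I).

(* The path (a_1|...|a_k) is the sequence of the vertices it visits; its
   length is k - 1. *)
Definition is_walk (s : seq I) : bool :=
  if s is a :: s' then path e a s' else false.

Record qpath := QPath { qpath_seq :> seq I; qpathP : is_walk qpath_seq }.

HB.instance Definition _ := [isSub for qpath_seq].
HB.instance Definition _ := [Choice of qpath by <:].

Definition qlength (s : seq I) : nat := (size s).-1.

(* (a_1|...|a_k)(b_1|...|b_l) = (a_1|...|a_k|b_2|...|b_l) if a_k = b_1; the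
   value [::], which is not a path, stands for the product zero. *)
Definition cat_walk (s t : seq I) : seq I :=
  match s, t with
  | a :: s', b :: t' => if last a s' == b then a :: s' ++ t' else [::]
  | _, _ => [::]
  end.

Definition path_alg : Type := {malg K[qpath]}.
HB.instance Definition _ := GRing.Lmodule.on path_alg.

(* The basis element given by the path s, 0 if s is not a path. *)
Definition walk (s : seq I) : path_alg :=
  if insub s is Some p then << (p : qpath) >> else 0.

Definition path_mul (f g : path_alg) : path_alg :=
  lin (fun p : qpath => lin (fun q : qpath => walk (cat_walk p q)) g) f.

Definition path_one : path_alg := \sum_(a : I) walk [:: a].

Lemma walkE (p : qpath) : walk p = << p >>.
Proof. by rewrite /walk valK. Qed.

Lemma walk0 s : ~~ is_walk s -> walk s = 0.
Proof. by move=> ns; rewrite /walk insubN. Qed.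

Lemma cat_walkA : associative cat_walk.
Proof.
case=> [|a s] [|b t] [|c u] //=; first by case: ifP.
have [<-|ne] := eqVneq (last a s) b.
  rewrite /= last_cat; case: ifP => //=; rewrite ?eqxx ?catA //.
by case: ifP => //=; rewrite (negPf ne).
Qed.

Lemma is_walk_cat s t : is_walk s -> is_walk t -> cat_walk s t != [::] ->
  is_walk (cat_walk s t).
Proof.
case: s t => [|a s] [|b t] //= ps pt; case: (last a s =P b) => // ab _ /=.
by rewrite cat_path ps ab.
Qed.

Lemma path_mulUU p q : path_mul << p >> << q >> = walk (cat_walk p q).
Proof. by rewrite /path_mul !linU !scale1r. Qed.

Lemma path_mulDl : left_distributive path_mul +%R.
Proof. by move=> f g h; rewrite /path_mul linD. Qed.

Lemma path_mulDr : right_distributive path_mul +%R.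
Proof.
move=> f g h; rewrite /path_mul /lin -big_split /=; apply: eq_bigr => p _.
by rewrite -scalerDr -linD.
Qed.

Lemma path_mulZl c f g : path_mul (c *: f) g = c *: path_mul f g.
Proof. by rewrite /path_mul linZ. Qed.

Lemma path_mulZr c f g : path_mul f (c *: g) = c *: path_mul f g.
Proof.
rewrite /path_mul {1 3}/lin scaler_sumr; apply: eq_bigr => p _.
by rewrite linZ !scalerA mulrC.
Qed.

Lemma path_mul0 f : path_mul 0 f = 0. Proof. by rewrite /path_mul lin0. Qed.

Lemma path_mulr0 f : path_mul f 0 = 0.
Proof. by rewrite /path_mul {1}/lin big1 // => p _; rewrite lin0 scaler0. Qed.

Lemma path_mul_walk s t : is_walk s -> is_walk t ->
  path_mul (walk s) (walk t) = walk (cat_walk s t).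
Proof.
move=> ws wt; rewrite (walkE (QPath ws)) (walkE (QPath wt)).
by rewrite path_mulUU.
Qed.

Lemma path_mul_catl s t (r : qpath) : is_walk s -> is_walk t ->
  path_mul (walk (cat_walk s t)) << r >> = walk (cat_walk (cat_walk s t) r).
Proof.
move=> ws wt; have [->|ne] := eqVneq (cat_walk s t) [::].
  by rewrite (@walk0 [::]) // path_mul0.
by rewrite -walkE path_mul_walk ?is_walk_cat //; apply: qpathP.
Qed.

Lemma path_mul_catr s t (r : qpath) : is_walk s -> is_walk t ->
  path_mul << r >> (walk (cat_walk s t)) = walk (cat_walk r (cat_walk s t)).
Proof.
move=> ws wt; have [->|ne] := eqVneq (cat_walk s t) [::].
  have -> : cat_walk r [::] = [::] by case: (r : seq I).
  by rewrite (@walk0 [::]) // path_mulr0.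
by rewrite -walkE path_mul_walk ?is_walk_cat //; apply: qpathP.
Qed.

Lemma path_mulA : associative path_mul.
Proof.
move=> f g h; move: f; apply: malg_ind => [|f f' IH IH'|c p].
- by rewrite !path_mul0.
- by rewrite !path_mulDl IH IH'.
rewrite 3!path_mulZl; congr (_ *: _); move: g.
apply: malg_ind => [|f f' IH IH'|d q].
- by rewrite path_mul0 !path_mulr0 path_mul0.
- by rewrite !(path_mulDl, path_mulDr) IH IH'.
rewrite path_mulZl 2!path_mulZr path_mulZl; congr (_ *: _); move: h.
apply: malg_ind => [|f f' IH IH'|b r].
- by rewrite !path_mulr0.
- by rewrite 3!path_mulDr IH IH'.
rewrite !path_mulZr !path_mulUU path_mul_catl ?path_mul_catr ?qpathP //.
by rewrite cat_walkA.
Qed.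

Lemma path_mul1 : left_id path_one path_mul.
Proof.
apply: malg_ind => [|f g ef eg|c p]; first by rewrite path_mulr0.
  by rewrite path_mulDr ef eg.
rewrite path_mulZr; congr (_ *: _).
rewrite /path_one (big_morph (path_mul^~ << p >>) (fun f g => path_mulDl f g _) (path_mul0 _)).
rewrite -walkE; case: p => -[|a s] //= ps.
rewrite (bigD1 a) //= path_mul_walk //= eqxx big1 ?addr0 // => b ba.
by rewrite path_mul_walk //= (negPf ba) walk0.
Qed.

Lemma path_mulr1 : right_id path_one path_mul.
Proof.
apply: malg_ind => [|f g ef eg|c p]; first by rewrite path_mul0.
  by rewrite path_mulDl ef eg.
rewrite path_mulZl; congr (_ *: _).
rewrite /path_one (big_morph (path_mul << p >>) (fun f g => path_mulDr _ f g) (path_mulr0 _)).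
rewrite -walkE; case: p => -[|a s] //= ps.
rewrite (bigD1 (last a s)) //= path_mul_walk //= eqxx cats0 big1 ?addr0 // => b.
by move=> ba; rewrite path_mul_walk //= eq_sym (negPf ba) walk0.
Qed.

HB.instance Definition _ := GRing.Zmodule_isPzRing.Build path_alg
  path_mulA path_mul1 path_mulr1 path_mulDl path_mulDr.

Definition path_scal (c : K) : path_alg := c *: (1 : path_alg).

Lemma path_scal_mul c (f : path_alg) : path_scal c * f = c *: f.
Proof. by rewrite -[LHS]/(path_mul _ _) path_mulZl path_mul1. Qed.

Lemma path_scal_zmod : zmod_morphism path_scal.
Proof. by move=> c d; rewrite /path_scal scalerBl. Qed.

Lemma path_scal_monoid : monoid_morphism path_scal.
Proof.
split=> [|c d]; first by rewrite /path_scal scale1r.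
by rewrite path_scal_mul /path_scal scalerA.
Qed.

HB.instance Definition _ := GRing.isZmodMorphism.Build K path_alg path_scal
  path_scal_zmod.
HB.instance Definition _ := GRing.isMonoidMorphism.Build K path_alg path_scal
  path_scal_monoid.

Lemma path_central c (f : path_alg) : path_scal c * f = f * path_scal c.
Proof.
rewrite path_scal_mul -[RHS]/(path_mul _ _) /path_scal path_mulZr.
by rewrite path_mulr1.
Qed.

Definition path_deg (n : int) (f : path_alg) : Prop :=
  forall p : qpath, f@_p != 0 -> n = (qlength p)%:Z.

Definition path_cmp (n : int) (f : path_alg) : path_alg :=
  lin (fun p : qpath => if n == (qlength p)%:Z then << p >> else 0) f.

Lemma mcoeff_path_cmp n f (p : qpath) :
  (path_cmp n f)@_p = if n == (qlength p)%:Z then f@_p else 0.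
Proof.
move: f; apply: malg_ind => [|f g ef eg|c q].
- by rewrite /path_cmp lin0 mcoeff0 if_same.
- by rewrite /path_cmp linD !mcoeffD ef eg; case: ifP; rewrite ?addr0.
rewrite /path_cmp linZ linU scale1r !mcoeffZ mcoeffU.
have [->|ne] := eqVneq q p; last first.
  by rewrite mulr0 if_same; case: ifP; rewrite ?mcoeff0 ?mulr0 // mcoeffU (negPf ne) mulr0.
by case: ifP; rewrite ?mcoeff0 ?mulr0 // mcoeffUU mulr1.
Qed.

Lemma path_degB n f g : path_deg n f -> path_deg n g -> path_deg n (f - g).
Proof.
move=> df dg p; rewrite mcoeffB.
have [->|/df -> //] := eqVneq f@_p 0.
have [->|/dg -> //] := eqVneq g@_p 0.
by rewrite subrr eqxx.
Qed.

Lemma path_deg_zero n : path_deg n 0.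
Proof. by move=> p; rewrite mcoeff0 eqxx. Qed.

Lemma path_degD n f g : path_deg n f -> path_deg n g -> path_deg n (f + g).
Proof.
move=> df dg; rewrite -[g]opprK; apply: path_degB => //.
by rewrite -sub0r; apply: path_degB => //; apply: path_deg_zero.
Qed.

Lemma path_degZ n c f : path_deg n f -> path_deg n (c *: f).
Proof.
by move=> df p; rewrite mcoeffZ mulf_eq0 negb_or => /andP[_]; apply: df.
Qed.

Lemma walk_deg s : path_deg (qlength s)%:Z (walk s).
Proof.
have [ws|/walk0 ->] := boolP (is_walk s); last exact: path_deg_zero.
rewrite (walkE (QPath ws)) => p; rewrite mcoeffU.
by case: (QPath ws =P p) => [<-|_] //; rewrite eqxx.
Qed.

Lemma path_grading : is_grading (fun c f => path_scal c * f) path_deg.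
Proof.
apply: (@grading_of_components _ _ _ _ path_cmp).
- exact: path_deg_zero.
- exact: path_degB.
- by move=> n c f df; rewrite path_scal_mul; apply: path_degZ.
- by move=> n f g; rewrite /path_cmp linD.
- by move=> n f p; rewrite mcoeff_path_cmp; case: (n =P _) => // _; rewrite eqxx.
- move=> n f df; apply/malgP=> p; rewrite mcoeff_path_cmp; case: (n =P _) => // ne.
  by apply/esym/eqP; apply: contraT => /df.
- move=> m n f df mn; apply/malgP=> p; rewrite mcoeff_path_cmp mcoeff0.
  case: (n =P _) => // np; apply/eqP; apply: contraT => /df mp.
  by rewrite np mp eqxx in mn.
move=> f; exists (undup [seq (qlength p)%:Z | p : qpath <- msupp f]).
  exact: undup_uniq.
apply/malgP=> p; rewrite raddf_sum /=.
under eq_bigr => n _ do rewrite mcoeff_path_cmp.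
have [p0|pn0] := eqVneq f@_p 0; first by rewrite big1 // => n _; rewrite p0 if_same.
rewrite (bigD1_seq (qlength p)%:Z) ?undup_uniq //=; last first.
  by rewrite mem_undup; apply/mapP; exists p => //; rewrite -mcoeff_neq0.
by rewrite eqxx big1 ?addr0 // => n /negPf ->.
Qed.

Lemma path_deg1 : path_deg 0 1.
Proof.
apply: (big_ind (path_deg 0)); [exact: path_deg_zero | exact: path_degD |].
by move=> a _; apply: (@walk_deg [:: a]).
Qed.

Lemma path_degM m n f g :
  path_deg m f -> path_deg n g -> path_deg (m + n) (f * g).
Proof.
move=> df dg; rewrite -[f * g]/(path_mul f g) /path_mul /lin.
rewrite big_seq; apply: big_ind => [||p pf]; [exact: path_deg_zero | exact: path_degD |].
apply: path_degZ; rewrite big_seq.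
apply: big_ind => [||q qg]; [exact: path_deg_zero | exact: path_degD |].
apply: path_degZ; rewrite (df p) ?mcoeff_neq0 // (dg q) ?mcoeff_neq0 //.
have := @walk_deg (cat_walk p q); case: p pf q qg => -[|a s] //= ps _ [[|b t] //= pt] _.
case: ifP => _ h; first by rewrite /qlength /= size_cat in h *.
by rewrite (@walk0 [::]) //; apply: path_deg_zero.
Qed.

Definition path_galg : galg K :=
  @GAlg K path_alg path_scal path_deg path_central path_grading path_deg1
    path_degM.

End PathAlgebra.

Section Zigzag.
Variables (K : fieldType) (I : finType) (e : rel I).

Local Notation PA := (path_galg K e).
Local Notation walk := (walk K e).

Variant long_path_rel : PA -> Prop :=
| LongPath (p : qpath e) : (2 < qlength p)%N -> long_path_rel (walk p).

Variant zigzag_rel : PA -> Prop :=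
| ZigzagStraight a b c : e a b -> e b c -> a != c ->
    zigzag_rel (walk [:: a; b; c])
| ZigzagLoop a b c : e a b -> e a c ->
    zigzag_rel (walk [:: a; b; a] - walk [:: a; c; a]).

Lemma long_path_homogeneous f :
  long_path_rel f -> exists n, galg_deg PA n f.
Proof. by case=> p _; exists (qlength p)%:Z; apply: walk_deg. Qed.

Lemma zigzag_homogeneous f : zigzag_rel f -> exists n, galg_deg PA n f.
Proof.
case=> [a b c _ _ _|a b c _ _]; exists 2%:Z; first exact: walk_deg.
by apply: path_degB; apply: walk_deg.
Qed.

(* [vg_vertex a] is the class of the path (a) of length zero. *)
Record vertex_galg := VertexGAlg {
  vg_alg :> galg K;
  vg_vertex : I -> vg_alg;
  vg_deg : forall a, galg_deg vg_alg 0 (vg_vertex a);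
  vg_idem : forall a, vg_vertex a * vg_vertex a = vg_vertex a }.

Lemma vertex_deg (S : PA -> Prop) a : quo_deg (S := S) 0 (quo_pi S (walk [:: a])).
Proof. by exists (walk [:: a]) => //; apply: (@walk_deg _ _ _ [:: a]). Qed.

Lemma vertex_idem (S : PA -> Prop) a :
  quo_pi S (walk [:: a]) * quo_pi S (walk [:: a]) = quo_pi S (walk [:: a]).
Proof.
rewrite -quo_piM -[_ * _]/(path_mul _ _) path_mul_walk //=.
by rewrite eqxx.
Qed.

Definition path_quotient (S : PA -> Prop)
    (homS : forall f, S f -> exists n, galg_deg PA n f) : vertex_galg :=
  @VertexGAlg (quo_galg homS) (fun a => quo_pi S (walk [:: a]))
    (@vertex_deg S) (@vertex_idem S).

Definition one_vertex : vertex_galg :=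
  @VertexGAlg (dual_numbers K) (fun=> 1)
    (fun=> galg_deg1 _) (fun=> mulr1 1).

(* The graph with vertex set I and adjacency relation e, assumed symmetric
   and irreflexive.  Its double has one arrow from a to b whenever e a b. *)
Definition zigzag : vertex_galg :=
  if #|I| == 1%N then one_vertex
  else if #|I| == 2%N then path_quotient long_path_homogeneous
  else path_quotient zigzag_homogeneous.

Definition short_walks : seq (seq I) :=
  [seq tval t | t : 1.-tuple I] ++ [seq tval t | t : 2.-tuple I]
  ++ [seq tval t | t : 3.-tuple I].

Lemma mem_short_walks s : is_walk e s -> (qlength s <= 2)%N ->
  s \in short_walks.
Proof.
have mem n (t : n.-tuple I) : tval t \in [seq tval t | t : n.-tuple I].
  by apply/imageP; exists t.
rewrite !mem_cat; case: s => [|a [|b [|c [|? ?]]]] // _ _.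
- by rewrite (mem 1%N [tuple a]).
- by rewrite (mem 2%N [tuple a; b]) orbT.
by rewrite (mem 3%N [tuple a; b; c]) !orbT.
Qed.

Lemma path_quotient_findim (S : PA -> Prop) 
    (homS : forall f, S f -> exists n, galg_deg PA n f) :
  (forall p : qpath e, (2 < qlength p)%N -> ideal S (walk p)) ->
  algebra_findim (quo_galg homS).
Proof.
move=> long.
apply: (@algebra_span_findim _ (quo_galg homS) [seq quo_pi S (walk s) | s <- short_walks]) => x.
rewrite -[x]quo_reprK; set f : path_alg K e := quo_repr x.
rewrite (monalgE f) (big_morph (quo_pi S) (@quo_piD _ _ S) (@quo_pi0 _ _ S)).
apply: span_sum => p; rewrite malgUZ -walkE -path_scal_mul quo_piM.
have [short|/long lp] := leqP (qlength p) 2; last first.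
  suff -> : quo_pi S (walk p) = 0 by rewrite mulr0; apply: span_zero.
  by rewrite -(@quo_pi0 _ _ S); apply/quo_piP; rewrite subr0.
by apply: span_gen; apply: map_f; apply: mem_short_walks => //; apply: qpathP.
Qed.

Hypothesis e_sym : symmetric e.
Hypothesis e_conn : forall D : {set I}, D != set0 -> D != setT ->
  exists a b, [/\ a \in D, b \notin D & e a b].

Lemma zigzag_long (p : qpath e) : (2 < #|I|)%N -> (2 < qlength p)%N ->
  ideal zigzag_rel (walk p).
Proof.
move=> cI; case: p => -[|a [|b [|c [|d s]]]] //= ps _.
have /and4P[eab ebc ecd eds] := ps.
have split4 : walk [:: a, b, c, d & s] = walk [:: a; b; c; d] * walk (d :: s).
  rewrite -[RHS]/(path_mul _ _) path_mul_walk /= ?eab ?ebc ?ecd //.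
  by rewrite eqxx.
rewrite split4; apply: (@ideal_mulr _ PA).
have gen := @ideal_sub _ PA zigzag_rel.
have straightl x y z t : e x y -> e y z -> e z t -> x != z ->
    ideal zigzag_rel (walk [:: x; y; z; t]).
  move=> xy yz zt xz.
  have -> : walk [:: x; y; z; t] = walk [:: x; y; z] * walk [:: z; t].
    by rewrite -[RHS]/(path_mul _ _) path_mul_walk /= ?xy ?yz ?zt // eqxx.
  by apply: (@ideal_mulr _ PA); apply: gen; apply: ZigzagStraight.
have straightr x y z t : e x y -> e y z -> e z t -> y != t ->
    ideal zigzag_rel (walk [:: x; y; z; t]).
  move=> xy yz zt yt.
  have -> : walk [:: x; y; z; t] = walk [:: x; y] * walk [:: y; z; t].
    by rewrite -[RHS]/(path_mul _ _) path_mul_walk /= ?xy ?yz ?zt // eqxx.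
  by apply: (@ideal_mull _ PA); apply: gen; apply: ZigzagStraight.
have [ac|] := eqVneq a c; last exact: straightl.
have [bd|] := eqVneq b d; last exact: straightr.
rewrite -{}ac -{}bd in ebc ecd * => {c d s ps eds split4}.
have D0 : [set a; b] != set0 by apply/set0Pn; exists a; rewrite !inE eqxx.
have DT : [set a; b] != setT.
  apply: contraTneq cI => DT; rewrite -leqNgt -cardsT -DT cards2.
  by case: (a != b).
have [x [y []]] := e_conn D0 DT; rewrite !inE negb_or.
case/orP=> /eqP-> /andP[ya yb] exy.
  have -> : walk [:: a; b; a; b] =
      (walk [:: a; b; a] - walk [:: a; y; a]) * walk [:: a; b]
      + walk [:: a; y; a; b].
    have eya : e y a by rewrite e_sym.
    rewrite mulrBl -![_ * _]/(path_mul _ _) !path_mul_walk /= ?eab ?ebc ?exy ?eya //.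
    by rewrite eqxx subrK.
  apply: ideal_add; last by apply: straightr; rewrite // e_sym.
  by apply: (@ideal_mulr _ PA); apply: gen; apply: ZigzagLoop.
have -> : walk [:: a; b; a; b] =
    walk [:: a; b] * (walk [:: b; a; b] - walk [:: b; y; b])
    + walk [:: a; b; y; b].
  have eyb : e y b by rewrite e_sym.
  rewrite mulrBr -![_ * _]/(path_mul _ _) !path_mul_walk /= ?eab ?ebc ?exy ?eyb //.
  by rewrite eqxx subrK.
apply: ideal_add; last by apply: straightl; rewrite // 1?eq_sym // e_sym.
by apply: (@ideal_mull _ PA); apply: gen; apply: ZigzagLoop.
Qed.

Lemma zigzag_findim : algebra_findim zigzag.
Proof.
rewrite /zigzag; case: eqP => [_|c1]; first exact: dual_numbers_findim.
case: eqP => [_|c2].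
  apply: path_quotient_findim => p long.
  by apply: (@ideal_sub _ PA); apply: LongPath.
apply: path_quotient_findim => p long; apply: zigzag_long => //.
have : (0 < #|I|)%N.
  by case: p long => -[|a s] //= _ _; apply/card_gt0P; exists a.
by move: c1 c2; case: #|I| => [|[|[|n]]].
Qed.

End Zigzag.

Section Modules.
Variable K : fieldType.

Record gmod (A : galg K) := GMod {
  gm_mod :> lmodType A;
  gm_deg : int -> gm_mod -> Prop;
  gm_grading : is_grading (fun c (x : gm_mod) => galg_scal A c *: x) gm_deg;
  gm_degZ : forall m n a x,
    galg_deg A m a -> gm_deg n x -> gm_deg (m + n) (a *: x);
  gm_findim : is_findim (fun c (x : gm_mod) => galg_scal A c *: x) }.

Record ghom (A : galg K) (M N : gmod A) := GHom {
  gh_fun :> M -> N;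
  gh_linear : forall a x y, gh_fun (a *: x + y) = a *: gh_fun x + gh_fun y;
  gh_deg : forall n x, gm_deg n x -> gm_deg n (gh_fun x) }.

(* (A, B)-bimodules on which the two actions of K agree. *)
Record gbimod (A B : galg K) := GBimod {
  bm_left :> gmod A;
  bm_act : bm_left -> B -> bm_left;
  bm_actDl : forall x y b, bm_act (x + y) b = bm_act x b + bm_act y b;
  bm_actDr : forall x b c, bm_act x (b + c) = bm_act x b + bm_act x c;
  bm_act1 : forall x, bm_act x 1 = x;
  bm_actM : forall x b c, bm_act x (b * c) = bm_act (bm_act x b) c;
  bm_actZ : forall a x b, bm_act (a *: x) b = a *: bm_act x b;
  bm_act_scal : forall c x, bm_act x (galg_scal B c) = galg_scal A c *: x;
  bm_deg_act : forall m n x b,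
    gm_deg m x -> galg_deg B n b -> gm_deg (m + n) (bm_act x b) }.

Section Hom.
Variable A : galg K.

Lemma module_span_findim (M : lmodType A) (s : seq M) :
  (forall x, in_span (fun c (x : M) => galg_scal A c *: x) s x) ->
  is_findim (fun c (x : M) => galg_scal A c *: x).
Proof.
apply: span_findim => [x|c d x]; first by rewrite rmorph0 scale0r.
by rewrite rmorphD scalerDl.
Qed.

Lemma ghom_eq (M N : gmod A) (f g : ghom M N) : f =1 g -> f = g.
Proof.
case: f g => [f lf df] [g lg dg] /= /funext fg; case: _ / fg in lg dg *.
by congr GHom; apply: Prop_irrelevance.
Qed.

Lemma ghomD (M N : gmod A) (f : ghom M N) : {morph f : x y / x + y}.
Proof. by move=> x y; rewrite -[x in LHS]scale1r gh_linear scale1r. Qed.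

Lemma ghom0 (M N : gmod A) (f : ghom M N) : f 0 = 0.
Proof. by apply: (addrI (f 0)); rewrite -ghomD !addr0. Qed.

Lemma ghomZ (M N : gmod A) (f : ghom M N) a x : f (a *: x) = a *: f x.
Proof. by rewrite -[_ *: x]addr0 gh_linear ghom0 addr0. Qed.

Definition ghom_id (M : gmod A) : ghom M M :=
  @GHom A M M id (fun _ _ _ => erefl) (fun _ _ d => d).

Lemma ghom_comp_linear (M N P : gmod A) (g : ghom N P) (f : ghom M N) a x y :
  g (f (a *: x + y)) = a *: g (f x) + g (f y).
Proof. by rewrite !gh_linear. Qed.

Definition ghom_comp (M N P : gmod A) (g : ghom N P) (f : ghom M N) :
    ghom M P :=
  @GHom A M P (fun x => g (f x)) (ghom_comp_linear g f)
    (fun n x d => gh_deg g (gh_deg f d)).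

(* M{k}_n = M_(n-k) *)
Definition shift_deg (k : int) (M : gmod A) (n : int) (x : M) : Prop :=
  gm_deg (n - k) x.

Lemma shift_grading k (M : gmod A) :
  is_grading (fun c (x : M) => galg_scal A c *: x) (@shift_deg k M).
Proof.
have g := gm_grading M; split.
- by move=> n; apply: (deg0 g).
- by move=> n x y; apply: (degB g).
- by move=> n c x; apply: (degZ g).
- move=> x; have [s [f [us df ->]]] := deg_span g x.
  exists [seq n + k | n <- s], (fun n => f (n - k)); split.
  + by rewrite map_inj_uniq //; apply: addIr.
  + by move=> n; apply: df.
  by rewrite big_map; apply: eq_bigr => n _; rewrite addrK.
move=> s f us df sum0 n ns.
have := @deg_free _ _ _ _ g [seq n - k | n <- s] (fun n => f (n + k)).
rewrite map_inj_uniq ?us; last exact: addIr.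
rewrite big_map; under eq_bigr => i _ do rewrite subrK.
move=> /(_ isT) h; rewrite -[n](subrK k); apply: h => //.
  by move=> m; have := df (m + k); rewrite /shift_deg addrK.
exact: map_f.
Qed.

Lemma shift_degZ k (M : gmod A) m n a (x : M) :
  galg_deg A m a -> shift_deg k n x -> shift_deg k (m + n) (a *: x).
Proof. by move=> da dx; rewrite /shift_deg -addrA; apply: gm_degZ. Qed.

Definition gshift (k : int) (M : gmod A) : gmod A :=
  @GMod A M (@shift_deg k M) (shift_grading k M) (@shift_degZ k M)
    (gm_findim M).

Definition gshift_hom k (M N : gmod A) (f : ghom M N) :
    ghom (gshift k M) (gshift k N) :=
  @GHom A (gshift k M) (gshift k N) f (gh_linear f)
    (fun n x => @gh_deg _ _ _ f (n - k) x).

Definition zero_deg (n : int) (x : 'rV[A]_0) : Prop := True.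

Lemma zero_grading :
  is_grading (fun c (x : 'rV[A]_0) => galg_scal A c *: x) zero_deg.
Proof.
split=> //.
  by move=> x; exists [::], (fun=> 0); split=> //; apply/rowP; case.
by move=> s f us df sum0 n ns; apply/rowP; case.
Qed.

Lemma zero_findim :
  is_findim (fun c (x : 'rV[A]_0) => galg_scal A c *: x).
Proof. by exists [::] => x; exists (fun=> 0); apply/rowP; case. Qed.

Definition gzero : gmod A :=
  @GMod A 'rV[A]_0 zero_deg zero_grading (fun _ _ _ _ _ _ => I) zero_findim.

Section Sum.
Variables M N : gmod A.

Definition sum_deg (n : int) (x : M * N) : Prop :=
  gm_deg n x.1 /\ gm_deg n x.2.

Lemma sum_grading :
  is_grading (fun c (x : M * N) => galg_scal A c *: x) sum_deg.
Proof.
have gM := gm_grading M; have gN := gm_grading N.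
pose p n (x : M * N) := (component gM n x.1, component gN n x.2).
apply: (@grading_of_components _ _ _ _ p).
- by move=> n; split; [apply: (deg0 gM)|apply: (deg0 gN)].
- by move=> n x y [? ?] [? ?]; split; [apply: (degB gM)|apply: (degB gN)].
- by move=> n c x [? ?]; split; [apply: (degZ gM)|apply: (degZ gN)].
- by move=> n x y; rewrite /p /= !componentD.
- by move=> n x; split; apply: component_deg.
- by move=> n [x y] [/= ? ?]; rewrite /p /= !component_id.
- move=> m n [x y] [/= dx dy] mn.
  by rewrite /p /= (component_neq gM dx) // (component_neq gN dy).
move=> [x y]; have [s [f [us df ex]]] := deg_span gM x.
have [t [h [ut dh ey]]] := deg_span gN y.
exists (undup (s ++ t)); first exact: undup_uniq.
have -> : \sum_(n <- undup (s ++ t)) p n (x, y) =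
    (\sum_(n <- undup (s ++ t)) component gM n x,
     \sum_(n <- undup (s ++ t)) component gN n y).
  by elim: (undup _) => [|n r IH]; rewrite ?big_nil // !big_cons IH.
congr pair; apply: component_supp; rewrite ?undup_uniq // => n.
  rewrite mem_undup mem_cat negb_or => /andP[/negPf ns _].
  by rewrite ex component_eq // ns.
rewrite mem_undup mem_cat negb_or => /andP[_ /negPf nt].
by rewrite ey component_eq // nt.
Qed.

Lemma sum_degZ m n a (x : M * N) :
  galg_deg A m a -> sum_deg n x -> sum_deg (m + n) (a *: x).
Proof. by move=> da [? ?]; split; apply: gm_degZ. Qed.

Lemma sum_findim :
  is_findim (fun c (x : M * N) => galg_scal A c *: x).
Proof.
have [s hs] := findim_span (gm_findim M).
have [t ht] := findim_span (gm_findim N).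
apply: (@module_span_findim (M * N)%type
  ([seq (x, 0) | x <- s] ++ [seq (0, y) | y <- t])) => -[x y].
have -> : (x, y) = (x, 0) + (0, y) by rewrite -[RHS]/(_ + _, _ + _) addr0 add0r.
apply: spanD.
  apply: (@span_sub _ _ _ [seq (x, 0) | x <- s]) => [z zs|].
    by rewrite mem_cat zs.
  apply: (@span_map _ M _ (fun c x => galg_scal A c *: x) _ (fun x => (x, 0))) => //.
    by move=> u v; rewrite -[RHS]/(_ + _, _ + _) addr0.
  by move=> c u; rewrite -[RHS]/(_ *: _, _ *: _) scaler0.
apply: (@span_sub _ _ _ [seq (0, y) | y <- t]) => [z zs|].
  by rewrite mem_cat zs orbT.
apply: (@span_map _ N _ (fun c x => galg_scal A c *: x) _ (fun x => (0, x))) => //.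
  by move=> u v; rewrite -[RHS]/(_ + _, _ + _) addr0.
by move=> c u; rewrite -[RHS]/(_ *: _, _ *: _) scaler0.
Qed.

Definition gsum : gmod A :=
  @GMod A (M * N)%type sum_deg sum_grading sum_degZ sum_findim.

End Sum.

Section SumHom.
Variables (M N M' N' : gmod A) (f : ghom M M') (g : ghom N N').

Definition sum_fun (x : gsum M N) : gsum M' N' := (f x.1, g x.2).

Lemma sum_fun_linear a x y :
  sum_fun (a *: x + y) = a *: sum_fun x + sum_fun y.
Proof. by rewrite /sum_fun /= !gh_linear. Qed.

Lemma sum_fun_deg n x : gm_deg n x -> gm_deg n (sum_fun x).
Proof. by case=> dx dy; split; apply: gh_deg. Qed.

Definition gsum_hom : ghom (gsum M N) (gsum M' N') :=
  GHom sum_fun_linear sum_fun_deg.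

End SumHom.
End Hom.
End Modules.

Lemma findim_window (K : fieldType) (A : galg K) (M : gmod A) :
  exists2 w : seq int, uniq w &
  forall (x : M) i, i \notin w -> component (gm_grading M) i x = 0.
Proof.
pose g := gm_grading M.
have [s hs] := findim_span (gm_findim M).
have [w uw hw] : exists2 w : seq int, uniq w &
    forall n i, n \in s -> i \notin w -> component g i n = 0.
  elim: (s) => [|n r [w uw hw]]; first by exists [::].
  have [t [f [ut df en]]] := deg_span g n.
  exists (undup (t ++ w)) => [|n' i]; first exact: undup_uniq.
  rewrite inE mem_undup mem_cat negb_or => /orP[/eqP->|nr] /andP[it iw].
    by rewrite en component_eq // (negPf it).
  exact: hw.
exists w => // n i iw.
elim: (hs n) => [|c x y xs _ IH]; first by rewrite component0.
rewrite componentD IH addr0 (@component_supp _ _ _ _ g x w uw) //; last first.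
  by move=> j; apply: hw.
rewrite scaler_sumr component_sum big1_seq // => j /andP[_ jw].
apply: (component_neq g (m := j)); last by apply: contraNneq iw => <-.
by apply: (degZ g); apply: component_deg.
Qed.

Section Tensor.
Variables (K : fieldType) (A B : galg K) (N : gbimod A B).

Section Object.
Variable M : gmod B.

(* A sequence of pairs (n, m) stands for the sum of the symbols n (x) m.  The
   tensor product is the quotient of the free commutative monoid of these sums
   by the congruence below; opposites exist thanks to the bilinearity
   relations. *)
Inductive tensor_rel : seq (N * M) -> seq (N * M) -> Prop :=
| tr_refl s : tensor_rel s s
| tr_sym s t : tensor_rel s t -> tensor_rel t s
| tr_trans s t u : tensor_rel s t -> tensor_rel t u -> tensor_rel s u
| tr_cat s s' t t' :
    tensor_rel s s' -> tensor_rel t t' -> tensor_rel (s ++ t) (s' ++ t')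
| tr_swap s t : tensor_rel (s ++ t) (t ++ s)
| tr_zero m : tensor_rel [:: (0, m)] [::]
| tr_addl n n' m : tensor_rel [:: (n + n', m)] [:: (n, m); (n', m)]
| tr_addr n m m' : tensor_rel [:: (n, m + m')] [:: (n, m); (n, m')]
| tr_balance n b m : tensor_rel [:: (bm_act n b, m)] [:: (n, b *: m)].

Definition tensor_relb : rel (seq (N * M)) := fun s t => `[< tensor_rel s t >].

Lemma tensor_relb_equiv : equiv_class_of tensor_relb.
Proof.
split=> [s|s t|t s u].
- by apply/asboolP; apply: tr_refl.
- by apply/asboolP/asboolP => h; apply: tr_sym.
- by move=> /asboolP st /asboolP tu; apply/asboolP; apply: tr_trans st tu.
Qed.

Canonical tensor_equiv := EquivRelPack tensor_relb_equiv.

Definition tensor : Type := {eq_quot tensor_equiv}%qT.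
HB.instance Definition _ := Choice.on tensor.

Definition tpi (s : seq (N * M)) : tensor := (\pi_({eq_quot tensor_equiv}) s)%qT.
Definition trepr (x : tensor) : seq (N * M) := repr x.

Lemma treprK : cancel trepr tpi. Proof. exact: reprK. Qed.

Lemma tpiP s t : tensor_rel s t <-> tpi s = tpi t.
Proof. by split=> [h|/eqquotP /asboolP]; [apply/eqquotP/asboolP|]. Qed.

Lemma trepr_pi s : tensor_rel (trepr (tpi s)) s.
Proof. by apply/tpiP; rewrite treprK. Qed.

Definition tadd (x y : tensor) : tensor := tpi (trepr x ++ trepr y).
Definition topp (x : tensor) : tensor := tpi [seq (- p.1, p.2) | p <- trepr x].

Lemma tpi_cat s t : tpi (s ++ t) = tadd (tpi s) (tpi t).
Proof. by apply/esym/tpiP; apply: tr_cat; apply: trepr_pi. Qed.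

Lemma taddA : associative tadd.
Proof.
by move=> x y z; rewrite -[x]treprK -[y]treprK -[z]treprK -!tpi_cat catA.
Qed.

Lemma taddC : commutative tadd.
Proof.
move=> x y; rewrite -[x]treprK -[y]treprK -!tpi_cat; apply/tpiP; exact: tr_swap.
Qed.

Lemma tadd0 : left_id (tpi [::]) tadd.
Proof. by move=> x; rewrite -[x]treprK -tpi_cat. Qed.

Lemma taddN : left_inverse (tpi [::]) topp tadd.
Proof.
move=> x; rewrite -[x in tadd _ x]treprK /topp -tpi_cat.
elim: (trepr x) => [|[n m] s IH] //.
rewrite -[X in X ++ _]/([:: (- n, m)] ++ _) -[_ :: s]/([:: (n, m)] ++ s).
rewrite !tpi_cat -taddA [tadd (tpi (map _ s)) _]taddC -taddA.
rewrite [tadd (tpi s) _]taddC -[tadd (tpi (map _ s)) (tpi s)]tpi_cat IH.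
rewrite [tadd _ (tpi [::])]taddC tadd0 -tpi_cat; apply/tpiP.
by apply: tr_trans (tr_zero m); apply: tr_sym; rewrite -(addNr n); apply: tr_addl.
Qed.

HB.instance Definition _ := GRing.isZmodule.Build tensor taddA taddC tadd0 taddN.

Definition pure (n : N) (m : M) : tensor := tpi [:: (n, m)].

Lemma tpiD s t : tpi (s ++ t) = tpi s + tpi t. Proof. exact: tpi_cat. Qed.

Lemma tpiE s : tpi s = \sum_(p <- s) pure p.1 p.2.
Proof.
elim: s => [|[n m] s IH]; first by rewrite big_nil.
by rewrite big_cons -IH -tpiD.
Qed.

Lemma tensorE (x : tensor) : x = \sum_(p <- trepr x) pure p.1 p.2.
Proof. by rewrite -tpiE treprK. Qed.

Lemma pureDl n n' m : pure (n + n') m = pure n m + pure n' m.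
Proof. by rewrite -tpiD; apply/tpiP; apply: tr_addl. Qed.

Lemma pureDr n m m' : pure n (m + m') = pure n m + pure n m'.
Proof. by rewrite -tpiD; apply/tpiP; apply: tr_addr. Qed.

Lemma pure0l m : pure 0 m = 0.
Proof. by apply: (addrI (pure 0 m)); rewrite -pureDl !addr0. Qed.

Lemma pure0r n : pure n 0 = 0.
Proof. by apply: (addrI (pure n 0)); rewrite -pureDr !addr0. Qed.

Lemma pure_balance n b m : pure (bm_act n b) m = pure n (b *: m).
Proof. by apply/tpiP; apply: tr_balance. Qed.

Section Lift.
Variables (G : zmodType) (f : N -> M -> G).
Hypothesis fDl : forall n n' m, f (n + n') m = f n m + f n' m.
Hypothesis fDr : forall n m m', f n (m + m') = f n m + f n m'.
Hypothesis fB : forall n b m, f (bm_act n b) m = f n (b *: m).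

Definition tlift (x : tensor) : G := \sum_(p <- trepr x) f p.1 p.2.

Lemma tlift_rel s t : tensor_rel s t ->
  \sum_(p <- s) f p.1 p.2 = \sum_(p <- t) f p.1 p.2.
Proof.
elim=> {s t} [||s t u _ -> _ ->||s t|m|n n' m|n m m'|n b m] //.
- by move=> s s' t t' _ e _ e'; rewrite !big_cat /= e e'.
- by rewrite !big_cat /= addrC.
- rewrite big_seq1 big_nil /=; apply: (addrI (f 0 m)).
  by rewrite -fDl !addr0.
- by rewrite !big_cons !big_nil /= fDl !addr0.
- by rewrite !big_cons !big_nil /= fDr !addr0.
- by rewrite !big_seq1 /= fB.
Qed.

Lemma tlift_pi s : tlift (tpi s) = \sum_(p <- s) f p.1 p.2.
Proof. exact/tlift_rel/trepr_pi. Qed.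

Lemma tlift_pure n m : tlift (pure n m) = f n m.
Proof. by rewrite tlift_pi big_seq1. Qed.

Lemma tliftD : {morph tlift : x y / x + y}.
Proof.
move=> x y; rewrite -{1}[x]treprK -{1}[y]treprK -tpiD tlift_pi.
by rewrite big_cat.
Qed.

End Lift.

Lemma tensor_ext (G : zmodType) (f g : tensor -> G) :
  {morph f : x y / x + y} -> {morph g : x y / x + y} ->
  (forall n m, f (pure n m) = g (pure n m)) -> f =1 g.
Proof.
move=> fD gD fg x.
have z (h : tensor -> G) : {morph h : x y / x + y} -> h 0 = 0.
  by move=> hD; apply: (addrI (h 0)); rewrite -hD !addr0.
rewrite (tensorE x) (big_morph f fD (z f fD)) (big_morph g gD (z g gD)).
by apply: eq_bigr => p _.
Qed.

Definition tscale (a : A) (x : tensor) : tensor :=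
  tlift (fun n m => pure (a *: n) m) x.

Lemma tscale_pure a n m : tscale a (pure n m) = pure (a *: n) m.
Proof.
apply: tlift_pure => [n1 n2 m'|n' m1 m2|n' b m'].
- by rewrite scalerDr pureDl.
- by rewrite pureDr.
- by rewrite -bm_actZ pure_balance.
Qed.

Lemma tscaleDr : right_distributive tscale +%R.
Proof.
move=> a; apply: tliftD => [n1 n2 m'|n' m1 m2|n' b m'].
- by rewrite scalerDr pureDl.
- by rewrite pureDr.
- by rewrite -bm_actZ pure_balance.
Qed.

Lemma tscaleA a b x : tscale a (tscale b x) = tscale (a * b) x.
Proof.
move: x; apply: tensor_ext => [x y|x y|n m]; rewrite ?tscaleDr //.
by rewrite !tscale_pure scalerA.
Qed.

Lemma tscale1 : left_id 1 tscale.
Proof.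
apply: tensor_ext => [x y|x y|n m] //; first by rewrite tscaleDr.
by rewrite tscale_pure scale1r.
Qed.

Lemma tscaleDl x : {morph tscale^~ x : a b / a + b}.
Proof.
move=> a b; move: x; apply: tensor_ext => [x y|x y|n m].
- by rewrite tscaleDr.
- by rewrite !tscaleDr addrACA.
- by rewrite !tscale_pure scalerDl pureDl.
Qed.

HB.instance Definition _ := GRing.Zmodule_isLmodule.Build A tensor
  tscaleA tscale1 tscaleDr tscaleDl.

Lemma pureZ a n m : a *: pure n m = pure (a *: n) m.
Proof. exact: tscale_pure. Qed.

Definition tensor_deg (k : int) (x : tensor) : Prop :=
  exists2 s : seq (N * M), x = \sum_(p <- s) pure p.1 p.2
  & forall p, p \in s -> exists i, gm_deg i p.1 /\ gm_deg (k - i) p.2.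

Lemma pure_deg i j n m : gm_deg i n -> gm_deg j m ->
  tensor_deg (i + j) (pure n m).
Proof.
move=> dn dm; exists [:: (n, m)]; first by rewrite big_seq1.
by move=> p; rewrite inE => /eqP ->; exists i; rewrite addrAC subrr add0r.
Qed.

Lemma tensor_deg0 k : tensor_deg k 0.
Proof. by exists [::]; rewrite ?big_nil. Qed.

Lemma tensor_degD k x y : tensor_deg k x -> tensor_deg k y ->
  tensor_deg k (x + y).
Proof.
move=> [s -> ds] [t -> dt]; exists (s ++ t); first by rewrite big_cat.
by move=> p; rewrite mem_cat => /orP[/ds|/dt].
Qed.

Lemma tensor_degZ m k a x : galg_deg A m a -> tensor_deg k x ->
  tensor_deg (m + k) (a *: x).
Proof.
move=> da [s -> ds]; rewrite scaler_sumr big_seq.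
apply: big_ind => [||p /ds[i [d1 d2]]]; first exact: tensor_deg0.
  exact: tensor_degD.
rewrite pureZ -[k](subrK i) [k - i + i]addrC addrA.
by apply: pure_deg => //; apply: gm_degZ.
Qed.

Let gN := gm_grading N.
Let gM := gm_grading M.

Section Projection.
Variables (w : seq int) (k : int).
Hypothesis uw : uniq w.
Hypothesis hw : forall (n : N) i, i \notin w -> component gN i n = 0.

Let proj (n : N) (m : M) : tensor :=
  \sum_(i <- w) pure (component gN i n) (component gM (k - i) m).

Let projDl n n' m : proj (n + n') m = proj n m + proj n' m.
Proof.
by rewrite -big_split; apply: eq_bigr => i _; rewrite /= componentD pureDl.
Qed.

Let projDr n m m' : proj n (m + m') = proj n m + proj n m'.
Proof.
by rewrite -big_split; apply: eq_bigr => i _; rewrite /= componentD pureDr.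
Qed.

Lemma proj_hom i j n m : gm_deg i n -> gm_deg j m ->
  proj n m = if i + j == k then pure n m else 0.
Proof.
move=> dn dm; have [iw|iw] := boolP (i \in w); last first.
  have n0 : n = 0 by rewrite -(component_id gN dn) hw.
  rewrite n0 pure0l if_same /proj big1 // => l _.
  by rewrite component0 pure0l.
rewrite /proj (bigD1_seq i) //= big1 ?addr0 => [|l li]; last first.
  by rewrite (component_neq gN dn) ?pure0l // eq_sym.
rewrite component_id //; case: (i + j =P k) => [<-|ne].
  by rewrite addrAC subrr add0r component_id.
rewrite (component_neq gM dm) ?pure0r //; apply/eqP => e; apply: ne.
by rewrite e addrC subrK.
Qed.

Let projB n b m : proj (bm_act n b) m = proj n (b *: m).
Proof.
have act0 x : bm_act (x : N) 0 = 0.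
  by apply: (addrI (bm_act x 0)); rewrite -bm_actDr !addr0.
have act0l c : bm_act (0 : N) c = 0.
  by apply: (addrI (bm_act 0 c)); rewrite -bm_actDl !addr0.
have proj0 m' : proj 0 m' = 0.
  by rewrite /proj big1 // => i _; rewrite component0 pure0l.
have proj0r n' : proj n' 0 = 0.
  by rewrite /proj big1 // => i _; rewrite component0 pure0r.
have [s _ ->] := component_span gN n; have [t _ ->] := component_span gM m.
have [u _ ->] := component_span (galg_grading B) b.
move: (fun i => component_deg gN i n) (fun i => component_deg gM i m)
  (fun i => component_deg (galg_grading B) i b).
move: (component gN ^~ n) (component gM ^~ m)
  (component (galg_grading B) ^~ b) => f g h df dg dh.
elim: s => [|i s IH]; first by rewrite !big_nil act0l !proj0.
rewrite big_cons bm_actDl !projDl IH; congr (_ + _) => {s IH}.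
elim: u => [|j u IH]; first by rewrite !big_nil act0 scale0r proj0 proj0r.
rewrite big_cons bm_actDr projDl scalerDl projDr IH; congr (_ + _) => {u IH}.
elim: t => [|l t IH]; first by rewrite !big_nil scaler0 !proj0r.
rewrite big_cons scalerDr !projDr IH; congr (_ + _) => {t IH}.
rewrite (proj_hom (bm_deg_act (df i) (dh j)) (dg l)).
rewrite (proj_hom (df i) (gm_degZ (dh j) (dg l))).
by rewrite addrA pure_balance.
Qed.

Definition tproj : tensor -> tensor := tlift proj.

Lemma tprojD : {morph tproj : x y / x + y}.
Proof. exact: tliftD. Qed.

Lemma tproj_hom i j n m : gm_deg i n -> gm_deg j m ->
  tproj (pure n m) = if i + j == k then pure n m else 0.
Proof. by move=> dn dm; rewrite /tproj tlift_pure //; apply: proj_hom. Qed.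

Lemma tproj0 : tproj 0 = 0.
Proof. by apply: (addrI (tproj 0)); rewrite -tprojD !addr0. Qed.

Lemma tproj_deg x : tensor_deg k (tproj x).
Proof.
rewrite (tensorE x) (big_morph tproj tprojD tproj0).
apply: big_ind => [||[n m] _]; [exact: tensor_deg0 | exact: tensor_degD |].
rewrite /= /tproj tlift_pure // /proj.
apply: big_ind => [||i _]; [exact: tensor_deg0 | exact: tensor_degD |].
rewrite -[k in tensor_deg k](subrK i) [k - i + i]addrC.
by apply: pure_deg; apply: component_deg.
Qed.

Lemma tproj_tensor_deg l x : tensor_deg l x ->
  tproj x = if l == k then x else 0.
Proof.
move=> [s -> ds]; rewrite (big_morph tproj tprojD tproj0).
case: ifP => lk.
  rewrite big_seq [RHS]big_seq; apply: eq_bigr => p /ds[i [d1 d2]].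
  by rewrite (tproj_hom d1 d2) addrC subrK lk.
rewrite big_seq big1 // => p /ds[i [d1 d2]].
by rewrite (tproj_hom d1 d2) addrC subrK lk.
Qed.

End Projection.

Lemma tensor_grading :
  is_grading (fun c (x : tensor) => galg_scal A c *: x) tensor_deg.
Proof.
have [w uw hw] := findim_window N.
have degZ0 k c x : tensor_deg k x -> tensor_deg k (galg_scal A c *: x).
  move=> dx; rewrite -[k]add0r; apply: tensor_degZ => //.
  rewrite -[galg_scal A c]mulr1; apply: (degZ (galg_grading A)).
  exact: galg_deg1.
apply: (@grading_of_components _ _ _ _ (tproj w)) => //.
- exact: tensor_deg0.
- move=> k x y dx dy; apply: tensor_degD => //.
  by have := degZ0 k (-1) y dy; rewrite rmorphN1 scaleN1r.
- by move=> k; apply: tprojD.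
- by move=> k x; apply: tproj_deg.
- by move=> k x dx; rewrite (tproj_tensor_deg k uw hw dx) eqxx.
- by move=> l k x dx lk; rewrite (tproj_tensor_deg k uw hw dx) (negPf lk).
have [v uv hv] := findim_window M.
pose r := undup [seq i + j | i <- w, j <- v].
move=> x; exists r; first exact: undup_uniq.
have sumD : {morph (fun x => \sum_(k <- r) tproj w k x) : x y / x + y}.
  by move=> y z; rewrite -big_split; apply: eq_bigr => k _; rewrite tprojD.
move: x; apply: tensor_ext => // n m.
rewrite [in LHS](component_supp uw (hw n)) [in LHS](component_supp uv (hv m)).
rewrite [in RHS](component_supp uw (hw n)) [in RHS](component_supp uv (hv m)).
have pure_sum : pure (\sum_(i <- w) component gN i n)
      (\sum_(j <- v) component gM j m) =
    \sum_(i <- w) \sum_(j <- v) pure (component gN i n) (component gM j m).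
  rewrite (big_morph (pure^~ _) (fun n n' => pureDl n n' _) (pure0l _)).
  by apply: eq_bigr => i _; rewrite (big_morph (pure _) (pureDr _) (pure0r _)).
rewrite pure_sum.
under [RHS]eq_bigr => k _ do rewrite (big_morph _ (tprojD k uw hw) (tproj0 k uw hw)).
rewrite [RHS]exchange_big big_seq [RHS]big_seq; apply: eq_bigr => i iw /=.
under [RHS]eq_bigr => k _ do rewrite (big_morph _ (tprojD k uw hw) (tproj0 k uw hw)).
rewrite [RHS]exchange_big big_seq [RHS]big_seq; apply: eq_bigr => j jv /=.
under eq_bigr => k _.
  rewrite (tproj_hom k uw hw (component_deg gN i n) (component_deg gM j m)).
  over.
rewrite (bigD1_seq (i + j)) ?undup_uniq //=; last first.
  by rewrite mem_undup; apply: allpairs_f.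
by rewrite eqxx big1 ?addr0 // => k; rewrite eq_sym => /negPf ->.
Qed.

Lemma tensor_findim :
  is_findim (fun c (x : tensor) => galg_scal A c *: x).
Proof.
have [s hs] := findim_span (gm_findim N).
have [t ht] := findim_span (gm_findim M).
apply: (@module_span_findim _ _ tensor [seq pure n m | n <- s, m <- t]) => x.
rewrite (tensorE x); apply: span_sum => -[n m] /=.
elim: (hs n) => [|c n1 n2 n1s _ IH]; first by rewrite pure0l; apply: span_zero.
rewrite pureDl; apply: spanD => //; rewrite -pureZ => {IH}.
elim: (ht m) => [|d m1 m2 m1t _ IH].
  by rewrite pure0r scaler0; apply: span_zero.
rewrite pureDr scalerDr; apply: spanD => //.
rewrite -pure_balance bm_act_scal -pureZ scalerA -rmorphM.
by apply: span_gen; apply: allpairs_f.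
Qed.

Definition gtensor : gmod A :=
  @GMod K A tensor tensor_deg tensor_grading tensor_degZ tensor_findim.

End Object.

Section Map.
Variables (M M' : gmod B) (f : ghom M M').

Definition tmap (x : gtensor M) : gtensor M' :=
  tlift (fun n m => pure n (f m)) x.

Let tmapDl n n' m : pure (n + n') (f m) = pure n (f m) + pure n' (f m).
Proof. exact: pureDl. Qed.

Let tmapDr n m m' : pure n (f (m + m')) = pure n (f m) + pure n (f m').
Proof. by rewrite ghomD pureDr. Qed.

Let tmapB n b m : pure (bm_act n b) (f m) = pure n (f (b *: m)).
Proof. by rewrite ghomZ pure_balance. Qed.

Lemma tmapD : {morph tmap : x y / x + y}.
Proof. exact: tliftD. Qed.

Lemma tmap_pure n m : tmap (pure n m) = pure n (f m).
Proof. exact: tlift_pure. Qed.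

Lemma tmap_linear a x y : tmap (a *: x + y) = a *: tmap x + tmap y.
Proof.
rewrite tmapD; congr (_ + _); move: x; apply: tensor_ext => [x x'|x x'|n m].
- by rewrite scalerDr tmapD.
- by rewrite tmapD scalerDr.
- by rewrite pureZ !tmap_pure pureZ.
Qed.

Lemma tmap_deg n x : gm_deg n x -> gm_deg n (tmap x).
Proof.
have t0 : tmap 0 = 0 by apply: (addrI (tmap 0)); rewrite -tmapD !addr0.
case=> s -> ds; rewrite (big_morph tmap tmapD t0).
exists [seq (p.1, f p.2) | p <- s].
  by rewrite big_map; apply: eq_bigr => p _; rewrite tmap_pure.
move=> _ /mapP[p /ds[i [d1 d2]] ->]; exists i; split=> //.
exact: gh_deg.
Qed.

Definition gtensor_hom : ghom (gtensor M) (gtensor M') :=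
  GHom tmap_linear tmap_deg.

End Map.
End Tensor.

Section Projective.
Variables (K : fieldType) (A : galg K) (u : A).
Hypotheses (u_deg : galg_deg A 0 u) (u_idem : u * u = u).
Hypothesis A_findim : algebra_findim A.

Let gA := galg_grading A.

(* A u = {x | x u = x} and u A = {x | u x = x}, as u is idempotent. *)
Definition in_lproj : {pred A} := fun x => x * u == x.
Definition in_rproj : {pred A} := fun x => u * x == x.

Lemma lproj_closed : zmod_closed in_lproj.
Proof.
split=> [|x y]; rewrite !unfold_in ?mul0r // => /eqP ex /eqP ey.
by rewrite mulrBl ex ey.
Qed.

Lemma rproj_closed : zmod_closed in_rproj.
Proof.
split=> [|x y]; rewrite !unfold_in ?mulr0 // => /eqP ex /eqP ey.
by rewrite mulrBr ex ey.
Qed.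

HB.instance Definition _ := GRing.isZmodClosed.Build A in_lproj lproj_closed.
HB.instance Definition _ := GRing.isZmodClosed.Build A in_rproj rproj_closed.

Record lproj := LProj { lproj_val :> A; lprojP : lproj_val \in in_lproj }.
Record rproj := RProj { rproj_val :> A; rprojP : rproj_val \in in_rproj }.

HB.instance Definition _ := [isSub for lproj_val].
HB.instance Definition _ := [Choice of lproj by <:].
HB.instance Definition _ := [SubChoice_isSubZmodule of lproj by <:].
HB.instance Definition _ := [isSub for rproj_val].
HB.instance Definition _ := [Choice of rproj by <:].
HB.instance Definition _ := [SubChoice_isSubZmodule of rproj by <:].

Lemma lproj_mul a (x : lproj) : a * (x : A) \in in_lproj.
Proof. by rewrite unfold_in -mulrA; case: x => x /= /eqP ->. Qed.

Lemma rproj_mul a (x : rproj) : (x : A) * a \in in_rproj.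
Proof. by rewrite unfold_in mulrA; case: x => x /= /eqP ->. Qed.

Lemma lproj_mulr (x : lproj) : lproj_val x * u = lproj_val x.
Proof. by case: x => x /= /eqP. Qed.

Lemma rproj_mull (x : rproj) : u * rproj_val x = rproj_val x.
Proof. by case: x => x /= /eqP. Qed.

Lemma lproj_gen a : a * u \in in_lproj.
Proof. by rewrite unfold_in -mulrA u_idem. Qed.

Lemma rproj_gen a : u * a \in in_rproj.
Proof. by rewrite unfold_in mulrA u_idem. Qed.

Lemma rproj_scal_mul c (x : rproj) : galg_scal A c * (x : A) \in in_rproj.
Proof. by rewrite galg_central rproj_mul. Qed.

Definition lproj_scale (a : A) (x : lproj) : lproj := LProj (lproj_mul a x).
Definition rproj_scale (c : ground K) (x : rproj) : rproj :=
  RProj (rproj_scal_mul c x).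

Lemma lproj_scaleA a b x :
  lproj_scale a (lproj_scale b x) = lproj_scale (a * b) x.
Proof. by apply: val_inj; rewrite /= mulrA. Qed.
Lemma lproj_scale1 : left_id 1 lproj_scale.
Proof. by move=> x; apply: val_inj; rewrite /= mul1r. Qed.
Lemma lproj_scaleDr : right_distributive lproj_scale +%R.
Proof. by move=> a x y; apply: val_inj; rewrite /= mulrDr. Qed.
Lemma lproj_scaleDl x : {morph lproj_scale^~ x : a b / a + b}.
Proof. by move=> a b; apply: val_inj; rewrite /= mulrDl. Qed.

HB.instance Definition _ := GRing.Zmodule_isLmodule.Build A lproj
  lproj_scaleA lproj_scale1 lproj_scaleDr lproj_scaleDl.

Lemma rproj_scaleA c d x :
  rproj_scale c (rproj_scale d x) = rproj_scale (c * d) x.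
Proof. by apply: val_inj; rewrite /= mulrA rmorphM. Qed.
Lemma rproj_scale1 : left_id 1 rproj_scale.
Proof. by move=> x; apply: val_inj; rewrite /= rmorph1 mul1r. Qed.
Lemma rproj_scaleDr : right_distributive rproj_scale +%R.
Proof. by move=> a x y; apply: val_inj; rewrite /= mulrDr. Qed.
Lemma rproj_scaleDl x : {morph rproj_scale^~ x : a b / a + b}.
Proof. by move=> a b; apply: val_inj; rewrite /= rmorphD mulrDl. Qed.

HB.instance Definition _ := GRing.Zmodule_isLmodule.Build (ground K) rproj
  rproj_scaleA rproj_scale1 rproj_scaleDr rproj_scaleDl.

Definition lproj_deg (n : int) (x : lproj) : Prop := galg_deg A n x.
Definition rproj_deg (n : int) (x : rproj) : Prop := galg_deg A n x.

Lemma lproj_grading :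
  is_grading (fun c (x : lproj) => galg_scal A c *: x) lproj_deg.
Proof.
split.
- by move=> n; apply: (deg0 gA).
- by move=> n x y; apply: (degB gA).
- by move=> n c x; apply: (degZ gA).
- move=> x; have [s [f [us df ex]]] := deg_span gA (lproj_val x).
  exists s, (fun n => LProj (lproj_gen (f n))); split=> // [n|].
    by have := galg_degM (df n) u_deg; rewrite addr0.
  apply: val_inj; rewrite raddf_sum /= -mulr_suml -ex.
  exact/esym/lproj_mulr.
move=> s f us df sum0 n ns; apply: val_inj.
apply: (deg_free gA us (f := fun n => val (f n)) df) => //.
by have := congr1 val sum0; rewrite raddf_sum.
Qed.

Lemma rproj_grading :
  is_grading (fun c (x : rproj) => galg_scal (ground K) c *: x) rproj_deg.
Proof.
split.
- by move=> n; apply: (deg0 gA).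
- by move=> n x y; apply: (degB gA).
- by move=> n c x; apply: (degZ gA).
- move=> x; have [s [f [us df ex]]] := deg_span gA (rproj_val x).
  exists s, (fun n => RProj (rproj_gen (f n))); split=> // [n|].
    by have := galg_degM u_deg (df n); rewrite add0r.
  apply: val_inj; rewrite raddf_sum /= -mulr_sumr -ex.
  exact/esym/rproj_mull.
move=> s f us df sum0 n ns; apply: val_inj.
apply: (deg_free gA us (f := fun n => val (f n)) df) => //.
by have := congr1 val sum0; rewrite raddf_sum.
Qed.

Lemma lproj_degZ m n a (x : lproj) :
  galg_deg A m a -> lproj_deg n x -> lproj_deg (m + n) (a *: x).
Proof. exact: galg_degM. Qed.

Lemma rproj_degZ m n c (x : rproj) :
  galg_deg (ground K) m c -> rproj_deg n x -> rproj_deg (m + n) (c *: x).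
Proof.
move=> dc dx; have [->|/dc ->] := eqVneq c 0.
  by rewrite scale0r; apply: (deg0 gA).
by rewrite add0r; apply: (degZ gA).
Qed.

Lemma lproj_findim :
  is_findim (fun c (x : lproj) => galg_scal A c *: x).
Proof.
have [s hs] := A_findim.
exists [seq LProj (lproj_gen a) | a <- s] => x.
have [c ex] := hs (lproj_val x); exists c; apply: val_inj; rewrite raddf_sum /= size_map.
rewrite -[LHS]lproj_mulr ex mulr_suml; apply: eq_bigr => i _.
by rewrite (nth_map 0) //= mulrA.
Qed.

Lemma rproj_findim :
  is_findim (fun c (x : rproj) => galg_scal (ground K) c *: x).
Proof.
have [s hs] := A_findim.
exists [seq RProj (rproj_gen a) | a <- s] => x.
have [c ex] := hs (rproj_val x); exists c; apply: val_inj; rewrite raddf_sum /= size_map.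
rewrite -[LHS]rproj_mull ex mulr_sumr; apply: eq_bigr => i _.
by rewrite (nth_map 0) //= !mulrA galg_central.
Qed.

Definition lproj_gmod : gmod A := GMod lproj_grading lproj_degZ lproj_findim.
Definition rproj_gmod : gmod (ground K) :=
  GMod rproj_grading rproj_degZ rproj_findim.

Lemma lproj_act_proof (x : lproj) (c : ground K) :
  (x : A) * galg_scal A c \in in_lproj.
Proof. by rewrite -galg_central lproj_mul. Qed.

Definition lproj_act (x : lproj_gmod) (c : ground K) : lproj_gmod :=
  LProj (lproj_act_proof x c).

Definition rproj_act (x : rproj_gmod) (a : A) : rproj_gmod :=
  RProj (rproj_mul a x).

Lemma lproj_actDl x y c : lproj_act (x + y) c = lproj_act x c + lproj_act y c.
Proof. by apply: val_inj; rewrite /= mulrDl. Qed.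
Lemma lproj_actDr x c d : lproj_act x (c + d) = lproj_act x c + lproj_act x d.
Proof. by apply: val_inj; rewrite /= rmorphD mulrDr. Qed.
Lemma lproj_act1 x : lproj_act x 1 = x.
Proof. by apply: val_inj; rewrite /= rmorph1 mulr1. Qed.
Lemma lproj_actM x c d : lproj_act x (c * d) = lproj_act (lproj_act x c) d.
Proof. by apply: val_inj; rewrite /= rmorphM mulrA. Qed.
Lemma lproj_actZ a x c : lproj_act (a *: x) c = a *: lproj_act x c.
Proof. by apply: val_inj; rewrite /= mulrA. Qed.
Lemma lproj_act_scal c x :
  lproj_act x (galg_scal (ground K) c) = galg_scal A c *: x.
Proof. by apply: val_inj; rewrite /= galg_central. Qed.
Lemma lproj_deg_act m n x c : gm_deg m x -> galg_deg (ground K) n c ->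
  gm_deg (m + n) (lproj_act x c).
Proof.
move=> dx dc; have [->|/dc ->] := eqVneq c 0.
  rewrite [lproj_act x 0](_ : _ = 0); first exact: (deg0 lproj_grading).
  by apply: val_inj; rewrite /= rmorph0 mulr0.
by rewrite addr0 [lproj_act x c]lproj_act_scal; apply: (degZ lproj_grading).
Qed.

Definition lproj_bimod : gbimod A (ground K) :=
  @GBimod K A (ground K) lproj_gmod lproj_act lproj_actDl lproj_actDr
    lproj_act1 lproj_actM lproj_actZ lproj_act_scal lproj_deg_act.

Lemma rproj_actDl x y a : rproj_act (x + y) a = rproj_act x a + rproj_act y a.
Proof. by apply: val_inj; rewrite /= mulrDl. Qed.
Lemma rproj_actDr x a b : rproj_act x (a + b) = rproj_act x a + rproj_act x b.
Proof. by apply: val_inj; rewrite /= mulrDr. Qed.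
Lemma rproj_act1 x : rproj_act x 1 = x.
Proof. by apply: val_inj; rewrite /= mulr1. Qed.
Lemma rproj_actM x a b : rproj_act x (a * b) = rproj_act (rproj_act x a) b.
Proof. by apply: val_inj; rewrite /= mulrA. Qed.
Lemma rproj_actZ c x a : rproj_act (c *: x) a = c *: rproj_act x a.
Proof. by apply: val_inj; rewrite /= mulrA. Qed.
Lemma rproj_act_scal c x :
  rproj_act x (galg_scal A c) = galg_scal (ground K) c *: x.
Proof. by apply: val_inj; rewrite /= galg_central. Qed.
Lemma rproj_deg_act m n x a : gm_deg m x -> galg_deg A n a ->
  gm_deg (m + n) (rproj_act x a).
Proof. exact: galg_degM. Qed.

Definition rproj_bimod : gbimod (ground K) A :=
  @GBimod K (ground K) A rproj_gmod rproj_act rproj_actDl rproj_actDr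
    rproj_act1 rproj_actM rproj_actZ rproj_act_scal rproj_deg_act.

End Projective.

Record category := Category {
  ob :> Type;
  hom : ob -> ob -> Type;
  idm : forall x, hom x x;
  cmp : forall x y z, hom y z -> hom x y -> hom x z;
  cmp_idl : forall x y (f : hom x y), cmp (idm y) f = f;
  cmp_idr : forall x y (f : hom x y), cmp f (idm x) = f;
  cmpA : forall x y z t (h : hom z t) (g : hom y z) (f : hom x y),
    cmp h (cmp g f) = cmp (cmp h g) f }.

Arguments hom {c} x y.
Arguments idm {c} x.
Arguments cmp {c x y z} g f.

Record functor (C D : category) := Functor {
  fob :> C -> D;
  fhom : forall x y, hom x y -> hom (fob x) (fob y);
  fhom_id : forall x, fhom (idm x) = idm (fob x);
  fhom_cmp : forall x y z (g : hom y z) (f : hom x y),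
    fhom (cmp g f) = cmp (fhom g) (fhom f) }.

Arguments fhom {C D} F {x y} f : rename.

Definition isomorphic (C D : category) (F G : functor C D) : Prop :=
  exists (eta : forall x, hom (F x) (G x)) (theta : forall x, hom (G x) (F x)),
    [/\ forall x y (f : hom x y),
          cmp (eta y) (fhom F f) = cmp (fhom G f) (eta x),
        forall x, cmp (theta x) (eta x) = idm (F x)
      & forall x, cmp (eta x) (theta x) = idm (G x)].

Section FunctorConstructions.

Definition functor_id (C : category) : functor C C :=
  @Functor C C id (fun _ _ f => f) (fun _ => erefl) (fun _ _ _ _ _ => erefl).

Section Composition.
Variables (C D E : category) (G : functor D E) (F : functor C D).

Lemma functor_comp_id x : fhom G (fhom F (idm x)) = idm (G (F x)).
Proof. by rewrite !fhom_id. Qed.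

Lemma functor_comp_cmp x y z (g : hom y z) (f : hom x y) :
  fhom G (fhom F (cmp g f)) = cmp (fhom G (fhom F g)) (fhom G (fhom F f)).
Proof. by rewrite !fhom_cmp. Qed.

Definition functor_comp : functor C E :=
  @Functor C E (fun x => G (F x)) (fun _ _ f => fhom G (fhom F f))
    functor_comp_id functor_comp_cmp.

End Composition.

Section Constant.
Variables (C D : category) (d : D).

Definition functor_const : functor C D :=
  @Functor C D (fun=> d) (fun _ _ _ => idm d) (fun _ => erefl)
    (fun _ _ _ _ _ => esym (cmp_idl (idm d))).

End Constant.

(* The category C x D^T; for finite T and additive C, D this is the direct sum
   of C and of copies of D indexed by T. *)
Section Family.
Variables (C D : category) (T : Type).

Definition family_ob : Type := (C * (T -> D))%type.
Definition family_hom (x y : family_ob) : Type :=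
  (hom x.1 y.1 * (forall t, hom (x.2 t) (y.2 t)))%type.
Definition family_id (x : family_ob) : family_hom x x :=
  (idm x.1, fun t => idm (x.2 t)).
Definition family_cmp (x y z : family_ob) (g : family_hom y z)
    (f : family_hom x y) : family_hom x z :=
  (cmp g.1 f.1, fun t => cmp (g.2 t) (f.2 t)).

Lemma family_idl x y (f : family_hom x y) : family_cmp (family_id y) f = f.
Proof.
case: f => f g; congr pair; first exact: cmp_idl.
by apply: functional_extensionality_dep => t; apply: cmp_idl.
Qed.

Lemma family_idr x y (f : family_hom x y) : family_cmp f (family_id x) = f.
Proof.
case: f => f g; congr pair; first exact: cmp_idr.
by apply: functional_extensionality_dep => t; apply: cmp_idr.
Qed.

Lemma family_cmpA x y z t (h : family_hom z t) (g : family_hom y z)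
    (f : family_hom x y) :
  family_cmp h (family_cmp g f) = family_cmp (family_cmp h g) f.
Proof.
congr pair; first exact: cmpA.
by apply: functional_extensionality_dep => ?; apply: cmpA.
Qed.

Definition family_cat : category :=
  @Category family_ob family_hom family_id family_cmp family_idl family_idr
    family_cmpA.

Definition fam_fst : functor family_cat C :=
  @Functor family_cat C (fun x => x.1) (fun _ _ f => f.1) (fun _ => erefl)
    (fun _ _ _ _ _ => erefl).

Definition fam_at (t : T) : functor family_cat D :=
  @Functor family_cat D (fun x => x.2 t) (fun _ _ f => f.2 t) (fun _ => erefl)
    (fun _ _ _ _ _ => erefl).

Section Tuple.
Variables (B : category) (F : functor B C) (G : T -> functor B D).

Definition fam_ob (b : B) : family_cat := (F b, fun t => G t b).
Definition fam_hom (b b' : B) (f : hom b b') : family_hom (fam_ob b) (fam_ob b') :=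
  (fhom F f, fun t => fhom (G t) f).

Lemma fam_hom_id b : fam_hom (idm b) = idm (fam_ob b).
Proof.
congr pair; first exact: fhom_id.
by apply: functional_extensionality_dep => t; apply: fhom_id.
Qed.

Lemma fam_hom_cmp x y z (g : hom y z) (f : hom x y) :
  fam_hom (cmp g f) = family_cmp (fam_hom g) (fam_hom f).
Proof.
congr pair; first exact: fhom_cmp.
by apply: functional_extensionality_dep => t; apply: fhom_cmp.
Qed.

Definition functor_family : functor B family_cat :=
  @Functor B family_cat fam_ob fam_hom fam_hom_id fam_hom_cmp.

End Tuple.
End Family.
End FunctorConstructions.

Section GModCategory.
Variables (K : fieldType).

Section Algebra.
Variable A : galg K.

Lemma ghom_idl (M N : gmod A) (f : ghom M N) : ghom_comp (ghom_id N) f = f.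
Proof. exact: ghom_eq. Qed.

Lemma ghom_idr (M N : gmod A) (f : ghom M N) : ghom_comp f (ghom_id M) = f.
Proof. exact: ghom_eq. Qed.

Lemma ghom_compA (M N P Q : gmod A) (h : ghom P Q) (g : ghom N P)
    (f : ghom M N) :
  ghom_comp h (ghom_comp g f) = ghom_comp (ghom_comp h g) f.
Proof. exact: ghom_eq. Qed.

Definition gmod_cat : category :=
  @Category (gmod A) (@ghom K A) (@ghom_id K A) (@ghom_comp K A)
    ghom_idl ghom_idr ghom_compA.

Lemma gshift_hom_id k (M : gmod A) :
  gshift_hom k (ghom_id M) = ghom_id (gshift k M).
Proof. exact: ghom_eq. Qed.

Lemma gshift_hom_comp k (M N P : gmod A) (g : ghom N P) (f : ghom M N) :
  gshift_hom k (ghom_comp g f) = ghom_comp (gshift_hom k g) (gshift_hom k f).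
Proof. exact: ghom_eq. Qed.

Definition shift (k : int) : functor gmod_cat gmod_cat :=
  @Functor gmod_cat gmod_cat (@gshift K A k) (@gshift_hom K A k)
    (gshift_hom_id k) (gshift_hom_comp k).

Section Sum.
Variables (C : category) (F G : functor C gmod_cat).

Definition sum_ob (x : C) : gmod_cat := gsum (F x) (G x).
Definition sum_hom (x y : C) (f : hom x y) : @hom gmod_cat (sum_ob x) (sum_ob y) :=
  gsum_hom (fhom F f) (fhom G f).

Lemma sum_hom_id x : sum_hom (idm x) = idm (sum_ob x).
Proof. by apply: ghom_eq => -[a b]; rewrite /sum_hom !fhom_id. Qed.

Lemma sum_hom_cmp x y z (g : hom y z) (f : hom x y) :
  sum_hom (cmp g f) = cmp (sum_hom g) (sum_hom f).
Proof. by apply: ghom_eq => -[a b]; rewrite /sum_hom !fhom_cmp. Qed.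

Definition functor_sum : functor C gmod_cat :=
  @Functor C gmod_cat sum_ob sum_hom sum_hom_id sum_hom_cmp.

End Sum.
End Algebra.

Section TensorFunctor.
Variables (A B : galg K) (N : gbimod A B).

Lemma gtensor_hom_id (M : gmod B) :
  gtensor_hom N (ghom_id M) = ghom_id (gtensor N M).
Proof.
apply: ghom_eq; apply: tensor_ext => // [x y|n m]; first exact: ghomD.
exact: tmap_pure.
Qed.

Lemma gtensor_hom_comp (M P Q : gmod B) (g : ghom P Q) (f : ghom M P) :
  gtensor_hom N (ghom_comp g f) =
  ghom_comp (gtensor_hom N g) (gtensor_hom N f).
Proof.
apply: ghom_eq; apply: tensor_ext => [x y|x y|n m]; try exact: ghomD.
by rewrite /= !tmap_pure.
Qed.

Definition tensor_functor : functor (gmod_cat B) (gmod_cat A) :=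
  @Functor (gmod_cat B) (gmod_cat A) (gtensor N) (@gtensor_hom K A B N)
    gtensor_hom_id gtensor_hom_comp.

End TensorFunctor.
End GModCategory.

Section RootSystem.
Variables (R : realType) (V : vectType R) (form : V -> V -> R).

Record is_euclidean : Prop := IsEuclidean {
  euc_sym : forall x y, form x y = form y x;
  euc_linear : forall a x y z, form (a *: x + y) z = a * form x z + form y z;
  euc_pos : forall x, x != 0 -> 0 < form x x }.

Definition cartan (x a : V) : R := 2 * form x a / form a a.

Definition reflection (a x : V) : V := x - cartan x a *: a.

Record is_root_system (Phi : seq V) : Prop := IsRootSystem {
  rs_span : <<Phi>>%VS = fullv;
  rs_neq0 : 0 \notin Phi;
  rs_reflection : {in Phi &, forall a b, reflection a b \in Phi};
  rs_integral : {in Phi &, forall a b, cartan b a \is a Num.int};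
  rs_reduced : forall a c, a \in Phi -> c *: a \in Phi -> c = 1 \/ c = -1 }.

Definition irreducible_roots (Phi : seq V) : Prop :=
  (exists a, a \in Phi) /\
  forall P : pred V,
    {in Phi &, forall a b, P a -> ~~ P b -> form a b = 0} ->
    {in Phi, forall a, P a} \/ {in Phi, forall a, ~~ P a}.

Record is_base (Phi Pi : seq V) : Prop := IsBase {
  base_sub : {subset Pi <= Phi};
  base_basis : basis_of fullv Pi;
  base_sign : forall b, b \in Phi -> exists k : V -> nat,
    b = \sum_(a <- Pi) (k a)%:R *: a \/ b = - \sum_(a <- Pi) (k a)%:R *: a }.

End RootSystem.

(* The root system of a simple simply-laced Lie algebra with its set of simple
   roots: V is the real span of the roots, and the form is invariant under the
   Weyl group because the reflections are orthogonal for it.  All roots have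
   the same length and the form is normalised accordingly, so that Cartan
   integers are values of the form.  These systems are exactly those of the
   simple simply-laced Lie algebras, which enter below only through them. *)
Record simply_laced_system (R : realType) := SimplyLacedSystem {
  sls_space : vectType R;
  sls_form : sls_space -> sls_space -> R;
  sls_roots : seq sls_space;
  sls_simple : seq sls_space;
  sls_euclidean : is_euclidean sls_form;
  sls_system : is_root_system sls_form sls_roots;
  sls_irreducible : irreducible_roots sls_form sls_roots;
  sls_base : is_base sls_roots sls_simple;
  sls_norm : {in sls_roots, forall a, sls_form a a = 2} }.

Section DynkinDiagram.
Variables (R : realType) (D : simply_laced_system R).

Local Notation V := (sls_space D).
Local Notation form := (@sls_form R D).
Local Notation Phi := (sls_roots D).
Local Notation Pi := (sls_simple D).

Definition root : choiceType := seq_sub Phi.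
Definition simple : finType := seq_sub Pi.

Definition dynkin : rel simple :=
  fun a b => (a != b) && (form (val a) (val b) != 0).

Lemma dynkin_sym : symmetric dynkin.
Proof. by move=> a b; rewrite /dynkin eq_sym (euc_sym (sls_euclidean D)). Qed.

Let formD x y z : form (x + y) z = form x z + form y z.
Proof. by have := euc_linear (sls_euclidean D) 1 x y z; rewrite scale1r mul1r. Qed.

Let form0 z : form 0 z = 0.
Proof. by apply: (addrI (form 0 z)); rewrite -formD !addr0. Qed.

Let formZ c x z : form (c *: x) z = c * form x z.
Proof.
by have := euc_linear (sls_euclidean D) c x 0 z; rewrite form0 !addr0.
Qed.

Let formN x z : form (- x) z = - form x z.
Proof. by rewrite -scaleN1r formZ mulN1r. Qed.

Let form_sum (I : Type) (r : seq I) (F : I -> V) z :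
  form (\sum_(i <- r) F i) z = \sum_(i <- r) form (F i) z.
Proof. exact: (big_morph (form^~ z) (fun x y => formD x y z) (form0 z)). Qed.

Let formC x y : form x y = form y x.
Proof. exact: euc_sym (sls_euclidean D) x y. Qed.

Let Pi_Phi a : a \in Pi -> a \in Phi. Proof. exact: base_sub (sls_base D) a. Qed.

Let reflE a b : a \in Phi -> reflection form a b = b - form b a *: a.
Proof.
by move=> aP; rewrite /reflection /cartan sls_norm // mulrAC divff ?mul1r ?pnatr_eq0.
Qed.

Let Pi_free (c : V -> R) : \sum_(a <- Pi) c a *: a = 0 ->
  forall a, a \in Pi -> c a = 0.
Proof.
move=> sum0 a aPi.
have fPi : free (in_tuple Pi) := basis_free (base_basis (sls_base D)).
rewrite (big_nth 0) big_mkord in sum0.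
have /freeP/(_ (fun i => c Pi`_i))/(_ sum0) := fPi.
have iP : (index a Pi < size Pi)%N by rewrite index_mem.
by move=> /(_ (Ordinal iP)); rewrite /= nth_index.
Qed.

Section Orthogonal.
Variables P : pred V.
Hypothesis orthP : {in Pi &, forall a b, P a -> ~~ P b -> form a b = 0}.

Let U (Q : pred V) : {vspace V} := <<filter Q Pi>>%VS.

Let U_orth x y : x \in U P -> y \in U (predC P) -> form x y = 0.
Proof.
have spanE (Q : pred V) z : z \in U Q -> exists c : nat -> R,
    z = \sum_(i < size (filter Q Pi)) c i *: (filter Q Pi)`_i.
  move=> /(@coord_span _ _ _ (in_tuple (filter Q Pi))) ->.
  exists (fun i => if insub i is Some j
    then coord (in_tuple (filter Q Pi)) j z else 0).
  by apply: eq_bigr => i _; rewrite valK.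
move=> /spanE[c ->] /spanE[d ->]; rewrite form_sum big1 // => i _.
rewrite formZ formC form_sum big1 ?mulr0 // => j _; rewrite formZ formC.
have := mem_nth 0 (ltn_ord i); have := mem_nth 0 (ltn_ord j).
rewrite !mem_filter => /andP[Qj Pj] /andP[Qi Pj'].
by rewrite orthP ?mulr0.
Qed.

Let simple_U a : a \in Pi -> a \in U P \/ a \in U (predC P).
Proof.
move=> aPi; have [Pa|Pa] := boolP (P a); [left|right].
  by apply: memv_span; rewrite mem_filter Pa.
by apply: memv_span; rewrite mem_filter /= Pa.
Qed.

Let positive_U h (k : V -> nat) : (\sum_(a <- Pi) k a = h)%N ->
  \sum_(a <- Pi) (k a)%:R *: a \in Phi ->
  \sum_(a <- Pi) (k a)%:R *: a \in U P \/
  \sum_(a <- Pi) (k a)%:R *: a \in U (predC P).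
Proof.
elim/ltn_ind: h k => h IH k kh; set b := \sum_(a <- Pi) _ => bPhi.
have b_gt0 : 0 < \sum_(a <- Pi) (k a)%:R * form a b.
  under eq_bigr => a _ do rewrite -formZ.
  rewrite -form_sum; apply: euc_pos (sls_euclidean D) _ _.
  by apply: contraNneq (rs_neq0 (sls_system D)) => <-.
have [a aPi ka] : exists2 a, a \in Pi & 0 < (k a)%:R * form a b.
  apply/hasP; apply: contraTT b_gt0; rewrite -leNgt => /hasPn h0.
  by rewrite big_seq; apply: sumr_le0 => a /h0; rewrite -leNgt.
have ab_gt0 : 0 < form b a.
  rewrite formC ltNge; apply/negP => ab.
  by move: ka; rewrite ltNge mulr_ge0_le0.
have uPi : uniq Pi := free_uniq (basis_free (base_basis (sls_base D))).
pose g := reflection form a b.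
have gE : g = b - form b a *: a by rewrite /g reflE ?Pi_Phi.
have gPhi : g \in Phi.
  by apply: (rs_reflection (sls_system D)) => //; apply: Pi_Phi.
have sumE (c : V -> R) :
    g - \sum_(x <- Pi) c x *: x =
    \sum_(x <- Pi) ((k x)%:R - (x == a)%:R * form b a - c x) *: x.
  under [RHS]eq_bigr => x _ do rewrite 2!scalerBl.
  rewrite !sumrB gE; congr (_ - _ - _).
  rewrite (bigD1_seq a) //= eqxx mul1r big1 ?addr0 // => x /negPf ->.
  by rewrite mul0r scale0r.
have [l [gl|gl]] := base_sign (sls_base D) gPhi; last first.
  have /Pi_free cl : \sum_(x <- Pi)
      ((k x)%:R - (x == a)%:R * form b a - - (l x)%:R) *: x = 0.
    rewrite -sumE gl.
    by under [X in _ - X]eq_bigr => x _ do rewrite scaleNr; rewrite sumrN subrr.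
  have bE : b = (k a)%:R *: a.
    rewrite /b (bigD1_seq a) //= big1_seq ?addr0 // => x /andP[xa xPi].
    have := cl x xPi; rewrite (negPf xa) mul0r subr0 opprK -natrD => /eqP.
    by rewrite pnatr_eq0 addn_eq0 => /andP[/eqP -> _]; rewrite scale0r.
  by rewrite bE; case: (simple_U aPi) => ?; [left|right]; apply: memvZ.
have /Pi_free cl : \sum_(x <- Pi)
    ((k x)%:R - (x == a)%:R * form b a - (l x)%:R) *: x = 0.
  by rewrite -sumE gl subrr.
have lt : (\sum_(x <- Pi) l x < h)%N.
  rewrite -kh (bigD1_seq a) //= [X in (_ < X)%N](bigD1_seq a) //=.
  rewrite -addSn leq_add //.
    have := cl a aPi; rewrite eqxx mul1r => /eqP; rewrite subr_eq0 => /eqP e.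
    by rewrite -(ltr_nat R) -e gtrBl.
  rewrite leq_eqVlt; apply/orP; left; apply/eqP.
  rewrite big_seq_cond [RHS]big_seq_cond; apply: eq_bigr => x /andP[xPi xa].
  have := cl x xPi; rewrite (negPf xa) mul0r subr0 => /eqP.
  by rewrite subr_eq0 eqr_nat => /eqP.
have ga : form g a = - form b a.
  rewrite gE formD formN formZ sls_norm ?Pi_Phi // mulrC mulrDl mul1r opprD.
  by rewrite addrA subrr add0r.
have bE : b = g + form b a *: a by rewrite gE subrK.
have ne0 : form g a != 0 by rewrite ga oppr_eq0 gt_eqF.
have := IH _ lt l erefl; rewrite -gl => /(_ gPhi) gU.
have [aU|aU] := simple_U aPi; case: gU => gU.
- by left; rewrite bE memvD ?memvZ.
- by rewrite formC U_orth ?eqxx in ne0.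
- by rewrite U_orth ?eqxx in ne0.
- by right; rewrite bE memvD ?memvZ.
Qed.

Let root_U b : b \in Phi -> b \in U P \/ b \in U (predC P).
Proof.
move=> bPhi; have [k [e|e]] := base_sign (sls_base D) bPhi.
  by rewrite e in bPhi *; apply: positive_U bPhi.
have nb : - b \in Phi.
  have := rs_reflection (sls_system D) bPhi bPhi.
  rewrite reflE // sls_norm // (_ : b - 2 *: b = - b) //.
  by rewrite scaler_nat mulr2n opprD addrA subrr add0r.
have := nb; rewrite e opprK => /(positive_U erefl).
by rewrite !memvN.
Qed.

Lemma base_connected : {in Pi, forall a, P a} \/ {in Pi, forall a, ~~ P a}.
Proof.
have [_ irr] := sls_irreducible D.
have [|all|none] := irr (mem (U P)).
- move=> a b aPhi bPhi /= aU bU; have [bU'|] := root_U bPhi.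
    by case/negP: bU.
  exact: U_orth.
- left=> a aPi; apply: contraT => nPa.
  have aU : a \in U (predC P) by apply: memv_span; rewrite mem_filter /= nPa.
  have := U_orth (all a (Pi_Phi aPi)) aU.
  by rewrite sls_norm ?Pi_Phi // => /eqP; rewrite pnatr_eq0.
right=> a aPi; apply: contra (none a (Pi_Phi aPi)) => Pa.
by apply: memv_span; rewrite mem_filter Pa.
Qed.

End Orthogonal.

Lemma dynkin_connected (S : {set simple}) : S != set0 -> S != setT ->
  exists a b, [/\ a \in S, b \notin S & dynkin a b].
Proof.
move=> S0 ST; apply: contrapT => nex.
pose P (x : V) := if insub x is Some a then (a : simple) \in S else false.
have PE (a : simple) : P (val a) = (a \in S) by rewrite /P valK.
have [|all|none] := @base_connected P.
- move=> x y xPi yPi.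
  rewrite -[x]/(val (SeqSub xPi)) -[y]/(val (SeqSub yPi)) !PE => xS yS.
  apply/eqP; apply: contraT => ne; case: nex.
  exists (SeqSub xPi), (SeqSub yPi); split=> //; rewrite /dynkin ne andbT.
  by apply: contraNneq yS => <-.
- by case/eqP: ST; apply/setP=> a; rewrite inE -PE all ?ssvalP.
by case/set0Pn: S0 => a; rewrite -PE; apply/negP/none/ssvalP.
Qed.

End DynkinDiagram.

Section AdjointCategory.
Variables (R : realType) (D : simply_laced_system R).

Local Notation CC := (ground R[i]).

Definition zz : vertex_galg R[i] (simple D) := zigzag R[i] (@dynkin R D).

Lemma zz_findim : algebra_findim zz.
Proof. exact: zigzag_findim (@dynkin_sym R D) (@dynkin_connected R D). Qed.

(* P_a and _aP; the tensor products with them over C and over A are those of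
   bimodules, vector spaces being the modules over CC = C. *)
Definition left_projective (a : simple D) : gbimod zz CC :=
  lproj_bimod (vg_deg zz a) (vg_idem zz a) zz_findim.

Definition right_projective (a : simple D) : gbimod CC zz :=
  rproj_bimod (vg_deg zz a) (vg_idem zz a) zz_findim.

(* An object is a graded A-module, its component of weight 0, together with a
   graded vector space for each root, its component of that weight. *)
Definition adj_cat : category :=
  family_cat (gmod_cat zz) (gmod_cat CC) (root D).

Definition weight0 : functor adj_cat (gmod_cat zz) := fam_fst _ _ _.

(* The component of weight v, which is zero if v is not a root. *)
Definition weight (v : sls_space D) : functor adj_cat (gmod_cat CC) :=
  if insub v is Some mu then fam_at _ _ (mu : root D)
  else functor_const adj_cat (gzero CC : gmod_cat CC).

(* (v, a) as an integer, for integral values of the form. *)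
Definition pairing (v : sls_space D) (a : simple D) : int :=
  Num.floor (sls_form v (val a)).

(* The functors are given by the components of their values.  Since E_a maps
   the component of weight mu to weight mu + a, the component of weight nu of
   E_a M depends on the component of weight mu = nu - a of M: it is
   - P_a (x) M_mu{-1} for nu = 0, that is mu = - a;
   - _aP (x)_A M_mu for nu = a, that is mu = 0;
   - M_mu for nu <> a, mu a root and (mu, a) = -1, and 0 otherwise.
   Similarly for F_a, with mu = nu + a and (mu, a) = 1.  Tensoring with the
   line C_nu amounts to placing a graded vector space in weight nu. *)
Definition Efun (a : simple D) : functor adj_cat adj_cat :=
  functor_family
    (functor_comp (tensor_functor (left_projective a))
      (functor_comp (shift CC (- 1)) (weight (- val a))))
    (fun nu : root D =>
      if val nu == val a then
        functor_comp (tensor_functor (right_projective a)) weight0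
      else if sls_form (val nu - val a) (val a) == - 1 then
        weight (val nu - val a)
      else functor_const adj_cat (gzero CC : gmod_cat CC)).

Definition Ffun (a : simple D) : functor adj_cat adj_cat :=
  functor_family
    (functor_comp (tensor_functor (left_projective a))
      (functor_comp (shift CC (- 1)) (weight (val a))))
    (fun nu : root D =>
      if val nu == - val a then
        functor_comp (tensor_functor (right_projective a)) weight0
      else if sls_form (val nu + val a) (val a) == 1 then
        weight (val nu + val a)
      else functor_const adj_cat (gzero CC : gmod_cat CC)).

Definition weight_shift (n : int) (a : simple D) : functor adj_cat adj_cat :=
  functor_family
    (functor_comp (shift zz (n * pairing 0 a)) weight0)
    (fun mu : root D =>
      functor_comp (shift CC (n * pairing (val mu) a)) (fam_at _ _ mu)).

Definition Kfun (a : simple D) : functor adj_cat adj_cat := weight_shift 1 a.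
Definition Kinvfun (a : simple D) : functor adj_cat adj_cat := weight_shift (-1) a.

Definition adj_shift (k : int) : functor adj_cat adj_cat :=
  functor_family (functor_comp (shift zz k) weight0)
    (fun mu : root D => functor_comp (shift CC k) (fam_at _ _ mu)).

Definition adj_sum (G H : functor adj_cat adj_cat) : functor adj_cat adj_cat :=
  functor_family
    (functor_sum (functor_comp weight0 G) (functor_comp weight0 H))
    (fun mu : root D =>
      functor_sum (functor_comp (fam_at _ _ mu) G)
        (functor_comp (fam_at _ _ mu) H)).

Definition adj_id : functor adj_cat adj_cat := functor_id adj_cat.

End AdjointCategory.

Declare Scope functor_scope.
Delimit Scope functor_scope with functor.
Notation "G ∘ F" := (functor_comp G F)
  (at level 40, left associativity) : functor_scope.
Notation "F ⊕ G" := (adj_sum F G)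
  (at level 50, left associativity) : functor_scope.
Notation "F ⟦ k ⟧" := (functor_comp (adj_shift _ k) F)
  (at level 30, k at level 200, format "F ⟦ k ⟧") : functor_scope.
Notation "F ≅ G" := (isomorphic F G)
  (at level 70, no associativity) : functor_scope.

(* Main.v *)
From HB Require Import structures.
Require Import Defs.
From mathcomp Require Import all_boot all_order all_algebra.
From mathcomp Require Import reals boolp complex.
From mathcomp Require Import finmap monalg zify lra.

(** The idea is to follow weights.  Both E_a and F_a are steps in the direction of
    a root v, where v = a for E_a and v = - a for F_a: they move the component of
    weight w - v to weight w whenever (w, v) = 1, they leave weight 0 for v by
    tensoring with aA, they reach weight 0 from - v by tensoring with Aa{-1}, and
    they are zero on all other components ([is_step], [Efun_step], [Ffun_step]).
    A relation between such functors is checked on each component of the target,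
    by following the weights backwards: for most weights both sides are zero or
    both are the same component of the argument.

    The remaining components are those where a path of weights crosses 0.
    There the composite aA (x)_A (Ab (x) -){-1} is the tensor product with the
    graded vector space aAb{-1} (section Corner), so that the structure of the
    zigzag algebra enters only through the dimensions of aAb: zero if a and b are
    distinct and not adjacent, one in degree 1 if they are adjacent, and aAa has
    dimension one in degrees 0 and 2 as soon as a has a neighbour
    ([zigzag_corners]).  The other paths vanish in A by the relations and, if they
    are long, by the connectedness of the graph.  That the expected basis elements
    are independent follows from linear forms on the path algebra, sums of
    coefficients of paths with given length and ends, which vanish on the ideal of
    relations ([path_coef_ideal]).

    If v and w are the roots of two steps at distinct vertices a and b, they
    commute when (v, w) is 0 or 1 ([step_commute]); this covers E_a F_b, with
    (v, w) = - (a, b), and the case (a, b) = 0 for E_a E_b and F_a F_b.  When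
    (v, w) = -1, the composites in the Serre relation are nonzero only in the
    weights v and v + w ([step_serre]).  On one side of the relation the path
    of weights crosses 0 with the corner aAa{-1}, which is the sum of lines in
    degrees 1 and -1, and on the other side with aAb{-1} or bAa{-1}, a line in
    degree 0.  The relations with K_a state that a step adds v to the weight
    ([step_Kfun]). *)

Set Implicit Arguments.
Unset Strict Implicit.
Unset Printing Implicit Defensive.

Import Order.TTheory GRing.Theory Num.Theory.

Local Open Scope ring_scope.
Local Open Scope functor_scope.

(** * Isomorphisms of functors and graded modules *)

Section Isomorphisms.
Variables B C D : category.

Lemma iso_refl (F : functor C D) : F ≅ F.
Proof.
exists (fun x => idm (F x)), (fun x => idm (F x)).
by split=> [x y f|x|x]; rewrite ?cmp_idl ?cmp_idr.
Qed.

Lemma iso_sym (F G : functor C D) : F ≅ G -> G ≅ F.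
Proof.
move=> [eta [theta [nat te et]]]; exists theta, eta; split=> // x y f.
by rewrite -[fhom G f]cmp_idr -et [cmp (fhom G f) _]cmpA -nat !cmpA te cmp_idl.
Qed.

Lemma iso_trans (G F H : functor C D) : F ≅ G -> G ≅ H -> F ≅ H.
Proof.
move=> [eta [theta [nat te et]]] [eta' [theta' [nat' te' et']]].
exists (fun x => cmp (eta' x) (eta x)), (fun x => cmp (theta x) (theta' x)).
split=> [x y f|x|x].
- by rewrite -cmpA nat !cmpA nat'.
- by rewrite -cmpA [cmp (theta' x) _]cmpA te' cmp_idl te.
- by rewrite -cmpA [cmp (eta x) _]cmpA et cmp_idl et'.
Qed.

Lemma iso_whiskerl (H : functor C D) (F G : functor B C) :
  F ≅ G -> H ∘ F ≅ H ∘ G.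
Proof.
move=> [eta [theta [nat te et]]].
exists (fun x => fhom H (eta x)), (fun x => fhom H (theta x)).
by split=> [x y f|x|x] /=; rewrite -!fhom_cmp ?nat ?te ?et ?fhom_id.
Qed.

Lemma iso_whiskerr (H : functor B C) (F G : functor C D) :
  F ≅ G -> F ∘ H ≅ G ∘ H.
Proof.
move=> [eta [theta [nat te et]]].
by exists (fun x => eta (H x)), (fun x => theta (H x)); split=> *; rewrite /= ?nat.
Qed.

End Isomorphisms.

(** A natural isomorphism into a product category is a family of natural
    isomorphisms; the components for the indices t, given only to exist, are
    picked by choice. *)
Lemma iso_family (B C D : category) (T : Type)
    (F G : functor B (family_cat C D T)) :
  fam_fst C D T ∘ F ≅ fam_fst C D T ∘ G ->
  (forall t, fam_at C D t ∘ F ≅ fam_at C D t ∘ G) -> F ≅ G.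
Proof.
move=> [eta0 [theta0 [nat0 te0 et0]]] h.
pose eta t := sval (cid (h t)); pose theta t := sval (cid (svalP (cid (h t)))).
have h' t := svalP (cid (svalP (cid (h t)))).
exists (fun x => (eta0 x, fun t => eta t x)).
exists (fun x => (theta0 x, fun t => theta t x)).
split=> [x y f|x|x] /=; congr pair => //;
  try (by have := nat0 x y f); try (by have := te0 x); try (by have := et0 x).
- apply: functional_extensionality_dep => t; have [nat _ _] := h' t.
  exact: nat.
- apply: functional_extensionality_dep => t; have [_ te _] := h' t.
  exact: te.
apply: functional_extensionality_dep => t; have [_ _ et] := h' t.
exact: et.
Qed.

Section GradedModules.
Variables (K : fieldType) (A : galg K) (C : category).
Implicit Types F G : functor C (gmod_cat A).

Lemma shift_iso k l F : k = l -> shift A k ∘ F ≅ shift A l ∘ F.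
Proof. by move=> ->; apply: iso_refl. Qed.

(** Shifts only relabel degrees, so that identity maps are the isomorphisms
    here and in the next lemma. *)
Lemma shift0 F : shift A 0 ∘ F ≅ F.
Proof.
have d1 x n (m : F x) : gm_deg n (m : gshift 0 (F x)) -> gm_deg n m.
  by rewrite /= /shift_deg subr0.
have d2 x n (m : F x) : gm_deg n m -> gm_deg n (m : gshift 0 (F x)).
  by rewrite /= /shift_deg subr0.
exists (fun x => @GHom _ _ (gshift 0 (F x)) (F x) id (fun _ _ _ => erefl) (d1 x)).
exists (fun x => @GHom _ _ (F x) (gshift 0 (F x)) id (fun _ _ _ => erefl) (d2 x)).
by split=> [x y f|x|x]; apply: ghom_eq.
Qed.

Lemma shiftD k l F : shift A k ∘ (shift A l ∘ F) ≅ shift A (k + l) ∘ F.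
Proof.
have e n : n - k - l = n - (k + l) by rewrite opprD addrA.
have d1 x n (m : F x) : gm_deg n (m : gshift k (gshift l (F x))) ->
    gm_deg n (m : gshift (k + l) (F x)).
  by rewrite /= /shift_deg /= /shift_deg e.
have d2 x n (m : F x) : gm_deg n (m : gshift (k + l) (F x)) ->
    gm_deg n (m : gshift k (gshift l (F x))).
  by rewrite /= /shift_deg /= /shift_deg e.
exists (fun x => @GHom _ _ (gshift k (gshift l (F x))) (gshift (k + l) (F x))
  id (fun _ _ _ => erefl) (d1 x)).
exists (fun x => @GHom _ _ (gshift (k + l) (F x)) (gshift k (gshift l (F x)))
  id (fun _ _ _ => erefl) (d2 x)).
by split=> [x y f|x|x]; apply: ghom_eq.
Qed.

(** Being the zero functor, in a form that passes to composites without
    mentioning isomorphisms. *)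
Definition vanishing F : Prop := forall x (m : F x), m = 0.

Lemma vanishing_const : vanishing (functor_const C (gzero A : gmod_cat A)).
Proof. by move=> x m; apply/rowP; case. Qed.

Lemma vanishing_iso F G : vanishing F -> vanishing G -> F ≅ G.
Proof.
move=> F0 G0.
have lin (M N : gmod A) a (x y : M) : 0 = a *: 0 + 0 :> N.
  by rewrite scaler0 addr0.
exists (fun x => @GHom _ _ (F x) (G x) (fun=> 0) (@lin (F x) (G x))
  (fun n _ _ => deg0 (gm_grading (G x)) n)).
exists (fun x => @GHom _ _ (G x) (F x) (fun=> 0) (@lin (G x) (F x))
  (fun n _ _ => deg0 (gm_grading (F x)) n)).
split=> [x y f|x|x]; apply: ghom_eq => m /=.
- by rewrite ghom0.
- by rewrite [m]F0.
- by rewrite [m]G0.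
Qed.

Lemma iso_vanishing F G : F ≅ G -> vanishing G -> vanishing F.
Proof.
move=> [eta [theta [_ te _]]] G0 x m.
by rewrite -[m]/(ghom_id (F x) m) -[ghom_id _](te x) /= (G0 _ (eta x m)) ghom0.
Qed.

Lemma vanishing_shift k F : vanishing F -> vanishing (shift A k ∘ F).
Proof. by move=> F0 x m; apply: F0. Qed.

Lemma vanishing_sum F G : vanishing F -> vanishing G -> vanishing (functor_sum F G).
Proof. by move=> F0 G0 x [m n]; rewrite [m]F0 [n]G0. Qed.

Lemma sum_iso F F' G G' :
  F ≅ F' -> G ≅ G' -> functor_sum F G ≅ functor_sum F' G'.
Proof.
move=> [eta [theta [nat te et]]] [eta' [theta' [nat' te' et']]].
exists (fun x => gsum_hom (eta x) (eta' x)).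
exists (fun x => gsum_hom (theta x) (theta' x)).
split=> [x y f|x|x]; apply: ghom_eq => -[m n]; congr pair => /=.
- by have /(congr1 (fun h => gh_fun h m)) := nat _ _ f.
- by have /(congr1 (fun h => gh_fun h n)) := nat' _ _ f.
- by have /(congr1 (fun h => gh_fun h m)) := te x.
- by have /(congr1 (fun h => gh_fun h n)) := te' x.
- by have /(congr1 (fun h => gh_fun h m)) := et x.
- by have /(congr1 (fun h => gh_fun h n)) := et' x.
Qed.

Lemma sum_vanishingl F G : vanishing F -> functor_sum F G ≅ G.
Proof.
move=> F0.
have l1 x a (m n : gsum (F x) (G x)) :
  (a *: m + n).2 = a *: m.2 + n.2 by [].
have l2 x a (m n : G x) :
    (0, a *: m + n) = a *: (0, m) + (0, n) :> gsum (F x) (G x).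
  by rewrite -[RHS]/(a *: 0 + 0, a *: m + n) scaler0 addr0.
have d1 x n (m : gsum (F x) (G x)) : gm_deg n m -> gm_deg n m.2 by case.
have d2 x n (m : G x) : gm_deg n m -> gm_deg n ((0, m) : gsum (F x) (G x)).
  by move=> dm; split=> //; apply: (deg0 (gm_grading (F x))).
exists (fun x => GHom (@l1 x) (@d1 x)), (fun x => GHom (@l2 x) (@d2 x)).
split=> [x y f|x|x]; apply: ghom_eq => // -[m n].
by congr pair; rewrite [m]F0.
Qed.

Lemma sum_vanishingr F G : vanishing G -> functor_sum F G ≅ F.
Proof.
move=> G0.
have l1 x a (m n : gsum (F x) (G x)) :
  (a *: m + n).1 = a *: m.1 + n.1 by [].
have l2 x a (m n : F x) :
    (a *: m + n, 0) = a *: (m, 0) + (n, 0) :> gsum (F x) (G x).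
  by rewrite -[RHS]/(a *: m + n, a *: 0 + 0) scaler0 addr0.
have d1 x n (m : gsum (F x) (G x)) : gm_deg n m -> gm_deg n m.1 by case.
have d2 x n (m : F x) : gm_deg n m -> gm_deg n ((m, 0) : gsum (F x) (G x)).
  by move=> dm; split=> //; apply: (deg0 (gm_grading (G x))).
exists (fun x => GHom (@l1 x) (@d1 x)), (fun x => GHom (@l2 x) (@d2 x)).
split=> [x y f|x|x]; apply: ghom_eq => // -[m n].
by congr pair; rewrite [n]G0.
Qed.

End GradedModules.

Section TensorFunctors.
Variables (K : fieldType) (A B : galg K) (N : gbimod A B).

Lemma vanishing_tensor (C : category) (F : functor C (gmod_cat B)) :
  vanishing F -> vanishing (tensor_functor N ∘ F).
Proof.
move=> F0 x m; move: m; apply: tensor_ext => [m m'|m m'|n m] //=.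
  by rewrite addr0.
by rewrite [m]F0 pure0r.
Qed.

(* Maps that shift degrees are not morphisms of graded modules; they still
   induce maps of tensor products. *)
Section Relabel.
Variables (M M' : gmod B) (f : M -> M').
Hypothesis f_linear : forall b x y, f (b *: x + y) = b *: f x + f y.

Definition tensor_relabel (x : tensor N M) : tensor N M' :=
  tlift (fun n m => pure n (f m)) x.

Let fD x y : f (x + y) = f x + f y.
Proof. by rewrite -[x in LHS]scale1r f_linear scale1r. Qed.

Let f0 : f 0 = 0. Proof. by apply: (addrI (f 0)); rewrite -fD !addr0. Qed.

Let fZ b x : f (b *: x) = b *: f x.
Proof. by rewrite -[_ *: x]addr0 f_linear f0 addr0. Qed.

Let relDl (n n' : N) m : pure (n + n') (f m) = pure n (f m) + pure n' (f m).
Proof. exact: pureDl. Qed.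

Let relDr (n : N) m m' : pure n (f (m + m')) = pure n (f m) + pure n (f m').
Proof. by rewrite fD pureDr. Qed.

Let relB (n : N) b m : pure (bm_act n b) (f m) = pure n (f (b *: m)).
Proof. by rewrite fZ pure_balance. Qed.

Lemma tensor_relabel_pure n m : tensor_relabel (pure n m) = pure n (f m).
Proof. exact: tlift_pure. Qed.

Lemma tensor_relabelD : {morph tensor_relabel : x y / x + y}.
Proof. exact: tliftD. Qed.

Lemma tensor_relabel_linear a x y :
  tensor_relabel (a *: x + y) = a *: tensor_relabel x + tensor_relabel y.
Proof.
rewrite tensor_relabelD; congr (_ + _).
move: x; apply: tensor_ext => [x x'|x x'|n m].
- by rewrite scalerDr tensor_relabelD.
- by rewrite tensor_relabelD scalerDr.
- by rewrite pureZ !tensor_relabel_pure pureZ.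
Qed.

Lemma tensor_relabel_deg k l x :
  (forall i m, gm_deg i m -> gm_deg (i - k) (f m)) ->
  tensor_deg l x -> tensor_deg (l - k) (tensor_relabel x).
Proof.
move=> df [s -> ds].
have t0 : tensor_relabel 0 = 0.
  by apply: (addrI (tensor_relabel 0)); rewrite -tensor_relabelD !addr0.
rewrite (big_morph _ tensor_relabelD t0); exists [seq (p.1, f p.2) | p <- s].
  by rewrite big_map; apply: eq_bigr => p _; rewrite tensor_relabel_pure.
move=> _ /mapP[p /ds[i [d1 d2]] ->]; exists i; split=> //=.
by rewrite addrAC; apply: df.
Qed.

End Relabel.

(** Tensoring commutes with shifts since only the sum of the two degrees matters
    in a tensor product.  The relations defining the tensor product mention the
    graded module, so that the tensor products with M and with M{k} are
    different types: the isomorphism sends n (x) m to n (x) m. *)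
Lemma tensor_shift k :
  tensor_functor N ∘ shift B k ≅ shift A k ∘ tensor_functor N.
Proof.
pose f (M : gmod B) := tensor_relabel (M := gshift k M) (M' := M) id.
pose g (M : gmod B) := tensor_relabel (M := M) (M' := gshift k M) id.
have lf (M : gmod B) a x y : f M (a *: x + y) = a *: f M x + f M y.
  exact: tensor_relabel_linear.
have lg (M : gmod B) a x y : g M (a *: x + y) = a *: g M x + g M y.
  exact: tensor_relabel_linear.
have df (M : gmod B) l x : tensor_deg l x -> tensor_deg (l - k) (f M x).
  exact: (@tensor_relabel_deg (gshift k M) M id (fun _ _ _ => erefl)).
have dg (M : gmod B) l x : tensor_deg (l - k) x -> tensor_deg l (g M x).
  move=> dx; rewrite -[l](subrK k) -[X in _ + X]opprK.
  apply: (@tensor_relabel_deg M (gshift k M) id (fun _ _ _ => erefl)) dx => i m.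
  by rewrite opprK /= /shift_deg addrK.
have fD (M : gmod B) x y : f M (x + y) = f M x + f M y.
  exact: tensor_relabelD.
have gD (M : gmod B) x y : g M (x + y) = g M x + g M y.
  exact: tensor_relabelD.
have fp (M : gmod B) n m : f M (pure n m) = pure n (m : M).
  exact: tensor_relabel_pure.
have gp (M : gmod B) n m : g M (pure n m) = pure n (m : gshift k M).
  exact: tensor_relabel_pure.
exists (fun M : gmod B => @GHom _ _ (gtensor N (gshift k M))
  (gshift k (gtensor N M)) (f M) (lf M) (df M)).
exists (fun M : gmod B => @GHom _ _ (gshift k (gtensor N M))
  (gtensor N (gshift k M)) (g M) (lg M) (dg M)).
split=> [M M' h|M|M]; apply: ghom_eq;
  apply: tensor_ext => [x y|x y|n m] //=.
- by rewrite tmapD fD.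
- by rewrite fD tmapD.
- by rewrite fp !tmap_pure fp.
- by rewrite fD gD.
- by rewrite fp gp.
- by rewrite gD fD.
- by rewrite gp fp.
Qed.

End TensorFunctors.

(** * The corners of an algebra and composites of tensor functors *)

(** These forms serve as coordinates on the spaces uAv below; by homogeneity,
    x (x) y (x) m |-> c(x y) m lowers degrees by d for such a form c. *)
Record is_coef (K : fieldType) (A : galg K) (d : int) (c : A -> K) : Prop :=
  IsCoef {
    coefD : forall x y, c (x + y) = c x + c y;
    coefZ : forall k x, c (galg_scal A k * x) = k * c x;
    coef_hom : forall n x, galg_deg A n x -> c x != 0 -> n = d }.

Section CornerBases.
Variables (K : fieldType) (A : galg K) (u v : A).

(** The three predicates describe the graded vector space uAv, for idempotents
    u and v: zero, a line in degree d, or the sum of a line in degree d and one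
    in degree d'.  A basis is given with its coordinate forms, which are defined
    on all of A, so that they can be applied to any product. *)
Definition zero_corner : Prop := forall x : A, u * x * v = 0.

Definition line_corner (d : int) : Prop := exists (z : A) (c : A -> K),
  [/\ galg_deg A d z, u * z * v = z, is_coef d c, c z = 1
    & forall x, u * x * v = x -> x = galg_scal A (c x) * z].

Definition plane_corner (d d' : int) : Prop :=
  exists (z z' : A) (c c' : A -> K),
  [/\ [/\ galg_deg A d z, u * z * v = z, is_coef d c & c z = 1],
      [/\ galg_deg A d' z', u * z' * v = z', is_coef d' c' & c' z' = 1],
      c z' = 0, c' z = 0
    & forall x, u * x * v = x ->
        x = galg_scal A (c x) * z + galg_scal A (c' x) * z'].

End CornerBases.

Section Corner.
Variables (K : fieldType) (A : galg K) (u v : A).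
Hypotheses (u_deg : galg_deg A 0 u) (u_idem : u * u = u).
Hypotheses (v_deg : galg_deg A 0 v) (v_idem : v * v = v).
Hypothesis A_findim : algebra_findim A.

Local Notation Q := (rproj_bimod u_deg u_idem A_findim).
Local Notation P := (lproj_bimod v_deg v_idem A_findim).
Local Notation vect := (gmod_cat (ground K)).

(** The functor uA (x)_A (Av (x) -), which is isomorphic to uAv (x) -. *)
Definition corner_functor : functor vect vect :=
  tensor_functor Q ∘ tensor_functor P.

Let corner_mul (x : Q) (y : P) :
  u * (rproj_val x * lproj_val y) * v = rproj_val x * lproj_val y.
Proof. by rewrite mulrA rproj_mull -mulrA lproj_mulr. Qed.

(* A coordinate form c gives the natural map x (x) y (x) m |-> c(x y) m. *)
Section Evaluation.
Variables (d : int) (c : A -> K).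
Hypothesis c_coef : is_coef d c.

Section Object.
Variable M : gmod (ground K).

Definition corner_eval_inner (x : Q) (t : gtensor P M) : M :=
  tlift (fun (y : P) (m : M) => (c (rproj_val x * lproj_val y) : ground K) *: m) t.

Let inner_Dl (x : Q) (y y' : P) (m : M) :
  (c (rproj_val x * lproj_val (y + y')) : ground K) *: m =
  (c (rproj_val x * lproj_val y) : ground K) *: m
  + (c (rproj_val x * lproj_val y') : ground K) *: m.
Proof. by rewrite /= mulrDr (coefD c_coef) scalerDl. Qed.

Let inner_Dr (x : Q) (y : P) (m m' : M) :
  (c (rproj_val x * lproj_val y) : ground K) *: (m + m') =
  (c (rproj_val x * lproj_val y) : ground K) *: m
  + (c (rproj_val x * lproj_val y) : ground K) *: m'.
Proof. exact: scalerDr. Qed.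

Let inner_B (x : Q) (y : P) (k : ground K) (m : M) :
  (c (rproj_val x * lproj_val (bm_act y k)) : ground K) *: m =
  (c (rproj_val x * lproj_val y) : ground K) *: (k *: m).
Proof.
by rewrite /= mulrA -galg_central (coefZ c_coef) scalerA mulrC.
Qed.

Lemma corner_eval_inner_pure x y m :
  corner_eval_inner x (pure y m) = (c (rproj_val x * lproj_val y) : ground K) *: m.
Proof. exact: tlift_pure. Qed.

Lemma corner_eval_innerD x : {morph corner_eval_inner x : t t' / t + t'}.
Proof. exact: tliftD. Qed.

Let outer_Dl (x x' : Q) t :
  corner_eval_inner (x + x') t = corner_eval_inner x t + corner_eval_inner x' t.
Proof.
move: t; apply: tensor_ext => [t t'|t t'|y m].
- by rewrite corner_eval_innerD.
- by rewrite !corner_eval_innerD addrACA.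
by rewrite !corner_eval_inner_pure /= mulrDl (coefD c_coef) scalerDl.
Qed.

Let outer_B (x : Q) (a : A) (t : gtensor P M) :
  corner_eval_inner (bm_act x a) t = corner_eval_inner x (a *: t).
Proof.
move: t; apply: tensor_ext => [t t'|t t'|y m].
- by rewrite corner_eval_innerD.
- by rewrite scalerDr corner_eval_innerD.
by rewrite pureZ !corner_eval_inner_pure /= mulrA.
Qed.

Definition corner_eval_fun (w : corner_functor M) : M := tlift corner_eval_inner w.

Lemma corner_eval_funD : {morph corner_eval_fun : w w' / w + w'}.
Proof. by apply: tliftD => // x t t'; apply: corner_eval_innerD. Qed.

Lemma corner_eval_fun_pure (x : Q) (y : P) (m : M) :
  corner_eval_fun (pure x (pure y m : gtensor P M)) =
  (c (rproj_val x * lproj_val y) : ground K) *: m.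
Proof.
rewrite /corner_eval_fun tlift_pure ?corner_eval_inner_pure //.
by move=> x' t t'; apply: corner_eval_innerD.
Qed.

Lemma corner_eval_linear (k : ground K) w w' :
  corner_eval_fun (k *: w + w') = k *: corner_eval_fun w + corner_eval_fun w'.
Proof.
rewrite corner_eval_funD; congr (_ + _); move: w.
apply: tensor_ext => [w1 w2|w1 w2|x t].
- by rewrite scalerDr corner_eval_funD.
- by rewrite corner_eval_funD scalerDr.
rewrite pureZ; move: t; apply: tensor_ext => [t t'|t t'|y m].
- by rewrite pureDr corner_eval_funD.
- by rewrite pureDr corner_eval_funD scalerDr.
by rewrite !corner_eval_fun_pure /= -mulrA (coefZ c_coef) scalerA.
Qed.

Lemma corner_eval_deg n w :
  gm_deg n w -> gm_deg n (corner_eval_fun w : gshift d M).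
Proof.
have gM := gm_grading M.
have z0 : corner_eval_fun 0 = 0.
  by apply: (addrI (corner_eval_fun 0)); rewrite -corner_eval_funD !addr0.
case=> s -> ds; rewrite (big_morph _ corner_eval_funD z0) big_seq.
apply: (deg_sum (shift_grading d M)) => -[x t] /ds[i [/= dx]] [r -> dr].
rewrite (big_morph (pure x) (pureDr x) (pure0r _ x)).
rewrite (big_morph _ corner_eval_funD z0) big_seq.
apply: (deg_sum (shift_grading d M)) => -[y m] /dr[j [/= dy dm]].
rewrite corner_eval_fun_pure.
have [->|c0] := eqVneq (c (rproj_val x * lproj_val y)) 0.
  by rewrite scale0r; apply: (deg0 gM).
have e := coef_hom c_coef (galg_degM dx dy) c0.
rewrite /shift_deg -e opprD addrA; apply: (degZ gM); exact: dm.
Qed.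

Definition corner_eval : @Defs.hom vect (corner_functor M) (gshift d M) :=
  @GHom _ _ (corner_functor M) (gshift d M) corner_eval_fun corner_eval_linear
    corner_eval_deg.

End Object.

Lemma corner_eval_natural (M N : gmod (ground K)) (f : ghom M N) w :
  corner_eval N (fhom corner_functor (f : @Defs.hom vect M N) w) =
  f (corner_eval M w).
Proof.
move: w; apply: tensor_ext => [w w'|w w'|x t].
- by rewrite !ghomD.
- by rewrite !ghomD.
move: t; apply: tensor_ext => [t t'|t t'|y m].
- by rewrite pureDr !ghomD.
- by rewrite pureDr !ghomD.
by rewrite /= !tmap_pure /= tmap_pure !corner_eval_fun_pure ghomZ.
Qed.

End Evaluation.

Lemma corner_ext (M : gmod (ground K)) (G : zmodType)
    (f g : corner_functor M -> G) :
  {morph f : w w' / w + w'} -> {morph g : w w' / w + w'} ->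
  (forall (x : Q) (y : P) (m : M), f (pure x (pure y m : gtensor P M)) =
     g (pure x (pure y m : gtensor P M))) -> f =1 g.
Proof.
move=> fD gD fg; apply: tensor_ext => // x.
by apply: tensor_ext => [t t'|t t'|y m] //; rewrite pureDr ?fD ?gD.
Qed.

Definition lproj_unit : P := LProj (lproj_gen v_idem 1).

Definition corner_gen (M : gmod (ground K)) (x : Q) (m : M) : corner_functor M :=
  pure x (pure lproj_unit m : gtensor P M).

(** Everything moves to the first factor: x (x) (y (x) m) = x y (x) (v (x) m), as
    y = y v for y in Av. *)
Lemma corner_pure (M : gmod (ground K)) (x : Q) (y : P) (m : M) :
  pure x (pure y m : gtensor P M) = corner_gen (bm_act x (lproj_val y)) m.
Proof.
have {1}-> : y = lproj_val y *: lproj_unit.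
  by apply: val_inj; rewrite /= mul1r lproj_mulr.
by rewrite -pureZ -pure_balance.
Qed.

Lemma corner_genDl (M : gmod (ground K)) (x x' : Q) (m : M) :
  corner_gen (x + x') m = corner_gen x m + corner_gen x' m.
Proof. exact: pureDl. Qed.

Lemma corner_genDr (M : gmod (ground K)) (x : Q) (m m' : M) :
  corner_gen x (m + m') = corner_gen x m + corner_gen x m'.
Proof. by rewrite /corner_gen !pureDr. Qed.

Lemma corner_genZ (M : gmod (ground K)) (x : Q) (k : ground K) (m : M) :
  corner_gen (k *: x) m = corner_gen x (k *: m).
Proof.
rewrite /corner_gen -(pure_balance (N := P) lproj_unit k m).
rewrite [bm_act lproj_unit k](bm_act_scal (k : K) lproj_unit) -(pureZ (N := P)).
rewrite -(pure_balance (N := Q)); congr pure; apply: val_inj => /=.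
exact: galg_central.
Qed.

(* In the other direction, z in uAv gives the map m |-> z (x) (v (x) m). *)
Section Insertion.
Variables (d : int) (z : A).
Hypotheses (z_deg : galg_deg A d z) (z_corner : u * z * v = z).

Lemma corner_in_rproj : z \in in_rproj u.
Proof. by rewrite unfold_in -{1}z_corner !mulrA u_idem z_corner. Qed.

Definition corner_elt : Q := RProj corner_in_rproj.

Section Object.
Variable M : gmod (ground K).

Definition corner_insert_fun (m : M) : corner_functor M :=
  corner_gen corner_elt m.

Lemma corner_insert_linear (k : ground K) m m' :
  corner_insert_fun (k *: m + m') =
  k *: corner_insert_fun m + corner_insert_fun m'.
Proof.
by rewrite /corner_insert_fun corner_genDr -corner_genZ [in RHS]/corner_gen pureZ.
Qed.

Lemma corner_insert_deg n m :
  gm_deg n (m : gshift d M) -> gm_deg n (corner_insert_fun m).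
Proof.
move=> dm; rewrite /= -[n](subrK d) addrC; apply: pure_deg => //.
rewrite -[n - d]add0r; apply: pure_deg => //=.
by rewrite /lproj_deg /= mul1r.
Qed.

Definition corner_insert : @Defs.hom vect (gshift d M) (corner_functor M) :=
  @GHom _ _ (gshift d M) (corner_functor M) corner_insert_fun
    corner_insert_linear corner_insert_deg.

End Object.

Lemma corner_eval_insert d' c (c_coef : is_coef d' c) (M : gmod (ground K)) m :
  corner_eval c_coef M (corner_insert M m) = (c z : ground K) *: m.
Proof.
by rewrite [LHS](corner_eval_fun_pure c_coef) /= mul1r -{1}z_corner -mulrA v_idem z_corner.
Qed.

End Insertion.

Lemma corner_vanishing : zero_corner u v -> vanishing corner_functor.
Proof.
move=> uv0 M; apply: corner_ext => // [w w'|x y m]; first by rewrite addr0.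
rewrite corner_pure (_ : bm_act _ _ = 0) ?[LHS]pure0l //.
by apply: val_inj; rewrite /= -corner_mul uv0.
Qed.

(** Evaluation at the coordinate form and insertion of the basis vector are
    inverse to each other. *)
Lemma corner_line d :
  line_corner u v d -> corner_functor ≅ shift (ground K) d.
Proof.
move=> [z [c [zd zuv cc cz span]]].
exists (corner_eval cc), (corner_insert zd zuv); split=> [M N f|M|M].
- by apply: ghom_eq => w; apply: corner_eval_natural.
- apply: ghom_eq; apply: corner_ext => [w w'|w w'|x y m] //.
    by rewrite !ghomD.
  rewrite /= (corner_eval_fun_pure cc) /corner_insert_fun -corner_genZ corner_pure.
  by congr corner_gen; apply: val_inj; rewrite /= [RHS]span ?corner_mul.
by apply: ghom_eq => m; rewrite [LHS]corner_eval_insert cz scale1r.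
Qed.

(** As for a line, with the two evaluations and the two insertions combined. *)
Lemma corner_plane d d' : plane_corner u v d d' ->
  corner_functor ≅ functor_sum (shift (ground K) d) (shift (ground K) d').
Proof.
move=> [z [z' [c [c' [[zd zuv cc cz] [zd' zuv' cc' cz1'] cz' cz1 span]]]]].
pose S := functor_sum (shift (ground K) d) (shift (ground K) d').
have ev_lin (M : gmod (ground K)) a x y :
    (corner_eval cc M (a *: x + y), corner_eval cc' M (a *: x + y)) =
    a *: (corner_eval cc M x, corner_eval cc' M x)
    + (corner_eval cc M y, corner_eval cc' M y) :> S M.
  by rewrite !gh_linear.
have ev_deg (M : gmod (ground K)) n x : gm_deg n x ->
    gm_deg n ((corner_eval cc M x, corner_eval cc' M x) : S M).
  by move=> dx; split; apply: gh_deg.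
have in_lin (M : gmod (ground K)) a (x y : S M) :
    corner_insert zd zuv M (a *: x + y).1
      + corner_insert zd' zuv' M (a *: x + y).2 =
    a *: (corner_insert zd zuv M x.1 + corner_insert zd' zuv' M x.2)
      + (corner_insert zd zuv M y.1 + corner_insert zd' zuv' M y.2).
  by rewrite !gh_linear scalerDr addrACA.
have in_deg (M : gmod (ground K)) n (x : S M) : gm_deg n x ->
    gm_deg n (corner_insert zd zuv M x.1 + corner_insert zd' zuv' M x.2).
  by case=> d1 d2; apply: (degD (gm_grading (corner_functor M))); apply: gh_deg.
exists (fun M => GHom (@ev_lin M) (@ev_deg M)), (fun M => GHom (@in_lin M) (@in_deg M)).
split=> [M N f|M|M]; apply: ghom_eq.
- by move=> w; congr pair; apply: corner_eval_natural.
- apply: corner_ext => [w w'|w w'|x y m] //; first by rewrite ghomD.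
  rewrite /= (corner_eval_fun_pure cc) (corner_eval_fun_pure cc').
  rewrite /corner_insert_fun -!corner_genZ corner_pure.
  rewrite -corner_genDl.
  by congr corner_gen; apply: val_inj; rewrite /= [RHS]span ?corner_mul.
move=> [m m']; rewrite /=; congr pair.
  rewrite (corner_eval_funD cc).
  rewrite [X in X + _](corner_eval_insert zd zuv cc).
  rewrite [X in _ + X](corner_eval_insert zd' zuv' cc).
  by rewrite cz cz' scale1r scale0r addr0.
rewrite (corner_eval_funD cc').
rewrite [X in X + _](corner_eval_insert zd zuv cc').
rewrite [X in _ + X](corner_eval_insert zd' zuv' cc').
by rewrite cz1 cz1' scale1r scale0r add0r.
Qed.

End Corner.

(** * The corners of zigzag algebras *)

Lemma galg_scal_mul3 (K : fieldType) (A : galg K) k l (f s g : A) :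
  galg_scal A k * f * s * (galg_scal A l * g) =
  galg_scal A k * (galg_scal A l * (f * s * g)).
Proof.
rewrite -!mulrA; congr (_ * _); rewrite [s * _]mulrA -[s * _]galg_central.
by rewrite -mulrA mulrA -[f * _]galg_central -mulrA.
Qed.

Lemma galg_mul3B (K : fieldType) (A : galg K) (p s t q : A) :
  p * (s - t) * q = p * s * q + galg_scal A (-1) * (p * t * q).
Proof. by rewrite rmorphN1 mulN1r mulrBr mulrBl. Qed.

Definition spans (K : fieldType) (A : galg K) (B : A -> Prop) : Prop :=
  forall Q : A -> Prop, Q 0 -> (forall x y, Q x -> Q y -> Q (x + y)) ->
    (forall k x, B x -> Q (galg_scal A k * x)) -> forall x, Q x.

(** How a linear form on an algebra descends to the quotient by the ideal
    generated by S: by bilinearity, only the products p s q with p and q in a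
    spanning set have to be tested. *)
Lemma ideal_spanning_ind (K : fieldType) (A : galg K) (B S : A -> Prop)
    (c : A -> K) :
  spans B ->
  {morph c : x y / x + y} -> (forall k x, c (galg_scal A k * x) = k * c x) ->
  (forall p q s, B p -> B q -> S s -> c (p * s * q) = 0) ->
  forall x, ideal S x -> c x = 0.
Proof.
move=> Bind cD cZ cS; have c0 : c 0 = 0 by apply: (addrI (c 0)); rewrite -cD !addr0.
move=> x; elim=> [x1 s x2 Ss|//|y z _ cy _ cz]; last by rewrite cD cy cz addr0.
move: x1; apply: (Bind _) => [|y z ey ez|k p Bp].
- by rewrite !mul0r.
- by rewrite !mulrDl cD ey ez addr0.
move: x2; apply: (Bind _) => [|y z ey ez|l q Bq].
- by rewrite mulr0.
- by rewrite mulrDr cD ey ez addr0.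
by rewrite galg_scal_mul3 !cZ cS // !mulr0.
Qed.

Record is_klinear (K : fieldType) (P A : galg K) (f : P -> A) : Prop := IsKLinear {
  klinearD : {morph f : x y / x + y};
  klinearZ : forall k x, f (galg_scal P k * x) = galg_scal A k * f x }.

(** A formula for the projection x |-> u x v to a corner can be checked on a
    spanning set; f is the map to a quotient below. *)
Lemma spanning_corner (K : fieldType) (P A : galg K) (B : P -> Prop)
    (f T : P -> A) (u v : A) :
  spans B ->
  is_klinear f -> is_klinear T -> (forall x, B x -> u * f x * v = T x) ->
  forall x, u * f x * v = T x.
Proof.
have z0 (g : P -> A) : is_klinear g -> g 0 = 0.
  by move=> gl; apply: (addrI (g 0)); rewrite -(klinearD gl) !addr0.
move=> Bind fl Tl fT; apply: Bind => [|x y ex ey|k x Bx].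
- by rewrite !z0 // mulr0 mul0r.
- by rewrite (klinearD fl) (klinearD Tl) mulrDr mulrDl ex ey.
rewrite (klinearZ fl) (klinearZ Tl) -fT // !mulrA; congr (_ * _ * _).
exact/esym/galg_central.
Qed.

Lemma klinear_line (K : fieldType) (P A : galg K) (c : P -> K) (z : A) :
  {morph c : x y / x + y} -> (forall k x, c (galg_scal P k * x) = k * c x) ->
  is_klinear (fun x => galg_scal A (c x) * z).
Proof.
by move=> cD cZ; split=> [x y|k x]; rewrite ?cD ?cZ (rmorphD, rmorphM) ?mulrDl ?mulrA.
Qed.

Lemma klinear_add (K : fieldType) (P A : galg K) (f g : P -> A) :
  is_klinear f -> is_klinear g -> is_klinear (fun x => f x + g x).
Proof.
move=> fl gl; split=> [x y|k x].
  by rewrite (klinearD fl) (klinearD gl) addrACA.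
by rewrite (klinearZ fl) (klinearZ gl) mulrDr.
Qed.

Section PathCoefficients.
Variables (K : fieldType) (I : finType) (e : rel I).
Local Notation PA := (path_galg K e).
Local Notation walk := (walk K e).

Definition path_from_to (d : nat) (a b : I) (s : seq I) : bool :=
  if s is x :: s' then [&& size s' == d, x == a & last x s' == b] else false.

(** The sum of the coefficients of the paths of length d from a to b.  For d = 0
    and d = 1 at most one path contributes.  For d = 2 and a = b the paths are
    the loops (a|y|a), which the zigzag relations identify with each other: it is
    their sum of coefficients that descends to the quotient. *)
Definition path_coef (d : nat) (a b : I) (f : path_alg K e) : K^o :=
  lin (fun p : qpath e => (path_from_to d a b p)%:R : K^o) f.

Lemma path_coef_walk d a b s : is_walk e s ->
  path_coef d a b (walk s) = (path_from_to d a b s)%:R.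
Proof. by move=> ws; rewrite (walkE K (QPath ws)) /path_coef linU scale1r. Qed.

Lemma path_coef_hom d a b n (f : PA) :
  galg_deg PA n f -> path_coef d a b f != 0 -> n = d%:Z.
Proof.
move=> df; apply: contraNeq => nd; rewrite /path_coef /lin big1_seq // => p.
move=> /andP[_]; rewrite -mcoeff_neq0 => /df en; rewrite [_%:R](_ : _ = 0) ?scaler0 //.
case: p en => -[|x s] //= ws en; have [sd|] := eqVneq (size s) d => //.
by rewrite en /qlength /= sd eqxx in nd.
Qed.

Lemma path_coefD d a b (f g : PA) :
  path_coef d a b (f + g) = path_coef d a b f + path_coef d a b g.
Proof. exact: (@linD K _ K^o _ f g). Qed.

Lemma path_coefZ d a b k (f : PA) :
  path_coef d a b (galg_scal PA k * f) = k * path_coef d a b f.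
Proof. by rewrite [galg_scal PA k * f]path_scal_mul /path_coef linZ. Qed.

Lemma path_mul3 (p q : qpath e) s : is_walk e s ->
  (<< p >> : PA) * walk s * (<< q >> : PA) = walk (cat_walk (cat_walk p s) q).
Proof.
move=> ws; rewrite -[RHS](path_mul_catl K q (qpathP p) ws).
by rewrite -[_ * walk s]/(path_mul _ _) -walkE path_mul_walk // qpathP.
Qed.

Lemma paths_span : spans (fun f : PA => exists p : qpath e, f = << p >>).
Proof.
move=> Q Q0 QD QZ; apply: malg_ind => // k p.
by rewrite -path_scal_mul; apply: QZ; exists p.
Qed.

(** The middle path enters only through its length and its two ends.  Hence path
    coefficients take the same value on p (a|y|a) q and p (a|z|a) q. *)
Lemma path_from_to_cat3 d a b (p q : qpath e) y s :
  path_from_to d a b (cat_walk (cat_walk p (y :: s)) q) =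
  [&& last a (behead p) == y, last y s == head y q,
      size (behead p) + size s + size (behead q) == d,
      head a p == a & last (head y q) (behead q) == b]%N.
Proof.
case: p q => -[|x p] //= _ [[|z q] //= _].
have [xa|xa] := eqVneq x a; last first.
  rewrite !andbF; case: ifP => //= _; case: ifP => //= _.
  by rewrite (negPf xa) andbF.
rewrite xa; case: eqP => [<-|] //=; rewrite last_cat; case: eqP => [<-|] //=.
by rewrite eqxx !last_cat !size_cat.
Qed.

Lemma path_coef_mul3 d a b (p q : qpath e) y s : is_walk e (y :: s) ->
  path_coef d a b ((<< p >> : PA) * walk (y :: s) * (<< q >> : PA)) =
  [&& last a (behead p) == y, last y s == head y q,
      size (behead p) + size s + size (behead q) == d,
      head a p == a & last (head y q) (behead q) == b]%N%:R.
Proof.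
move=> ws; rewrite path_mul3 // -path_from_to_cat3; set t := cat_walk _ _.
have [t0|tw] := boolP (t == [::]).
  by rewrite (eqP t0) walk0 // /path_coef lin0.
have pw : cat_walk p (y :: s) != [::].
  by apply: contraNneq tw; rewrite /t => ->.
by rewrite path_coef_walk // is_walk_cat ?is_walk_cat // qpathP.
Qed.

(** The relations of the zigzag algebras of the connected graphs with two vertices
    and with more vertices, taken together: both ideals contain all of them, and
    are generated by some of them. *)
Definition elementary_rel (f : PA) : Prop :=
  [\/ exists2 p : qpath e, (2 < qlength p)%N & f = walk p,
      exists x y z, [/\ e x y, e y z, x != z & f = walk [:: x; y; z]]
    | exists x y z, [/\ e x y, e y x, e x z, e z x
        & f = walk [:: x; y; x] - walk [:: x; z; x]]].

Section Quotient.
Variable S : PA -> Prop.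
Hypothesis S_hom : forall f, S f -> exists n, galg_deg PA n f.
Hypothesis S_gen : forall f, S f -> elementary_rel f.
Hypothesis S_long : forall p : qpath e, (2 < qlength p)%N -> ideal S (walk p).
Hypothesis S_straight : forall x y z, e x y -> e y z -> x != z ->
  ideal S (walk [:: x; y; z]).
Hypothesis S_loop : forall x y z, e x y -> e x z ->
  ideal S (walk [:: x; y; x] - walk [:: x; z; x]).
Hypothesis e_irr : irreflexive e.
Hypothesis e_sym : symmetric e.

Let A : vertex_galg K I := path_quotient S_hom.
Let cl : PA -> A := quo_pi S.

(** Long paths and products of a straight path (x|y|z), x <> z, with other paths
    are not among the paths counted by the coefficient: a product of length at
    most 2 is the straight path itself, which is not a loop.  Two loops at x are
    counted equally. *)
Lemma path_coef_ideal d a b f :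
  (d < 2)%N || (d == 2)%N && (a == b) -> ideal S f -> path_coef d a b f = 0.
Proof.
move=> dab; apply: (ideal_spanning_ind paths_span) => [g h|k g|].
- exact: path_coefD.
- exact: path_coefZ.
move=> _ _ s [p ->] [q ->] /S_gen[[r lr ->]|[x [y [z [xy yz xz ->]]]]|].
- case: r lr => -[|x r] //= wr lr; rewrite path_coef_mul3 //.
  rewrite [X in _ + X + _ == d]/= [X in X%:R](_ : _ = 0%N) //.
  apply/eqP; rewrite eqb0; apply/negP=> /and5P[_ _ /eqP ed _ _].
  by move: dab lr; rewrite -ed /qlength /=; lia.
- rewrite path_coef_mul3 /= ?xy ?yz //; rewrite [X in X%:R](_ : _ = 0%N) //.
  apply/eqP; rewrite eqb0; apply: contra xz.
  case: p q => -[|u p] //= _ [[|v q] //= _] /and5P[px /eqP zv /eqP ed /eqP ua qb].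
  have p0 : p = [::] by apply: size0nil; lia.
  have q0 : q = [::] by apply: size0nil; lia.
  have d2 : (d < 2)%N = false by lia.
  move: dab; rewrite d2 /= => /andP[_ /eqP ab].
  by move: px qb; rewrite p0 q0 /= zv -ab => /eqP-> /eqP->.
move=> [x [y [z [xy yx xz zx ->]]]].
rewrite (galg_mul3B (A := PA) << p >> (walk [:: x; y; x]) (walk [:: x; z; x]) << q >>).
rewrite path_coefD.
rewrite [X in _ + X]path_coefZ.
rewrite [X in X + _]path_coef_mul3 /= ?xy ?yx //.
rewrite [X in _ + _ * X]path_coef_mul3 /= ?xz ?zx //.
by rewrite mulN1r subrr.
Qed.

Lemma cl_linear : is_klinear (P := PA) (A := A) cl.
Proof. by split=> [f g|k f]; [apply: quo_piD | apply: quo_piM]. Qed.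

Definition quo_coef d a b (x : A) : K := path_coef d a b (quo_repr x).

Lemma quo_coef_cl d a b f :
  (d < 2)%N || (d == 2)%N && (a == b) -> quo_coef d a b (cl f) = path_coef d a b f.
Proof.
move=> dab; rewrite /quo_coef -[quo_repr _](subrK f) path_coefD.
by rewrite [X in X + _]path_coef_ideal ?add0r //; apply: quo_repr_pi.
Qed.

Lemma quo_coefP d a b :
  (d < 2)%N || (d == 2)%N && (a == b) -> is_coef (A := A) d%:Z (quo_coef d a b).
Proof.
move=> dab; split=> [x y|k x|n _ [f df ->]].
- rewrite -[x]quo_reprK -[y]quo_reprK -quo_piD !quo_coef_cl //.
  exact: path_coefD.
- rewrite -[x]quo_reprK -[_ * _]quo_piM !quo_coef_cl //.
  exact: path_coefZ.
by rewrite quo_coef_cl //; apply: path_coef_hom.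
Qed.

Lemma vertex_corner a b (p : qpath e) :
  vg_vertex A a * cl << p >> * vg_vertex A b =
  if path_from_to (qlength p) a b p then cl << p >> else 0.
Proof.
rewrite -[vg_vertex A a]/(cl (walk [:: a])) -[vg_vertex A b]/(cl (walk [:: b])).
rewrite -[X in X * _]quo_piM -[LHS]quo_piM -[_ * _]/(path_mul (path_mul _ _) _).
rewrite -{1}walkE path_mul_walk ?qpathP //; case: p => -[|x p] //= wp.
have [->|ax] := eqVneq a x; last first.
  by rewrite andbF (@walk0 _ _ _ [::]) // path_mul0 quo_pi0.
rewrite path_mul_walk //= cats0 ?eqxx /=; case: eqP => _; first by rewrite -walkE.
by rewrite walk0 // quo_pi0.
Qed.

(** To describe the corner at a and b it is enough to know the classes of the
    paths from a to b. *)
Lemma corner_expand a b (T : PA -> A) :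
  is_klinear T ->
  (forall p : qpath e, path_from_to (qlength p) a b p -> cl << p >> = T << p >>) ->
  (forall p : qpath e, ~~ path_from_to (qlength p) a b p -> T << p >> = 0) ->
  forall x, vg_vertex A a * x * vg_vertex A b = T (quo_repr x).
Proof.
move=> Tlin T1 T2 x; rewrite -{1}[x]quo_reprK.
apply: (spanning_corner paths_span cl_linear Tlin) => _ [p ->].
by rewrite vertex_corner; case: ifPn => [/T1|/T2].
Qed.

Lemma path_coefU d a b (p : qpath e) :
  path_coef d a b << p >> = (path_from_to d a b p)%:R.
Proof. by rewrite -walkE path_coef_walk ?qpathP. Qed.

Lemma path_from_to_length d a b (p : qpath e) :
  path_from_to d a b p = (qlength p == d) && path_from_to (qlength p) a b p.
Proof. by case: p => -[|x p] //= _; rewrite ?andbF // /qlength /= eqxx. Qed.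

Lemma cl_ideal f : ideal S f -> cl f = 0.
Proof. by move=> Sf; rewrite -(quo_pi0 S); apply/quo_piP; rewrite subr0. Qed.

Lemma cl_long (p : qpath e) : (2 < qlength p)%N -> cl << p >> = 0.
Proof. by move=> lp; rewrite -walkE; apply/cl_ideal/S_long. Qed.

Lemma cl_straight a b (p : qpath e) : a != b -> path_from_to 2 a b p ->
  cl << p >> = 0.
Proof.
move=> ab fp; rewrite -walkE; apply: cl_ideal; case: p fp.
case=> [|x [|y [|z [|? ?]]]] //= /and3P[xy yz _] /andP[/eqP xa /eqP zb].
by apply: S_straight; rewrite // xa zb.
Qed.

Lemma cl_loop a y (p : qpath e) : e a y -> path_from_to 2 a a p ->
  cl << p >> = cl (walk [:: a; y; a]).
Proof.
move=> ay fp; rewrite -walkE; apply/quo_piP; case: p fp.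
case=> [|x [|z [|t [|? ?]]]] //= /and3P[xz zt _] /andP[/eqP xa /eqP ta].
by rewrite {}xa {}ta in xz zt *; apply: S_loop.
Qed.

Lemma path_edge a b (p : qpath e) : path_from_to 1 a b p ->
  e a b /\ << p >> = walk [:: a; b].
Proof.
move=> fp; rewrite -walkE; case: p fp.
by case=> [|x [|y [|? ?]]] //= /andP[xy _] /andP[/eqP <- /eqP <-].
Qed.

Lemma path_vertex a b (p : qpath e) : path_from_to 0 a b p ->
  a = b /\ << p >> = walk [:: a].
Proof.
move=> fp; rewrite -walkE; case: p fp.
by case=> [|x [|? ?]] //= _ /andP[/eqP <- /eqP <-].
Qed.

(** A path from a to another vertex b has length at least 1, and length 1 only if
    it is an edge; those of length 2 are straight, and all longer ones are zero.
    Hence the corner at a and b is zero if a and b are not adjacent, and a line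
    spanned by the edge (a|b) if they are. *)
Lemma quotient_zero_corner a b : a != b -> ~~ e a b ->
  zero_corner (vg_vertex A a) (vg_vertex A b).
Proof.
move=> ab nab; apply: (@corner_expand a b (fun=> 0)) => //.
  by split=> [f g|k f]; rewrite ?addr0 ?mulr0.
move=> p; case E: (qlength p) => [|[|[|n]]] fp.
- by case: (path_vertex fp) ab => ->; rewrite eqxx.
- by case: (path_edge fp) nab => ->.
- exact: cl_straight fp.
by apply: cl_long; rewrite E.
Qed.

Lemma quotient_line_corner a b : e a b ->
  line_corner (vg_vertex A a) (vg_vertex A b) 1.
Proof.
move=> ab; have ab' : a != b by apply: contraTneq ab => ->; rewrite e_irr.
exists (cl (walk [:: a; b])), (quo_coef 1 a b); split.
- by exists (walk [:: a; b]) => //; apply: (@walk_deg K I e [:: a; b]).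
- have w : is_walk e [:: a; b] by rewrite /= ab.
  by rewrite (walkE K (QPath w)) vertex_corner /= !eqxx.
- exact: quo_coefP.
- by rewrite quo_coef_cl // path_coef_walk /= ?ab // !eqxx.
move=> x {1}<-; apply: (corner_expand
  (T := fun f => galg_scal A (path_coef 1 a b f) * cl (walk [:: a; b]))).
- by apply: klinear_line; [apply: path_coefD | apply: path_coefZ].
- move=> p; rewrite path_coefU (path_from_to_length 1).
  case E: (qlength p) => [|[|[|n]]] fp; rewrite /= ?rmorph0 ?mul0r.
  + by case: (path_vertex fp) ab' => ->; rewrite eqxx.
  + by rewrite fp rmorph1 mul1r; case: (path_edge fp) => _ ->.
  + exact: cl_straight fp.
  by apply: cl_long; rewrite E.
move=> p nfp; rewrite path_coefU (path_from_to_length 1) (negPf nfp) andbF.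
by rewrite rmorph0 mul0r.
Qed.

(** The paths from a to a that survive are (a) and the loops (a|y|a), which are
    all equal. *)
Lemma quotient_plane_corner a b : e a b ->
  plane_corner (vg_vertex A a) (vg_vertex A a) 2 0.
Proof.
move=> ab; have ba : e b a by rewrite e_sym.
exists (cl (walk [:: a; b; a])), (vg_vertex A a), (quo_coef 2 a a), (quo_coef 0 a a).
split.
- split.
  + by exists (walk [:: a; b; a]) => //; apply: (@walk_deg K I e [:: a; b; a]).
  + have w : is_walk e [:: a; b; a] by rewrite /= ab ba.
    by rewrite (walkE K (QPath w)) vertex_corner /= !eqxx.
  + by apply: quo_coefP; rewrite /= eqxx.
  by rewrite quo_coef_cl ?eqxx // path_coef_walk /= ?ab ?ba // !eqxx.
- split; [exact: vg_deg | by rewrite !vg_idem | exact: quo_coefP |].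
  by rewrite quo_coef_cl // path_coef_walk //= !eqxx.
- by rewrite quo_coef_cl ?eqxx // path_coef_walk.
- by rewrite quo_coef_cl // path_coef_walk //= ab ba.
move=> x {1}<-; apply: (corner_expand
  (T := fun f => galg_scal A (path_coef 2 a a f) * cl (walk [:: a; b; a])
    + galg_scal A (path_coef 0 a a f) * vg_vertex A a)).
- by apply: klinear_add; apply: klinear_line; do ?[exact: path_coefD | exact: path_coefZ].
- move=> p; rewrite !path_coefU.
  rewrite (path_from_to_length 0) (path_from_to_length 2).
  case E: (qlength p) => [|[|[|n]]] fp; rewrite /= ?rmorph0 ?mul0r ?add0r ?addr0.
  + by rewrite fp rmorph1 mul1r; case: (path_vertex fp) => _ ->.
  + by case: (path_edge fp); rewrite e_irr.
  + by rewrite fp rmorph1 mul1r; apply: cl_loop.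
  by apply: cl_long; rewrite E.
move=> p nfp; rewrite !path_coefU (path_from_to_length 0) (path_from_to_length 2).
by rewrite (negPf nfp) !andbF rmorph0 !mul0r addr0.
Qed.

End Quotient.
End PathCoefficients.

Section ZigzagCorners.
Variables (K : fieldType) (I : finType) (e : rel I).
Hypothesis e_irr : irreflexive e.
Hypothesis e_sym : symmetric e.
Hypothesis e_conn : forall D : {set I}, D != set0 -> D != setT ->
  exists a b, [/\ a \in D, b \notin D & e a b].
Local Notation Z := (zigzag K e).
Local Notation PA := (path_galg K e).

(** With one vertex nothing is asserted.  With two vertices there are no straight
    paths of length 2 and only one loop at each vertex; with more of them, long
    paths vanish because the graph is connected. *)
Lemma zigzag_corners a b : a != b ->
  [/\ ~~ e a b -> zero_corner (vg_vertex Z a) (vg_vertex Z b),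
      e a b -> line_corner (vg_vertex Z a) (vg_vertex Z b) 1
    & e a b -> plane_corner (vg_vertex Z a) (vg_vertex Z a) 2 0].
Proof.
move=> ab; have cI : (1 < #|I|)%N.
  rewrite (cardD1 a) inE (cardD1 b) !inE eq_sym ab /=; lia.
rewrite /zigzag (gtn_eqF cI); case: eqP => [c2|c2].
  have gen (f : PA) : long_path_rel f -> elementary_rel f.
    by case=> p lp; constructor 1; exists p.
  have long (p : qpath e) : (2 < qlength p)%N -> ideal (@long_path_rel K I e) (walk K e p).
    by move=> lp; apply: (@ideal_sub _ PA); apply: LongPath.
  have no3 x y z : e x y -> e y z -> x = z.
    move=> xy yz; apply: contra_eq c2 => xz; rewrite neq_ltn; apply/orP; right.
    have xy' : x != y by apply: contraTneq xy => ->; rewrite e_irr.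
    have yz' : y != z by apply: contraTneq yz => ->; rewrite e_irr.
    rewrite (cardD1 x) inE (cardD1 y) !inE eq_sym xy' (cardD1 z) !inE.
    by rewrite [z == x]eq_sym xz [z == y]eq_sym yz' /=; lia.
  have straight x y z : e x y -> e y z -> x != z ->
      ideal (@long_path_rel K I e) (walk K e [:: x; y; z]).
    by move=> xy yz; rewrite (no3 _ _ _ xy yz) eqxx.
  have loop x y z : e x y -> e x z ->
      ideal (@long_path_rel K I e) (walk K e [:: x; y; x] - walk K e [:: x; z; x]).
    move=> xy xz; have yx : e y x by rewrite e_sym.
    by rewrite (no3 _ _ _ yx xz) subrr; apply: ideal_zero.
  split; [exact: quotient_zero_corner | exact: quotient_line_corner |].
  exact: quotient_plane_corner.
have gen (f : PA) : zigzag_rel f -> elementary_rel f.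
  case=> [x y z xy yz xz|x y z xy xz]; [constructor 2|constructor 3];
    by exists x, y, z; split; rewrite // e_sym.
have long (p : qpath e) : (2 < qlength p)%N -> ideal (@zigzag_rel K I e) (walk K e p).
  by apply: zigzag_long => //; lia.
have straight x y z : e x y -> e y z -> x != z ->
    ideal (@zigzag_rel K I e) (walk K e [:: x; y; z]).
  by move=> xy yz xz; apply: (@ideal_sub _ PA); apply: ZigzagStraight.
have loop x y z : e x y -> e x z ->
    ideal (@zigzag_rel K I e) (walk K e [:: x; y; x] - walk K e [:: x; z; x]).
  by move=> xy xz; apply: (@ideal_sub _ PA); apply: ZigzagLoop.
split; [exact: quotient_zero_corner | exact: quotient_line_corner |].
exact: quotient_plane_corner.
Qed.

End ZigzagCorners.

(** * Simply laced root systems *)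

Section Roots.
Variables (R : realType) (D : simply_laced_system R).
Local Notation V := (sls_space D).
Local Notation form := (@sls_form R D).
Local Notation Phi := (sls_roots D).

Lemma formC x y : form x y = form y x.
Proof. exact: euc_sym (sls_euclidean D) x y. Qed.

Lemma formDl x y z : form (x + y) z = form x z + form y z.
Proof. by have := euc_linear (sls_euclidean D) 1 x y z; rewrite scale1r mul1r. Qed.

Lemma form0l z : form 0 z = 0.
Proof. by apply: (addrI (form 0 z)); rewrite -formDl !addr0. Qed.

Lemma formZl c x z : form (c *: x) z = c * form x z.
Proof.
by have := euc_linear (sls_euclidean D) c x 0 z; rewrite form0l !addr0.
Qed.

Lemma formNl x z : form (- x) z = - form x z.
Proof. by rewrite -scaleN1r formZl mulN1r. Qed.

Lemma formDr x y z : form z (x + y) = form z x + form z y.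
Proof. by rewrite formC formDl !(formC z). Qed.

Lemma formNr x z : form z (- x) = - form z x.
Proof. by rewrite formC formNl formC. Qed.

Definition formE := (formDl, formDr, formNl, formNr).

Lemma simple_root (a : simple D) : val a \in Phi.
Proof. exact: base_sub (sls_base D) _ (ssvalP a). Qed.

Lemma root_reflect v w : v \in Phi -> w \in Phi -> w - form w v *: v \in Phi.
Proof.
move=> vP wP; have := rs_reflection (sls_system D) vP wP.
by rewrite /reflection /cartan sls_norm // mulrAC divff ?mul1r ?pnatr_eq0.
Qed.

Lemma root_opp v : v \in Phi -> - v \in Phi.
Proof.
move=> vP; have := root_reflect vP vP; rewrite sls_norm //.
by rewrite scaler_nat mulr2n opprD addrA subrr add0r.
Qed.

Lemma root_form_int v w : v \in Phi -> w \in Phi -> form v w \is a Num.int.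
Proof.
move=> vP wP; have := rs_integral (sls_system D) wP vP.
by rewrite /cartan sls_norm // mulrAC divff ?mul1r ?pnatr_eq0.
Qed.

(** Equality in the Cauchy-Schwarz inequality. *)
Lemma root_eq v w : v \in Phi -> w \in Phi -> form v w = 2 -> v = w.
Proof.
move=> vP wP vw; apply/eqP; rewrite -subr_eq0; apply: contraT => ne.
have := euc_pos (sls_euclidean D) ne.
by rewrite !formE [form w v]formC vw !sls_norm //; lra.
Qed.

Lemma simple_free (c : V -> R) : \sum_(x <- sls_simple D) c x *: x = 0 ->
  forall x, x \in sls_simple D -> c x = 0.
Proof.
rewrite (big_nth 0) big_mkord => sum0 x xP.
have fP : free (in_tuple (sls_simple D)) := basis_free (base_basis (sls_base D)).
have xi : (index x (sls_simple D) < size (sls_simple D))%N by rewrite index_mem.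
have /freeP/(_ (fun i => c (sls_simple D)`_i))/(_ sum0)/(_ (Ordinal xi)) := fP.
by rewrite /= nth_index.
Qed.

Lemma simple_sum (a : simple D) :
  \sum_(x <- sls_simple D) (x == val a)%:R *: x = val a.
Proof.
have uP := free_uniq (basis_free (base_basis (sls_base D))).
rewrite (bigD1_seq (val a)) ?ssvalP //= eqxx scale1r big1 ?addr0 // => x /negPf->.
by rewrite scale0r.
Qed.

(** If (a, b) > 0, the reflection b - (b, a) a would be a root with coordinates of
    opposite signs. *)
Lemma simple_form_le0 (a b : simple D) : a != b -> form (val a) (val b) <= 0.
Proof.
move=> ab; rewrite leNgt; apply/negP => ab_gt0.
have abv : val a != val b by rewrite (inj_eq val_inj).
pose c (x : V) : R := (x == val b)%:R - form (val b) (val a) * (x == val a)%:R.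
have coef (k : V -> R) : val b - form (val b) (val a) *: val a =
    \sum_(x <- sls_simple D) k x *: x -> forall x, x \in sls_simple D -> c x - k x = 0.
  move=> e; apply: simple_free; under eq_bigr => x _ do rewrite 2!scalerBl -scalerA.
  by rewrite !sumrB -scaler_sumr !simple_sum -e subrr.
have [k [e|e]] := base_sign (sls_base D) (root_reflect (simple_root a) (simple_root b)).
  have := coef _ e _ (ssvalP a); rewrite /c eqxx (negPf abv) formC mulr1 sub0r.
  by have := ler0n R (k (val a)); lra.
have {}e : val b - form (val b) (val a) *: val a =
    \sum_(x <- sls_simple D) (- (k x)%:R) *: x.
  by rewrite e -sumrN; apply: eq_bigr => x _; rewrite scaleNr.
have := coef _ e _ (ssvalP b); rewrite /c eqxx eq_sym (negPf abv) mulr0 subr0 [true%:R]mulr1n.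
by have := ler0n R (k (val b)); lra.
Qed.

(** The form is an integer here, and it is larger than -2 because a + b has
    positive norm 4 + 2 (a, b). *)
Lemma simple_form (a b : simple D) : a != b ->
  form (val a) (val b) = 0 \/ form (val a) (val b) = -1.
Proof.
move=> ab; have le0 := simple_form_le0 ab.
have aP := simple_root a; have bP := simple_root b.
have abv : val a != val b by rewrite (inj_eq val_inj).
have ne : val a + val b != 0.
  apply/eqP => e; have : \sum_(x <- sls_simple D)
      ((x == val a)%:R + (x == val b)%:R : R) *: x = 0.
    under eq_bigr => x _ do rewrite scalerDl.
    by rewrite big_split /= !simple_sum.
  move=> /simple_free/(_ _ (ssvalP a)); rewrite eqxx (negPf abv) addr0 => /eqP.
  by rewrite oner_eq0.
have gt : -2 < form (val a) (val b).
  have := euc_pos (sls_euclidean D) ne.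
  by rewrite !formE [form (val b) _]formC !sls_norm //; lra.
have [n en] := intrP (root_form_int aP bP).
move: le0 gt; rewrite en -[-2]/((-2)%:~R) -[0]/(0%:~R) ler_int ltr_int => le0 gt.
have [->|->] : n = 0 \/ n = -1 by lia.
  by left.
by right.
Qed.

Lemma dynkin_form (a b : simple D) : a != b ->
  dynkin a b = (form (val a) (val b) == -1).
Proof.
move=> ab; rewrite /dynkin ab /=; have [->|->] := simple_form ab.
  by rewrite eqxx eq_sym oppr_eq0 oner_eq0.
by rewrite eqxx oppr_eq0 oner_eq0.
Qed.

Lemma dynkin_irr : irreflexive (@dynkin R D).
Proof. by move=> a; rewrite /dynkin eqxx. Qed.

Lemma pairing_int (v : V) (a : simple D) : v \in Phi ->
  (pairing v a)%:~R = form v (val a).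
Proof. by move=> vP; apply: floorK; apply: root_form_int (simple_root a). Qed.

Lemma pairingD (v w : V) (a : simple D) : v \in Phi ->
  pairing (w + v) a = pairing w a + pairing v a.
Proof.
move=> vP; rewrite /pairing formDl -(pairing_int a vP) floorDrz ?intrKfloor //.
Qed.

Lemma pairing0 (a : simple D) : pairing 0 a = 0.
Proof. by rewrite /pairing form0l floor0. Qed.

End Roots.

(** * Steps in the direction of a root, and their commutation *)

Section Weights.
Variables (R : realType) (D : simply_laced_system R).
Local Notation V := (sls_space D).
Local Notation form := (@sls_form R D).
Local Notation Phi := (sls_roots D).
Local Notation CC := (ground R[i]).
Local Notation AC := (adj_cat D).
Local Notation endo := (functor AC AC).

Lemma weight_val (mu : Defs.root D) : weight (val mu) = fam_at _ _ mu.
Proof. by rewrite /weight valK. Qed.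

Lemma vanishing_weight (v : V) : v \notin Phi -> vanishing (weight v).
Proof. by move=> vP; rewrite /weight insubN //; apply: vanishing_const. Qed.

Lemma vanishing_comp (K : fieldType) (A : galg K) (B C : category)
    (F : functor C (gmod_cat A)) (G : functor B C) :
  vanishing F -> vanishing (F ∘ G).
Proof. by move=> F0 x; apply: F0. Qed.

Lemma adj_iso (F G : endo) : weight0 D ∘ F ≅ weight0 D ∘ G ->
  (forall v, v \in Phi -> weight v ∘ F ≅ weight v ∘ G) -> F ≅ G.
Proof.
move=> h0 h; apply: iso_family => // mu.
by rewrite -weight_val; apply: h; apply: ssvalP.
Qed.

Lemma weight_family (G : functor AC (gmod_cat (zz D)))
    (H : Defs.root D -> functor AC (gmod_cat CC)) (mu : Defs.root D) :
  weight (val mu) ∘ functor_family G H ≅ H mu.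
Proof. by rewrite weight_val; apply: iso_refl. Qed.

(** The common form of E_a and F_a: X moves weights by the root v, which is a for
    E_a and -a for F_a, and passes through weight 0 by means of the projective
    modules at the vertex a.  The relations between these functors depend only on
    the values of the form at their two roots, so that each is proved once.
    Weights w run through all vectors, which avoids deciding at each step whether
    a weight is a root. *)
Record is_step (X : endo) (a : simple D) (v : V) : Prop := IsStep {
  step_root : v \in Phi;
  step_out : weight0 D ∘ X ≅
    tensor_functor (left_projective a) ∘ (shift CC (-1) ∘ weight (- v));
  step_in : weight v ∘ X ≅ tensor_functor (right_projective a) ∘ weight0 D;
  step_move : forall w, w != v -> form w v = 1 ->
    weight w ∘ X ≅ weight (w - v);
  step_stop : forall w, w != v -> form w v != 1 -> vanishing (weight w ∘ X) }.

(** If w is not a root, neither is w - v when (w, v) = 1: they are exchanged by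
    the reflection in v.  So step_move holds for all w, with zero on both sides. *)
Lemma step_family (a : simple D) (v : V) (H : Defs.root D -> functor AC (gmod_cat CC)) :
  v \in Phi ->
  (forall mu, val mu = v -> H mu = tensor_functor (right_projective a) ∘ weight0 D) ->
  (forall mu, val mu != v -> form (val mu) v = 1 -> H mu = weight (val mu - v)) ->
  (forall mu, val mu != v -> form (val mu) v != 1 ->
     H mu = functor_const AC (gzero CC : gmod_cat CC)) ->
  is_step (functor_family
    (tensor_functor (left_projective a) ∘ (shift CC (-1) ∘ weight (- v))) H) a v.
Proof.
move=> vP Hv H1 H0; split=> //.
- exact: iso_refl.
- rewrite -[v]/(val (SeqSub vP : Defs.root D)) -(Hv (SeqSub vP)) //.
  exact: weight_family.
- move=> w wv wv1; have [wP|wP] := boolP (w \in Phi).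
    rewrite -[w]/(val (SeqSub wP : Defs.root D)) -(H1 (SeqSub wP)) //.
    exact: weight_family.
  apply: vanishing_iso; first by apply/vanishing_comp/vanishing_weight.
  apply: vanishing_weight; apply: contra wP => wvP.
  have := root_reflect vP wvP; rewrite !formE wv1 sls_norm //.
  by rewrite (_ : 1 - 2 = -1) ?scaleN1r ?opprK ?subrK //; lra.
move=> w wv wv1; have [wP|wP] := boolP (w \in Phi); last first.
  by apply/vanishing_comp/vanishing_weight.
have := weight_family (tensor_functor (left_projective a)
  ∘ (shift CC (-1) ∘ weight (- v))) H (SeqSub wP).
by rewrite (H0 (SeqSub wP)) // => /iso_vanishing; apply; apply: vanishing_const.
Qed.

Lemma Efun_step (a : simple D) : is_step (Efun a) a (val a).
Proof.
apply: step_family => [|mu ->|mu ne e|mu ne e]; first exact: simple_root.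
- by rewrite eqxx.
- rewrite (negPf ne) !formE e sls_norm ?simple_root //.
  by rewrite (_ : 1 - 2 = -1) ?eqxx //; lra.
rewrite (negPf ne) !formE sls_norm ?simple_root // ifN //.
by apply: contra e => /eqP e; apply/eqP; lra.
Qed.

Lemma Ffun_step (a : simple D) : is_step (Ffun a) a (- val a).
Proof.
rewrite /Ffun -{1}[val a]opprK.
apply: step_family => [|mu ->|mu ne e|mu ne e].
- exact/root_opp/simple_root.
- by rewrite eqxx.
- rewrite (negPf ne) opprK; move: e; rewrite !formE sls_norm ?simple_root // => e.
  by rewrite ifT //; apply/eqP; lra.
rewrite (negPf ne) ifN //; apply: contra e; rewrite !formE.
by rewrite sls_norm ?simple_root // => /eqP e; apply/eqP; lra.
Qed.

Section Composition.
Variables (X Y : endo) (a b : simple D) (v w : V).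
Hypotheses (sX : is_step X a v) (sY : is_step Y b w).

Lemma weight_stop (F : endo) u : u != v -> form u v != 1 ->
  vanishing (weight u ∘ (X ∘ F)).
Proof. by move=> uv e; apply: (vanishing_comp (G := F) (step_stop sX uv e)). Qed.

Lemma weight_move (F : endo) u : u != v -> form u v = 1 ->
  weight u ∘ (X ∘ F) ≅ weight (u - v) ∘ F.
Proof. by move=> uv e; apply: (iso_whiskerr F (step_move sX uv e)). Qed.

Lemma weight0_step (F : endo) : weight0 D ∘ (X ∘ F) ≅
  tensor_functor (left_projective a) ∘ (shift CC (-1) ∘ (weight (- v) ∘ F)).
Proof. exact: (iso_whiskerr F (step_out sX)). Qed.

Lemma weight0_stop (F : endo) : vanishing (weight (- v) ∘ F) ->
  vanishing (weight0 D ∘ (X ∘ F)).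
Proof.
move=> F0; apply: iso_vanishing (weight0_step F) _.
exact/vanishing_tensor/vanishing_shift.
Qed.

(** The composite of two steps through weight 0, up to the shift by -1. *)
Definition corner_at (a b : simple D) :=
  corner_functor (vg_deg (zz D) a) (vg_idem (zz D) a)
    (vg_deg (zz D) b) (vg_idem (zz D) b) (zz_findim D).

(** Weight - w is moved to 0 by Y and then to v by X. *)
Lemma weight_in (F : endo) : weight v ∘ (X ∘ (Y ∘ F)) ≅
  corner_at a b ∘ (shift CC (-1) ∘ (weight (- w) ∘ F)).
Proof.
apply: iso_trans (iso_whiskerr (Y ∘ F) (step_in sX)) _.
exact: (iso_whiskerl (tensor_functor (right_projective a))
  (iso_whiskerr F (step_out sY))).
Qed.

End Composition.

Lemma weight_in_comp (X Y : endo) (a b : simple D) (v w : V) :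
  is_step X a v -> is_step Y b w ->
  weight v ∘ (X ∘ Y) ≅ corner_at a b ∘ (shift CC (-1) ∘ weight (- w)).
Proof. by move=> sX sY; exact: (weight_in sX sY (adj_id D)). Qed.

Lemma form_neq (u w z : V) : form u z <> form w z -> u != w.
Proof. by move=> ne; apply/eqP => e; apply: ne; rewrite e. Qed.

Section Corners.
Variables (a b : simple D) (W : functor AC (gmod_cat CC)).

Lemma line_shift :
  line_corner (vg_vertex (zz D) a) (vg_vertex (zz D) b) 1 ->
  corner_at a b ∘ (shift CC (-1) ∘ W) ≅ W.
Proof.
move=> /(corner_line (vg_deg (zz D) a) (vg_idem (zz D) a) (vg_deg (zz D) b)
  (vg_idem (zz D) b) (zz_findim D)) h.
apply: iso_trans (iso_whiskerr _ h) _; apply: iso_trans (shiftD _ _ _) _.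
exact: shift0.
Qed.

Lemma plane_shift :
  plane_corner (vg_vertex (zz D) a) (vg_vertex (zz D) b) 2 0 ->
  corner_at a b ∘ (shift CC (-1) ∘ W) ≅
  functor_sum (shift CC 1 ∘ W) (shift CC (-1) ∘ W).
Proof.
move=> /(corner_plane (vg_deg (zz D) a) (vg_idem (zz D) a) (vg_deg (zz D) b)
  (vg_idem (zz D) b) (zz_findim D)) h.
apply: iso_trans (iso_whiskerr _ h) _.
apply: (@iso_trans _ _ (functor_sum (shift CC 2 ∘ (shift CC (-1) ∘ W))
  (shift CC 0 ∘ (shift CC (-1) ∘ W)))); first exact: iso_refl.
by apply: sum_iso; [apply: shiftD | apply: shift0].
Qed.

Lemma zero_shift :
  zero_corner (vg_vertex (zz D) a) (vg_vertex (zz D) b) ->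
  vanishing (corner_at a b ∘ (shift CC (-1) ∘ W)).
Proof. by move=> h; apply/vanishing_comp/corner_vanishing. Qed.

End Corners.

Section Commute.
Variables (X Y : endo) (a b : simple D) (v w : V).
Hypotheses (sX : is_step X a v) (sY : is_step Y b w).

Lemma commute_weight0 : form v w = 0 \/ form v w = 1 ->
  vanishing (weight0 D ∘ (X ∘ Y)).
Proof.
move=> vw; apply: (weight0_stop sX); apply: (step_stop sY).
  apply: (@form_neq _ _ w); rewrite !formE (sls_norm (step_root sY)).
  by case: vw; lra.
by apply/eqP; rewrite formNl; case: vw; lra.
Qed.

(** Along - w -> 0 -> v the functor is given by the corner at a and b.  The other
    order arrives at v from v - w, and is zero unless (v, w) = 1; the corner is a
    line or zero accordingly. *)
Lemma commute_in :
  form v w = 0 /\ zero_corner (vg_vertex (zz D) a) (vg_vertex (zz D) b) \/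
  form v w = 1 /\ line_corner (vg_vertex (zz D) a) (vg_vertex (zz D) b) 1 ->
  weight v ∘ (X ∘ Y) ≅ weight v ∘ (Y ∘ X).
Proof.
have vv := sls_norm (step_root sX); have ww := sls_norm (step_root sY).
case=> -[vw c].
  have v_w : v != w by apply: (@form_neq _ _ w); lra.
  apply: vanishing_iso; last by apply: (weight_stop sY) => //; apply/eqP; lra.
  by apply: iso_vanishing (weight_in_comp sX sY) _; apply: zero_shift.
have v_w : v != w by apply: (@form_neq _ _ w); lra.
apply: iso_trans (weight_in_comp sX sY) _; apply: iso_trans (line_shift _ c) _.
apply/iso_sym; apply: iso_trans (weight_move sY _ v_w vw) _.
have := step_move sX (w := v - w); rewrite (addrAC v) subrr add0r.
rewrite !formE vv [form w v]formC vw; apply; last by lra.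
by apply: (@form_neq _ _ v); rewrite !formE vv [form w v]formC vw; lra.
Qed.

Lemma commute_stop u : u != v -> form v w <> -1 ->
  (form u v = 1 -> form u w - form v w <> 1) -> vanishing (weight u ∘ (X ∘ Y)).
Proof.
move=> uv vw uw; have vv := sls_norm (step_root sX).
have [e|/eqP e] := eqVneq (form u v) 1; last exact/(weight_stop sX)/eqP.
apply: iso_vanishing (weight_move sX _ uv e) _; apply: (step_stop sY).
  by apply: (@form_neq _ _ v); rewrite !formE vv e [form w v]formC; lra.
by rewrite !formE; apply/eqP/uw.
Qed.

Lemma commute_move u : u != v -> form v w = 0 -> form u v = 1 -> form u w = 1 ->
  weight u ∘ (X ∘ Y) ≅ weight (u - v - w).
Proof.
move=> uv vw e e'; have vv := sls_norm (step_root sX).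
apply: iso_trans (weight_move sX _ uv e) _; apply: (step_move sY).
  by apply: (@form_neq _ _ v); rewrite !formE vv e [form w v]formC; lra.
by rewrite !formE; lra.
Qed.

End Commute.

(** Besides v and w only the weights u with (u, v) = (u, w) = 1 occur, and this for
    (v, w) = 0: both composites are then the component of weight u - v - w.  For
    (v, w) = 1 a nonzero component of X Y at u would need (u, v) = 1 and
    (u - v, w) = 1, hence (u, w) = 2 and u = w. *)
Lemma step_commute (X Y : endo) (a b : simple D) (v w : V) :
  is_step X a v -> is_step Y b w -> a != b ->
  form v w = 0 /\ ~~ dynkin a b \/ form v w = 1 /\ dynkin a b ->
  X ∘ Y ≅ Y ∘ X.
Proof.
move=> sX sY ab vwab.
have ba : b != a by rewrite eq_sym.
have [ab0 ab1 _] := zigzag_corners R[i] (@dynkin_irr R D) (@dynkin_sym R D)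
  (@dynkin_connected R D) ab.
have [ba0 ba1 _] := zigzag_corners R[i] (@dynkin_irr R D) (@dynkin_sym R D)
  (@dynkin_connected R D) ba.
rewrite [dynkin b a]dynkin_sym in ba0 ba1.
have vw : form v w = 0 \/ form v w = 1 by case: vwab => -[]; [left|right].
have wv : form w v = 0 \/ form w v = 1 by rewrite formC.
apply: adj_iso => [|u uP].
  by apply: vanishing_iso; [apply: (commute_weight0 sX sY) | apply: (commute_weight0 sY sX)].
have [->|uv] := eqVneq u v.
  apply: (commute_in sX sY).
  by case: vwab => -[e c]; [left; split=> //; apply: ab0 | right; split=> //; apply: ab1].
have [->|uw] := eqVneq u w.
  apply/iso_sym/(commute_in sY sX); rewrite formC.
  by case: vwab => -[e c]; [left; split=> //; apply: ba0 | right; split=> //; apply: ba1].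
case: vwab => -[e _].
  have [ev|ev] := eqVneq (form u v) 1; last first.
    apply: vanishing_iso; [apply: (commute_stop sX sY) | apply: (commute_stop sY sX)] => //;
      rewrite ?[form w v]formC e; move/eqP: ev; lra.
  have [ew|ew] := eqVneq (form u w) 1; last first.
    apply: vanishing_iso; [apply: (commute_stop sX sY) | apply: (commute_stop sY sX)] => //;
      rewrite ?[form w v]formC e; move/eqP: ew; lra.
  apply: iso_trans (commute_move sX sY uv e ev ew) _; apply: iso_sym.
  by rewrite addrAC; apply: (commute_move sY sX) => //; rewrite formC.
have nv : form u v <> 2 by move/(root_eq uP (step_root sX)); apply/eqP.
have nw : form u w <> 2 by move/(root_eq uP (step_root sY)); apply/eqP.
apply: vanishing_iso; [apply: (commute_stop sX sY) | apply: (commute_stop sY sX)] => //;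
  rewrite ?[form w v]formC e; lra.
Qed.

End Weights.

(** * The Serre relations and the relations with K *)

Section Serre.
Variables (R : realType) (D : simply_laced_system R).
Local Notation V := (sls_space D).
Local Notation form := (@sls_form R D).
Local Notation Phi := (sls_roots D).
Local Notation CC := (ground R[i]).
Local Notation AC := (adj_cat D).
Local Notation endo := (functor AC AC).

Lemma weight_sum (v : V) (G H : endo) : v \in Phi ->
  weight v ∘ (G ⊕ H) ≅ functor_sum (weight v ∘ G) (weight v ∘ H).
Proof.
by move=> vP; rewrite -[v]/(val (SeqSub vP : Defs.root D)) weight_val; apply: iso_refl.
Qed.

Lemma weight_adj_shift (v : V) k (F : endo) : v \in Phi ->
  weight v ∘ F⟦k⟧ ≅ shift CC k ∘ (weight v ∘ F).
Proof.
by move=> vP; rewrite -[v]/(val (SeqSub vP : Defs.root D)) weight_val; apply: iso_refl.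
Qed.

Lemma vanishing_corner (a b : simple D) (W : functor AC (gmod_cat CC)) :
  vanishing W -> vanishing (corner_at a b ∘ (shift CC (-1) ∘ W)).
Proof.
move=> W0 x; apply: (vanishing_tensor (N := right_projective a)
  (F := tensor_functor (left_projective b) ∘ (shift CC (-1) ∘ W))).
exact/vanishing_tensor/vanishing_shift.
Qed.

(* The three composites raise weights by 2 v + w.  If u and u - 2 v - w are both
   roots, or 0 and a root, then u = v or u = v + w; all other components of the
   composites are zero.  Each vanishing is found by following the path backwards
   from u until the form at the root of the next step is different from 1. *)
Section StepSerre.
Variables (X Y : endo) (a b : simple D) (v w : V).
Hypotheses (sX : is_step X a v) (sY : is_step Y b w).
Hypothesis vw : form v w = -1.

Let vv : form v v = 2 := sls_norm (step_root sX).
Let ww : form w w = 2 := sls_norm (step_root sY).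
Let wv : form w v = -1. Proof. by rewrite formC. Qed.

Ltac form_lra :=
  rewrite ?formE; have := vv; have := ww; have := vw; have := wv; lra.

Let moveX (F : endo) u : form u v = 1 -> weight u ∘ (X ∘ F) ≅ weight (u - v) ∘ F.
Proof. by move=> e; apply: (weight_move sX) => //; apply: (form_neq (z := v)); form_lra. Qed.

Let moveY (F : endo) u : form u w = 1 -> weight u ∘ (Y ∘ F) ≅ weight (u - w) ∘ F.
Proof. by move=> e; apply: (weight_move sY) => //; apply: (form_neq (z := w)); form_lra. Qed.

Let stopX (F : endo) u : u != v -> form u v <> 1 -> vanishing (weight u ∘ (X ∘ F)).
Proof. by move=> uv e; apply: (weight_stop sX) => //; apply/eqP. Qed.

Let stopY (F : endo) u : u != w -> form u w <> 1 -> vanishing (weight u ∘ (Y ∘ F)).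
Proof. by move=> uw e; apply: (weight_stop sY) => //; apply/eqP. Qed.

Let stopX' (F : endo) u : form u v < 1 -> vanishing (weight u ∘ (X ∘ F)).
Proof. by move=> e; apply: stopX; [apply: (form_neq (z := v))|]; form_lra. Qed.

Let moveXid u : form u v = 1 -> weight u ∘ X ≅ weight (u - v).
Proof. exact: (@moveX (adj_id D)). Qed.

Let moveYid u : form u w = 1 -> weight u ∘ Y ≅ weight (u - w).
Proof. exact: (@moveY (adj_id D)). Qed.

Let stopXid u : form u v < 1 -> vanishing (weight u ∘ X).
Proof. exact: (@stopX' (adj_id D)). Qed.

Lemma serre0_XXY : vanishing (weight0 D ∘ (X ∘ (X ∘ Y))).
Proof. by apply: (weight0_stop sX); apply: stopX'; form_lra. Qed.

Lemma serre0_YXX : vanishing (weight0 D ∘ (Y ∘ (X ∘ X))).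
Proof.
apply: (weight0_stop sY).
have e : form (- w) v = 1 by form_lra.
by apply: iso_vanishing (moveX _ e) _; apply: stopXid; form_lra.
Qed.

Lemma serre0_XYX : vanishing (weight0 D ∘ (X ∘ (Y ∘ X))).
Proof.
apply: (weight0_stop sX).
have e : form (- v) w = 1 by form_lra.
by apply: iso_vanishing (moveY _ e) _; apply: stopXid; form_lra.
Qed.

Lemma serre_XXY u : u != v -> vanishing (weight u ∘ (X ∘ (X ∘ Y))).
Proof.
move=> uv; have [e|/eqP e] := eqVneq (form u v) 1; last exact: stopX.
by apply: iso_vanishing (moveX _ e) _; apply: stopX'; form_lra.
Qed.

Lemma serre_YXX u : u != v + w -> vanishing (weight u ∘ (Y ∘ (X ∘ X))).
Proof.
move=> uvw; have [->|uw] := eqVneq u w.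
  apply: iso_vanishing (weight_in sY sX X) _; apply: vanishing_corner.
  by apply: stopXid; form_lra.
have [e|/eqP e] := eqVneq (form u w) 1; last exact: stopY.
apply: iso_vanishing (moveY _ e) _.
have uwv : u - w != v by rewrite subr_eq.
have [e'|/eqP e'] := eqVneq (form (u - w) v) 1; last exact: stopX.
by apply: iso_vanishing (moveX _ e') _; apply: stopXid; move: e'; form_lra.
Qed.

Lemma serre_XYX u : u != v -> u != v + w -> vanishing (weight u ∘ (X ∘ (Y ∘ X))).
Proof.
move=> uv uvw; have [e|/eqP e] := eqVneq (form u v) 1; last exact: stopX.
apply: iso_vanishing (moveX _ e) _.
have uwv : u - v != w by rewrite subr_eq addrC.
have [e'|/eqP e'] := eqVneq (form (u - v) w) 1; last exact: stopY.
by apply: iso_vanishing (moveY _ e') _; apply: stopXid; form_lra.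
Qed.

Hypothesis plane_aa : plane_corner (vg_vertex (zz D) a) (vg_vertex (zz D) a) 2 0.
Hypothesis line_ab : line_corner (vg_vertex (zz D) a) (vg_vertex (zz D) b) 1.
Hypothesis line_ba : line_corner (vg_vertex (zz D) b) (vg_vertex (zz D) a) 1.

(** The path - v - w -> - v -> 0 -> v, where the passage through 0 is by the corner
    at a, which has lines in degrees 2 and 0; the shift by -1 makes them 1 and -1. *)
Lemma serre_in_XXY : weight v ∘ (X ∘ (X ∘ Y)) ≅
  functor_sum (shift CC 1 ∘ weight (- v - w)) (shift CC (-1) ∘ weight (- v - w)).
Proof.
apply: iso_trans (weight_in sX sX Y) _; apply: iso_trans (plane_shift _ plane_aa) _.
have e : form (- v) w = 1 by form_lra.
by apply: sum_iso; apply: iso_whiskerl; apply: moveYid.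
Qed.

(** The path - v - w -> - w -> 0 -> v, through the line of degree 1 at a and b. *)
Lemma serre_in_XYX : weight v ∘ (X ∘ (Y ∘ X)) ≅ weight (- v - w).
Proof.
apply: iso_trans (weight_in sX sY X) _; apply: iso_trans (line_shift _ line_ab) _.
by rewrite addrC; apply: moveXid; form_lra.
Qed.

(** The path - v -> 0 -> v -> v + w. *)
Lemma serre_sum_YXX : weight (v + w) ∘ (Y ∘ (X ∘ X)) ≅
  functor_sum (shift CC 1 ∘ weight (- v)) (shift CC (-1) ∘ weight (- v)).
Proof.
have e : form (v + w) w = 1 by form_lra.
apply: iso_trans (moveY _ e) _; rewrite addrK.
by apply: iso_trans (weight_in_comp sX sX) _; apply: plane_shift.
Qed.

(** The path - v -> 0 -> w -> v + w. *)
Lemma serre_sum_XYX : weight (v + w) ∘ (X ∘ (Y ∘ X)) ≅ weight (- v).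
Proof.
have e : form (v + w) v = 1 by form_lra.
apply: iso_trans (moveX _ e) _; rewrite [v + w]addrC addrK.
by apply: iso_trans (weight_in_comp sY sX) _; apply: line_shift.
Qed.

Let serre_assoc : (X ∘ (X ∘ Y)) ⊕ (Y ∘ (X ∘ X)) ≅
  ((adj_id D)⟦1⟧ ⊕ (adj_id D)⟦-1⟧) ∘ (X ∘ (Y ∘ X)).
Proof.
apply: adj_iso => [|u uP].
  apply: vanishing_iso.
    exact: (vanishing_sum serre0_XXY serre0_YXX).
  apply: (iso_vanishing (G := functor_sum
    (shift (zz D) 1 ∘ (weight0 D ∘ (X ∘ (Y ∘ X))))
    (shift (zz D) (-1) ∘ (weight0 D ∘ (X ∘ (Y ∘ X)))))); first exact: iso_refl.
  by apply: vanishing_sum; apply: vanishing_shift; apply: serre0_XYX.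
apply: iso_trans (weight_sum _ _ uP) _; apply: iso_sym.
apply: (iso_trans (G := functor_sum (shift CC 1 ∘ (weight u ∘ (X ∘ (Y ∘ X))))
    (shift CC (-1) ∘ (weight u ∘ (X ∘ (Y ∘ X)))))).
  rewrite -[u]/(val (SeqSub uP : Defs.root D)) weight_val; exact: iso_refl.
have [->|uv] := eqVneq u v.
  apply: iso_trans (sum_iso (iso_whiskerl _ serre_in_XYX)
    (iso_whiskerl _ serre_in_XYX)) _; apply: iso_sym.
  apply: iso_trans serre_in_XXY; apply: sum_vanishingr; apply: serre_YXX.
  by apply: (form_neq (z := v)); form_lra.
have [->|uvw] := eqVneq u (v + w).
  apply: iso_trans (sum_iso (iso_whiskerl _ serre_sum_XYX)
    (iso_whiskerl _ serre_sum_XYX)) _; apply: iso_sym.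
  apply: iso_trans serre_sum_YXX; apply: sum_vanishingl; apply: serre_XXY.
  by apply: (form_neq (z := v)); form_lra.
have z := serre_XYX uv uvw.
apply: vanishing_iso; first by apply: vanishing_sum; apply: vanishing_shift.
by apply: vanishing_sum; [apply: serre_XXY | apply: serre_YXX].
Qed.

Lemma step_serre : (X ∘ X ∘ Y) ⊕ (Y ∘ X ∘ X) ≅
  ((adj_id D)⟦1⟧ ⊕ (adj_id D)⟦-1⟧) ∘ (X ∘ Y ∘ X).
Proof. exact: serre_assoc. Qed.

End StepSerre.

Lemma weight_weight_shift n (a : simple D) (v : V) (F : endo) :
  weight v ∘ (weight_shift n a ∘ F) ≅ shift CC (n * pairing v a) ∘ (weight v ∘ F).
Proof.
have [vP|vP] := boolP (v \in Phi); last first.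
  by apply: vanishing_iso; [|apply: vanishing_shift]; apply/vanishing_comp/vanishing_weight.
by rewrite -[v]/(val (SeqSub vP : Defs.root D)) weight_val; apply: iso_refl.
Qed.

Lemma weight0_weight_shift n (a : simple D) (F : endo) :
  weight0 D ∘ (weight_shift n a ∘ F) ≅ weight0 D ∘ F.
Proof.
apply: (iso_trans (G := shift (zz D) (n * pairing 0 a) ∘ (weight0 D ∘ F))).
  exact: iso_refl.
by rewrite pairing0 mulr0; apply: shift0.
Qed.

Lemma weight_shift_comp n m (a b : simple D) (v : V) :
  weight v ∘ (weight_shift n a ∘ weight_shift m b) ≅
  shift CC (n * pairing v a + m * pairing v b) ∘ weight v.
Proof.
have h : weight v ∘ weight_shift m b ≅ shift CC (m * pairing v b) ∘ weight v.
  exact: (weight_weight_shift m b v (adj_id D)).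
apply: iso_trans (weight_weight_shift _ _ _ _) _.
apply: iso_trans (iso_whiskerl _ h) _.
exact: (shiftD (n * pairing v a) (m * pairing v b) (weight v)).
Qed.

Lemma weight0_shift_comp n m (a b : simple D) :
  weight0 D ∘ (weight_shift n a ∘ weight_shift m b) ≅ weight0 D.
Proof.
apply: iso_trans (weight0_weight_shift _ _ _) _.
exact: (weight0_weight_shift m b (adj_id D)).
Qed.

Lemma weight_shiftC n m (a b : simple D) :
  weight_shift n a ∘ weight_shift m b ≅ weight_shift m b ∘ weight_shift n a.
Proof.
apply: adj_iso => [|v _].
  by apply: iso_trans (weight0_shift_comp _ _ _ _) (iso_sym (weight0_shift_comp _ _ _ _)).
apply: iso_trans (weight_shift_comp _ _ _ _ _) _; rewrite addrC.
exact/iso_sym/weight_shift_comp.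
Qed.

Lemma weight_shiftK n (a : simple D) :
  weight_shift n a ∘ weight_shift (- n) a ≅ adj_id D.
Proof.
apply: adj_iso => [|v _]; first exact: weight0_shift_comp.
apply: iso_trans (weight_shift_comp _ _ _ _ _) _.
by rewrite mulNr subrr; apply: shift0.
Qed.

Lemma tensor_shift_comp (K : fieldType) (A B : galg K) (N : gbimod A B)
    (C : category) k (W : functor C (gmod_cat B)) :
  tensor_functor N ∘ (shift B k ∘ W) ≅ shift A k ∘ (tensor_functor N ∘ W).
Proof. exact: (iso_whiskerr W (tensor_shift N k)). Qed.

(** Each step adds v to the weight and so (v, c) to the shift; in weight 0 the
    shift (v, c) cancels the shift (- v, c) of the component of weight - v. *)
Lemma step_Kfun (X : endo) (a c : simple D) (v : V) : is_step X a v ->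
  Kfun c ∘ X ≅ (X ∘ Kfun c)⟦pairing v c⟧.
Proof.
move=> sX; have vP := step_root sX.
have Kid u : weight u ∘ Kfun c ≅ shift CC (1 * pairing u c) ∘ weight u.
  exact: (weight_weight_shift 1 c u (adj_id D)).
apply: adj_iso => [|u uP].
  apply: iso_trans (weight0_weight_shift _ _ _) _; apply: iso_trans (step_out sX) _.
  apply: iso_trans (tensor_shift_comp _ _ _) _; apply: iso_sym.
  apply: (iso_trans (G := shift (zz D) (pairing v c) ∘ (weight0 D ∘ (X ∘ Kfun c)))).
    exact: iso_refl.
  apply: iso_trans (iso_whiskerl _ (weight0_step sX _)) _.
  apply: iso_trans (iso_whiskerl _ (tensor_shift_comp _ _ _)) _.
  apply: iso_trans (iso_whiskerl _ (iso_whiskerl _ (iso_whiskerl _ (Kid _)))) _.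
  apply: iso_trans (iso_whiskerl _ (iso_whiskerl _ (tensor_shift_comp _ _ _))) _.
  apply: iso_trans (iso_whiskerl _ (shiftD _ _ _)) _.
  apply: iso_trans (shiftD _ _ _) _; apply: shift_iso.
  have := pairingD (- v) c vP; rewrite addNr pairing0; lia.
apply: iso_trans (weight_weight_shift _ _ _ _) _; apply: iso_sym.
apply: iso_trans (weight_adj_shift _ _ uP) _; apply: iso_sym.
have [->|uv] := eqVneq u v.
  rewrite mul1r; apply: iso_whiskerl; apply: iso_trans (step_in sX) _.
  apply: iso_sym; apply: iso_trans (iso_whiskerr (Kfun c) (step_in sX)) _.
  exact: (iso_whiskerl (tensor_functor (right_projective a))
    (weight0_weight_shift 1 c (adj_id D))).
have [e|e] := eqVneq (form u v) 1; last first.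
  apply: vanishing_iso; apply: vanishing_shift; last exact: (weight_stop sX).
  exact: (step_stop sX).
apply: iso_trans (iso_whiskerl _ (step_move sX uv e)) _; apply: iso_sym.
apply: iso_trans (iso_whiskerl _ (weight_move sX _ uv e)) _.
apply: iso_trans (iso_whiskerl _ (Kid _)) _.
apply: iso_trans (shiftD _ _ _) _; apply: shift_iso.
by have := pairingD (u - v) c vP; rewrite subrK; lia.
Qed.

End Serre.

Theorem proposition2 (R : realType) (D : simply_laced_system R)
    (alpha beta : simple D) :
  let E := @Efun R D in let F := @Ffun R D in
  let K := @Kfun R D in let Kinv := @Kinvfun R D in
  let Id := adj_id D in
  let ab := pairing (val alpha) beta in
  (K alpha ∘ Kinv alpha ≅ Id /\ Id ≅ Kinv alpha ∘ K alpha) /\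
  K alpha ∘ K beta ≅ K beta ∘ K alpha /\
  K alpha ∘ E beta ≅ (E beta ∘ K alpha)⟦ab⟧ /\
  K alpha ∘ F beta ≅ (F beta ∘ K alpha)⟦- ab⟧ /\
  (alpha != beta -> E alpha ∘ F beta ≅ F beta ∘ E alpha) /\
  (sls_form (val alpha) (val beta) = 0 ->
     E alpha ∘ E beta ≅ E beta ∘ E alpha /\
     F alpha ∘ F beta ≅ F beta ∘ F alpha) /\
  (sls_form (val alpha) (val beta) = - 1 ->
     (E alpha ∘ E alpha ∘ E beta) ⊕ (E beta ∘ E alpha ∘ E alpha)
       ≅ (Id⟦1⟧ ⊕ Id⟦- 1⟧) ∘ (E alpha ∘ E beta ∘ E alpha) /\
     (F alpha ∘ F alpha ∘ F beta) ⊕ (F beta ∘ F alpha ∘ F alpha)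
       ≅ (Id⟦1⟧ ⊕ Id⟦- 1⟧) ∘ (F alpha ∘ F beta ∘ F alpha)).
Proof.
move=> E F K Kinv Id ab.
have neq c : sls_form (val alpha) (val beta) = c -> c < 2 -> alpha != beta.
  move=> e c2; apply: contraTneq c2 => ab'; rewrite -e ab' sls_norm ?ltxx //.
  exact: simple_root.
split; [split|split; [|split; [|split; [|split; [|split]]]]].
- exact: weight_shiftK.
- by apply/iso_sym/(weight_shiftK (-1)).
- exact: weight_shiftC.
- have -> : ab = pairing (val beta) alpha by rewrite /ab /pairing formC.
  exact: step_Kfun (Efun_step beta).
- have -> : - ab = pairing (- val beta) alpha.
    have := pairingD (- val beta) alpha (simple_root beta).
    by rewrite addNr pairing0 /ab /pairing (formC (val beta)); lia.
  exact: step_Kfun (Ffun_step beta).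
(* The roots are a and - b here, and (a, b) is 0 or -1. *)
- move=> ne; apply: (step_commute (Efun_step alpha) (Ffun_step beta) ne).
  by rewrite formNr dynkin_form //; case: (simple_form ne) => ->; [left|right];
    split; rewrite ?oppr0 ?opprK // eq_sym oppr_eq0 oner_eq0.
- move=> e; have ne := neq _ e (ltr0n _ 2).
  have nd : ~~ dynkin alpha beta by rewrite /dynkin e eqxx andbF.
  split; first by apply: (step_commute (Efun_step alpha) (Efun_step beta) ne); left.
  apply: (step_commute (Ffun_step alpha) (Ffun_step beta) ne); left.
  by rewrite !formE opprK.
move=> e; have ne : alpha != beta by apply: neq e _; lra.
have ne' : beta != alpha by rewrite eq_sym.
have d : dynkin alpha beta by rewrite dynkin_form // e.
have d' : dynkin beta alpha by rewrite dynkin_sym.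
have [_ /(_ d) line_ab /(_ d) plane] := zigzag_corners R[i] (@dynkin_irr R D)
  (@dynkin_sym R D) (@dynkin_connected R D) ne.
have [_ /(_ d') line_ba _] := zigzag_corners R[i] (@dynkin_irr R D)
  (@dynkin_sym R D) (@dynkin_connected R D) ne'.
split.
  exact: (step_serre (Efun_step alpha) (Efun_step beta)).
by apply: (step_serre (Ffun_step alpha) (Ffun_step beta)) => //; rewrite !formE opprK.
Qed.
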